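(* Let $x,a,b$ be real numbers with $b>a>0$, let $c=b-a$, and suppose $x\ge 40\,c^{-3}(1+b)^4$. Put $J=c^{3/5}(1+b)^{-4/5}x^{1/5}$. Then $$W(x;a,b)=\frac{2}{\pi}\,\zeta(3/2)\sqrt{cx}+\mathcal{R}(J,x;a,b)+O\big((1+b)^{2/5}c^{1/5}x^{2/5}\big),$$ where the implied constant is absolute.
   Context: $\{t\}=t-\lfloor t\rfloor$ is the fractional part of $t$, and $\zeta$ is the Riemann zeta function. For $x>0$ and $b>a>0$, with $c=b-a$: $$W(x;a,b)=\sum_{n\ge 0}\big|\{x/(n+a)\}-\{x/(n+b)\}\big|$$ (sum over integers $n\ge 0$; the series converges). For $t>0$, $K(t)$ is the largest integer $k$ such that $k(k+1)\le t$. For $t>0$ and an integer $j\ge 0$, $K_j(t)$ is the largest integer $k\ge j$ such that $(k-j)k\le jt$ (in particular $K_0(t)=0$). Define $$R_0(x;a,b)=\frac{c}{x}\sum_{1\le k\le K(x/c)}k^2\big(\{x/k-a\}-\{x/k-b\}\big),$$ and for integers $j\ge 1$ $$R_j(x;a,b)=\sum_{K_{j-1}(x/c)<k\le K_{j+1}(x/c)}(k^2c/x-j)\big(\{x/k-a\}-\{x/k-b\}\big).$$ For real $J\ge 0$, $\mathcal{R}(J,x;a,b)=\sum_{0\le j\le J}R_j(x;a,b)$, the sum being over integers $j$. *)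

(* Defs.v *)
From Stdlib Require Import Reals Lra Lia ClassicalEpsilon.
From Coquelicot Require Import Coquelicot.

Open Scope R_scope.

(* The Riemann zeta function on the half-line s > 1, by its Dirichlet series. *)
Definition zeta (s : R) : R :=
  Series (fun n : nat => / Rpower (INR (S n)) s).

Definition W (x a b : R) : R :=
  Series (fun n : nat =>
    Rabs (frac_part (x / (INR n + a)) - frac_part (x / (INR n + b)))).

Definition is_largest (P : nat -> Prop) (k : nat) : Prop :=
  P k /\ forall m : nat, P m -> (m <= k)%nat.

Definition largest (P : nat -> Prop) : nat :=
  epsilon (inhabits 0%nat) (is_largest P).

(* The largest integer k with k (k + 1) <= t.  Since k = 0 qualifies for t > 0,
   it is enough to search among the natural numbers. *)
Definition K (t : R) : nat :=
  largest (fun k => INR k * (INR k + 1) <= t).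

Definition Kj (j : nat) (t : R) : nat :=
  largest (fun k => (j <= k)%nat /\ (INR k - INR j) * INR k <= INR j * t).

(* In the range m < k <= n used below, sum_n_m f (S m) n is 0 when n <= m. *)
Definition Rj (j : nat) (x a b : R) : R :=
  let c := b - a in
  match j with
  | O =>
      c / x * sum_n_m (fun k : nat =>
        INR k ^ 2 * (frac_part (x / INR k - a) - frac_part (x / INR k - b)))
        1 (K (x / c))
  | S i =>
      sum_n_m (fun k : nat =>
        (INR k ^ 2 * c / x - INR j)
        * (frac_part (x / INR k - a) - frac_part (x / INR k - b)))
        (S (Kj i (x / c))) (Kj (S j) (x / c))
  end.

(* Meaningful for J >= 0, where Z.to_nat (Int_part J) is the floor of J. *)
Definition calR (J x a b : R) : R :=
  sum_n_m (fun j : nat => Rj j x a b) 0 (Z.to_nat (Int_part J)).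

(* K and Kj satisfy their defining properties. *)

Lemma largest_spec (P : nat -> Prop) (k0 N : nat) :
  P k0 -> (forall m, P m -> (m <= N)%nat) -> is_largest P (largest P).
Proof.
intros H0 HN.
apply (epsilon_spec (inhabits 0%nat) (is_largest P)).
revert HN; induction N as [|N IH]; intros HN.
- exists 0%nat; split; [|exact HN].
  assert (E : k0 = 0%nat) by (specialize (HN _ H0); lia).
  now rewrite <- E.
- destruct (excluded_middle_informative (P (S N))) as [H|H].
  + now exists (S N).
  + apply IH; intros m Hm.
    assert (m <> S N) by (intros ->; contradiction).
    specialize (HN m Hm); lia.
Qed.

Lemma K_spec (t : R) : 0 < t ->
  is_largest (fun k => INR k * (INR k + 1) <= t) (K t).
Proof.
intros Ht.
destruct (nfloor_ex t (Rlt_le _ _ Ht)) as [N [_ HN]].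
apply largest_spec with (k0 := 0%nat) (N := N).
- simpl; lra.
- intros m Hm.
  apply INR_le.
  destruct m as [|m]; [apply pos_INR|].
  apply le_INR.
  assert (1 <= INR (S m)) by (rewrite S_INR; pose proof (pos_INR m); lra).
  assert (INR (S m) < INR (S N)) by (rewrite (S_INR N); nra).
  apply INR_lt in H0; lia.
Qed.

Lemma Kj_spec (j : nat) (t : R) : 0 < t ->
  is_largest (fun k => (j <= k)%nat /\ (INR k - INR j) * INR k <= INR j * t)
    (Kj j t).
Proof.
intros Ht.
pose proof (pos_INR j) as Hj.
destruct (nfloor_ex (INR j + t)) as [N [_ HN]]; [lra|].
apply largest_spec with (k0 := j) (N := N).
- split; [lia|]. nra.
- intros m [Hjm Hm].
  apply le_INR in Hjm.
  assert (INR m < INR (S N)).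
  { rewrite (S_INR N).
    destruct (Rle_or_lt (INR m) (INR j + t)) as [H|H]; [lra|].
    exfalso.
    assert (t * INR m < (INR m - INR j) * INR m)
      by (apply Rmult_lt_compat_r; lra).
    nra. }
  apply INR_lt in H; lia.
Qed.

Lemma Kj_0 (t : R) : 0 < t -> Kj 0 t = 0%nat.
Proof.
intros Ht.
destruct (Kj_spec 0 t Ht) as [[_ H] _].
simpl in H.
apply INR_eq; simpl.
pose proof (pos_INR (Kj 0 t)); nra.
Qed.

(* The series defining zeta and W converge. *)

Lemma ex_series_telescope (u : nat -> R) :
  (forall n, u (S n) <= u n) -> (forall n, 0 <= u n) ->
  ex_series (fun n => u n - u (S n)).
Proof.
intros Hd Hp.
destruct (ex_finite_lim_seq_decr u 0 Hd Hp) as [l Hl].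
exists (u 0%nat - l).
change (is_lim_seq (sum_n (fun n => u n - u (S n))) (u 0%nat - l)).
apply (is_lim_seq_ext (fun n => u 0%nat - u (S n))
         (sum_n (fun n => u n - u (S n)))).
- intros n; induction n as [|n IH].
  + now rewrite sum_O.
  + rewrite sum_Sn, <- IH; unfold plus; simpl; ring.
- apply (is_lim_seq_minus' (fun _ => u 0%nat)).
  + apply is_lim_seq_const.
  + now apply -> is_lim_seq_incr_1.
Qed.

Lemma ex_series_zeta (s : R) : 1 < s ->
  ex_series (fun n : nat => / Rpower (INR (S n)) s).
Proof.
intros Hs.
set (u := fun n : nat => Rpower (INR (S n)) (1 - s)).
assert (Hpos : forall n, 0 < INR (S n)) by (intros; apply lt_0_INR; lia).
assert (Hu : forall n, (s - 1) * / Rpower (INR (S (S n))) s <= u n - u (S n)).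
{ intros n.
  destruct (MVT_cor2 (fun y => Rpower y (1 - s))
              (fun y => (1 - s) * Rpower y (1 - s - 1))
              (INR (S n)) (INR (S (S n)))) as [y [Hy1 Hy2]].
  - apply lt_INR; lia.
  - intros y Hy; apply derivable_pt_lim_power; specialize (Hpos n); lra.
  - unfold u.
    replace (INR (S (S n)) - INR (S n)) with 1 in Hy1
      by (rewrite (S_INR (S n)); ring).
    enough (/ Rpower (INR (S (S n))) s <= Rpower y (1 - s - 1)) by nra.
    replace (1 - s - 1) with (- s) by ring.
    rewrite Rpower_Ropp.
    apply Rinv_le_contravar; [apply exp_pos|].
    apply Rle_Rpower_l; [lra|].
    specialize (Hpos n); lra. }
assert (Hz : forall n, 0 < / Rpower (INR (S n)) s)
  by (intros; apply Rinv_0_lt_compat, exp_pos).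
apply ex_series_incr_1.
apply (ex_series_le (fun n => / Rpower (INR (S (S n))) s)
         (fun n => / (s - 1) * (u n - u (S n)))).
- intros n; unfold norm; simpl; unfold abs; simpl.
  rewrite Rabs_pos_eq by apply Rlt_le, (Hz (S n)).
  apply (Rmult_le_reg_l (s - 1)); [lra|].
  rewrite <- Rmult_assoc, Rinv_r, Rmult_1_l by lra.
  apply Hu.
- apply (ex_series_scal (/ (s - 1)) (fun n => u n - u (S n))).
  apply ex_series_telescope.
  + intros n. specialize (Hu n). specialize (Hz (S n)). nra.
  + intros n; apply Rlt_le, exp_pos.
Qed.

Lemma frac_part_small (y : R) : 0 <= y < 1 -> frac_part y = y.
Proof.
intros [H0 H1].
unfold frac_part, Int_part.
rewrite <- (tech_up y 1); [simpl; lra | simpl; lra | simpl; lra].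
Qed.

Lemma ex_series_W (x a b : R) : 0 < x -> 0 < a -> a < b ->
  ex_series (fun n : nat =>
    Rabs (frac_part (x / (INR n + a)) - frac_part (x / (INR n + b)))).
Proof.
intros Hx Ha Hab.
destruct (nfloor_ex x (Rlt_le _ _ Hx)) as [N [_ HN]].
apply (ex_series_incr_n _ (S N)).
apply (ex_series_le
  (fun k => Rabs (frac_part (x / (INR (S N + k) + a))
                  - frac_part (x / (INR (S N + k) + b))))
  (fun k => x * (b - a) * / Rpower (INR (S k)) 2)).
- intros k; unfold norm; simpl norm; unfold abs; simpl abs.
  rewrite Rabs_Rabsolu.
  set (n := INR (S N + k)).
  assert (Hn : x < n).
  { unfold n; rewrite plus_INR, S_INR. pose proof (pos_INR k); lra. }
  assert (Hk : INR (S k) <= n) by (apply le_INR; lia).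
  assert (Hk0 : 0 < INR (S k)) by (apply lt_0_INR; lia).
  assert (Hsm : forall d, 0 < d -> frac_part (x / (n + d)) = x / (n + d)).
  { intros d Hd; apply frac_part_small; split.
    - apply Rlt_le, Rdiv_lt_0_compat; lra.
    - apply Rlt_div_l; lra. }
  rewrite !Hsm by lra.
  replace (x / (n + a) - x / (n + b))
    with (x * (b - a) * / ((n + a) * (n + b))) by (field; lra).
  assert (0 < x * (b - a)) by (apply Rmult_lt_0_compat; lra).
  rewrite Rabs_pos_eq.
  + apply Rmult_le_compat_l; [lra|].
    replace 2 with (INR 2) by (simpl; ring).
    rewrite Rpower_pow by exact Hk0.
    apply Rinv_le_contravar; [apply pow_lt; exact Hk0 | nra].
  + apply Rmult_le_pos; [lra|].
    apply Rlt_le, Rinv_0_lt_compat; nra.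
- apply (ex_series_scal (x * (b - a)) (fun k => / Rpower (INR (S k)) 2)).
  apply ex_series_zeta; lra.
Qed.

(* Main.v *)
Require Import Defs.
From Stdlib Require Import Reals ZArith Lra Lia.
From Coquelicot Require Import Coquelicot.

Open Scope R_scope.

(* Let u = x / (n + a), v = x / (n + b), d = u - v, and let m be the number of integers
   in (v, u], so that {u} - {v} = d - m.  When j <= d < j + 1, m is j or j + 1, and
   |d - m| = (d - j) + (m - j) (1 - 2 (d - j)).  The n with d >= J are at most about
   sqrt (c x / J) in number, which is the size of the error term, and are dropped.
   For the others, the sum of m (1 - 2 (d - j)) is a sum over pairs (n, k) with
   v < k <= u; on such a pair d is close to k^2 c / x, and j is determined by the
   thresholds K_j up to O(j) values of k.  The number of n for a given k is
   c - ({x/k - a} - {x/k - b}), and summing over n first produces R(J, x; a, b).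
   The smooth parts left over are all sums of square roots: they add up to
   sqrt (c x) times 16/3 L^(3/2) + 4 sqrt L - 8 (sqrt 1 + ... + sqrt L), L = floor J,
   which tends to -8 zeta(-1/2) = 2/pi zeta(3/2).

   The value of this constant comes from the integral of {t} (1 - {t}) t^(-3/2), the
   Fourier series {t} (1 - {t}) = sum_k (1 - cos (2 pi k t)) / (pi k)^2, and the
   Fresnel integral. *)

(** * Finite sums *)

(** With t = x / c one has u v = d t exactly. So v < k <= u forces k^2 to be close to d t, and since
    (u - d) u = d t, the K_j are, up to rounding, the values of u at d = j: if d < j then u < K_j +
    1. For a pair with i <= d < i + 1 the weight 1 - 2 (d - i) is minus the sum of d - i and d - (i
    + 1). With d replaced by k^2 c / x, these two halves belong to R_i and R_(i+1); this is why the
    blocks of the R_j overlap, from K_(j-1) to K_(j+1). At the top, R_L reaches one block beyond the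
    pairs that are kept, and that half block needs a bound of its own. Passing from a cut in n to a
    cut in k costs O(j (1 + b)) pairs at the threshold j, and O(L^2 (1 + b)) in all. As J^5 (1 +
    b)^4 = c^3 x, the error term is exactly sqrt (c x / J) = J^2 (1 + b)^2 / c: this is the order of
    the number of dropped n, and it exceeds J^2 (1 + b) because c < 1 + b. *)

Fixpoint rsum (f : nat -> R) (n : nat) : R :=
  match n with
  | O => 0
  | S m => rsum f m + f m
  end.

Lemma rsum_S (f : nat -> R) (n : nat) : rsum f (S n) = rsum f n + f n.
Proof. reflexivity. Qed.

Lemma rsum_ext (f g : nat -> R) (n : nat) :
  (forall i, (i < n)%nat -> f i = g i) -> rsum f n = rsum g n.
Proof.
induction n as [|n IH]; intros H; simpl; [reflexivity|].
rewrite IH, H by (intros; try apply H; lia). reflexivity.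
Qed.

Lemma rsum_le (f g : nat -> R) (n : nat) :
  (forall i, (i < n)%nat -> f i <= g i) -> rsum f n <= rsum g n.
Proof.
induction n as [|n IH]; intros H; simpl; [lra|].
apply Rplus_le_compat; [apply IH; intros; apply H; lia|apply H; lia].
Qed.

Lemma rsum_plus (f g : nat -> R) (n : nat) :
  rsum (fun i => f i + g i) n = rsum f n + rsum g n.
Proof. induction n as [|n IH]; simpl; [ring|rewrite IH; ring]. Qed.

Lemma rsum_minus (f g : nat -> R) (n : nat) :
  rsum (fun i => f i - g i) n = rsum f n - rsum g n.
Proof. induction n as [|n IH]; simpl; [ring|rewrite IH; ring]. Qed.

Lemma rsum_scal (k : R) (f : nat -> R) (n : nat) :
  rsum (fun i => k * f i) n = k * rsum f n.
Proof. induction n as [|n IH]; simpl; [ring|rewrite IH; ring]. Qed.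

Lemma rsum_const (k : R) (n : nat) : rsum (fun _ => k) n = INR n * k.
Proof. induction n as [|n IH]; [simpl; ring|]. rewrite S_INR; simpl; rewrite IH; ring. Qed.

Lemma rsum_ge_0 (f : nat -> R) (n : nat) :
  (forall i, (i < n)%nat -> 0 <= f i) -> 0 <= rsum f n.
Proof.
intros H. replace 0 with (rsum (fun _ => 0) n) by (rewrite rsum_const; ring).
apply rsum_le, H.
Qed.

Lemma rsum_abs_le (f : nat -> R) (n : nat) :
  Rabs (rsum f n) <= rsum (fun i => Rabs (f i)) n.
Proof.
induction n as [|n IH]; simpl; [rewrite Rabs_R0; lra|].
apply Rle_trans with (1 := Rabs_triang _ _). lra.
Qed.

Lemma rsum_0 (f : nat -> R) : rsum f 0 = 0.
Proof. reflexivity. Qed.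

Lemma rsum_swap (f : nat -> nat -> R) (m n : nat) :
  rsum (fun i => rsum (fun j => f i j) m) n = rsum (fun j => rsum (fun i => f i j) n) m.
Proof.
induction n as [|n IH]; simpl.
- rewrite rsum_const. ring.
- rewrite IH, <- rsum_plus. reflexivity.
Qed.

Lemma rsum_range_le (f g : nat -> R) (p q : nat) : (p <= q)%nat ->
  (forall n, (p <= n < q)%nat -> f n <= g n) ->
  rsum f q - rsum f p <= rsum g q - rsum g p.
Proof.
intros Hpq; induction Hpq as [|q Hpq IH]; intros H; [lra|].
rewrite !rsum_S. specialize (IH ltac:(intros; apply H; lia)).
specialize (H q ltac:(lia)). lra.
Qed.

Lemma rsum_range_ext (f g : nat -> R) (p q : nat) : (p <= q)%nat ->
  (forall n, (p <= n < q)%nat -> f n = g n) ->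
  rsum f q - rsum f p = rsum g q - rsum g p.
Proof.
intros Hpq H. apply Rle_antisym; apply rsum_range_le; try exact Hpq;
  intros n Hn; rewrite (H n Hn); lra.
Qed.

Lemma rsum_range_telescope_le (f u : nat -> R) (p q : nat) : (p <= q)%nat ->
  (forall n, (p <= n < q)%nat -> f n <= u n - u (S n)) ->
  rsum f q - rsum f p <= u p - u q.
Proof.
intros Hpq H.
pose proof (rsum_range_le f (fun n => u n - u (S n)) p q Hpq H) as B.
assert (E : forall n, rsum (fun n => u n - u (S n)) n = u O - u n).
{ intros n; induction n as [|n IH]; simpl; [ring|rewrite IH; ring]. }
rewrite !E in B. lra.
Qed.

Lemma rsum_range_telescope_ge (f u : nat -> R) (p q : nat) : (p <= q)%nat ->
  (forall n, (p <= n < q)%nat -> u n - u (S n) <= f n) ->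
  u p - u q <= rsum f q - rsum f p.
Proof.
intros Hpq H.
pose proof (rsum_range_telescope_le (fun n => (-1) * f n) (fun n => - u n) p q Hpq) as B.
rewrite !rsum_scal in B.
enough (-1 * rsum f q - -1 * rsum f p <= - u p - - u q) by lra.
apply B. intros n Hn. specialize (H n Hn). lra.
Qed.

Lemma rsum_le_upper (f : nat -> R) (p q : nat) : (p <= q)%nat ->
  (forall n, (p <= n < q)%nat -> 0 <= f n) -> rsum f p <= rsum f q.
Proof.
intros Hpq H. pose proof (rsum_range_le (fun _ => 0) f p q Hpq H) as B.
rewrite !rsum_const in B. lra.
Qed.

Lemma rsum_close (f g : nat -> R) (k : R) (n : nat) :
  (forall i, (i < n)%nat -> Rabs (f i - g i) <= k) ->
  Rabs (rsum f n - rsum g n) <= INR n * k.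
Proof.
intros H. rewrite <- rsum_minus, <- rsum_const.
apply Rle_trans with (1 := rsum_abs_le _ _). apply rsum_le, H.
Qed.

Lemma rsum_sqr (n : nat) :
  rsum (fun i => INR (S i) ^ 2) n = INR n ^ 3 / 3 + INR n ^ 2 / 2 + INR n / 6.
Proof.
induction n as [|n IH]; [simpl; field|].
rewrite rsum_S, IH, S_INR. field.
Qed.

Lemma rsum_INR (n : nat) : rsum (fun i => INR (S i)) n = INR n * (INR n + 1) / 2.
Proof.
induction n as [|n IH]; [simpl; field|].
rewrite rsum_S, IH, S_INR. field.
Qed.

Lemma rsum_shift (f : nat -> R) (n : nat) :
  rsum f (S n) = f O + rsum (fun i => f (S i)) n.
Proof.
induction n as [|n IH]; [simpl; ring|].
rewrite rsum_S, IH, rsum_S. ring.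
Qed.

Lemma rsum_range_const (f : nat -> R) (k : R) (p q : nat) : (p <= q)%nat ->
  (forall n, (p <= n < q)%nat -> f n <= k) ->
  rsum f q - rsum f p <= (INR q - INR p) * k.
Proof.
intros Hpq H. pose proof (rsum_range_le f (fun _ => k) p q Hpq H) as B.
rewrite !rsum_const in B. lra.
Qed.

Lemma sum_n_m_rsum (f : nat -> R) (p q : nat) : (p <= q)%nat ->
  sum_n_m f (S p) q = rsum (fun i => f (S i)) q - rsum (fun i => f (S i)) p.
Proof.
intros Hpq; induction Hpq as [|q Hpq IH].
- rewrite sum_n_m_zero by lia. unfold zero; simpl. ring.
- rewrite sum_n_Sm by lia. rewrite IH, rsum_S. unfold plus; simpl. ring.
Qed.

Lemma sum_n_m_0_rsum (f : nat -> R) (n : nat) : sum_n_m f 0 n = rsum f (S n).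
Proof.
induction n as [|n IH].
- rewrite sum_n_n. simpl. ring.
- rewrite sum_n_Sm by lia. rewrite IH. reflexivity.
Qed.

(** * Fresnel integrals *)

(* The phases 0 and - PI / 2 give the cosine and the sine integral. *)
Definition fresnel (p T : R) : R := RInt (fun x => cos (x ^ 2 + p)) 0 T.

(** The auxiliary function of a classical proof of the Gaussian integral, the integral of exp (- T^2
    (1 + y^2)) / (1 + y^2) over [0, 1], with an imaginary exponent. *)
Definition fresnel_rem (p T : R) : R :=
  RInt (fun y => cos (T ^ 2 * (1 + y ^ 2) + p) / (1 + y ^ 2)) 0 1.

Lemma one_plus_sqr_neq_0 (y : R) : 1 + y ^ 2 <> 0.
Proof. pose proof (pow2_ge_0 y); lra. Qed.

Lemma continuous_fresnel_integrand (p x : R) :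
  continuous (fun x => cos (x ^ 2 + p)) x.
Proof.
apply (ex_derive_continuous (fun x => cos (x ^ 2 + p))). auto_derive; trivial.
Qed.

Lemma ex_RInt_fresnel (p u v : R) : ex_RInt (fun x => cos (x ^ 2 + p)) u v.
Proof.
apply (ex_RInt_continuous (V := R_CompleteNormedModule)).
intros; apply continuous_fresnel_integrand.
Qed.

Lemma is_derive_fresnel (p T : R) : is_derive (fresnel p) T (cos (T ^ 2 + p)).
Proof.
apply (is_derive_RInt (fun x => cos (x ^ 2 + p)) (fresnel p) 0).
- apply filter_forall; intros y.
  apply (RInt_correct (V := R_CompleteNormedModule)), ex_RInt_fresnel.
- apply continuous_fresnel_integrand.
Qed.

Lemma fresnel_0 (p : R) : fresnel p 0 = 0.
Proof. exact (RInt_point (V := R_CompleteNormedModule) 0 _). Qed.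

Lemma fresnel_scale (p T : R) :
  fresnel p T = T * RInt (fun y => cos (T ^ 2 * y ^ 2 + p)) 0 1.
Proof.
unfold fresnel.
pose proof (RInt_comp_lin (fun x => cos (x ^ 2 + p)) T 0 0 1) as H.
rewrite Rmult_0_r, Rplus_0_r, Rmult_1_r, Rplus_0_r in H.
rewrite <- H by apply ex_RInt_fresnel.
rewrite <- (RInt_scal (V := R_CompleteNormedModule)
  (fun y => cos (T ^ 2 * y ^ 2 + p))).
- apply RInt_ext; intros y _. unfold scal; simpl; unfold mult; simpl.
  do 2 f_equal. ring.
- apply (ex_RInt_continuous (V := R_CompleteNormedModule)); intros z _.
  apply (ex_derive_continuous (fun y => cos (T ^ 2 * y ^ 2 + p))).
  auto_derive; trivial.
Qed.

(** Every phase is thereby expressed through the phases p and p - PI / 2, since cos (z - PI / 2) =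
    sin z. *)
Lemma fresnel_add (p q T : R) :
  fresnel (p + q) T = cos q * fresnel p T - sin q * fresnel (p - PI / 2) T.
Proof.
unfold fresnel.
rewrite <- !(RInt_scal (V := R_CompleteNormedModule)) by apply ex_RInt_fresnel.
rewrite <- (RInt_minus (V := R_CompleteNormedModule)).
- apply RInt_ext; intros x _.
  unfold minus, plus, opp, scal; simpl; unfold mult; simpl.
  replace (x * (x * 1) + (p - PI / 2)) with (x * (x * 1) + p - PI / 2) by ring.
  rewrite (cos_minus _ (PI / 2)), cos_PI2, sin_PI2.
  replace (x * (x * 1) + (p + q)) with (x * (x * 1) + p + q) by ring.
  rewrite cos_plus. ring.
- apply @ex_RInt_scal, ex_RInt_fresnel.
- apply @ex_RInt_scal, ex_RInt_fresnel.
Qed.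

Lemma continuous_fresnel_rem_integrand (p T y : R) :
  continuous (fun y => cos (T ^ 2 * (1 + y ^ 2) + p) / (1 + y ^ 2)) y.
Proof.
apply (ex_derive_continuous
  (fun y => cos (T ^ 2 * (1 + y ^ 2) + p) / (1 + y ^ 2))).
auto_derive. pose proof (one_plus_sqr_neq_0 y) as H; simpl in H; exact H.
Qed.

(** Differentiating under the integral sign brings out the factor 1 + y^2, which cancels the
    denominator; what is left is T times the integral of a cosine in T^2 y^2, a Fresnel integral by
    [fresnel_scale]. *)
Lemma is_derive_fresnel_rem (p T : R) :
  is_derive (fresnel_rem p) T (- 2 * fresnel (T ^ 2 + p - PI / 2) T).
Proof.
assert (D : forall T y, is_derive
  (fun T => cos (T ^ 2 * (1 + y ^ 2) + p) / (1 + y ^ 2)) T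
  (- 2 * T * sin (T ^ 2 * (1 + y ^ 2) + p))).
{ intros T0 y. pose proof (one_plus_sqr_neq_0 y) as H.
  auto_derive; [trivial|]. simpl in H |- *; field; lra. }
replace (- 2 * fresnel (T ^ 2 + p - PI / 2) T)
  with (RInt (fun y => Derive
    (fun T => cos (T ^ 2 * (1 + y ^ 2) + p) / (1 + y ^ 2)) T) 0 1).
- apply (is_derive_RInt_param
    (fun T y => cos (T ^ 2 * (1 + y ^ 2) + p) / (1 + y ^ 2)) 0 1 T).
  + apply filter_forall; intros T0 y _. eexists; apply D.
  + intros y _.
    apply continuity_2d_pt_ext with
      (fun T y => - 2 * T * sin (T ^ 2 * (1 + y ^ 2) + p)).
    { intros u v. symmetry; apply is_derive_unique, D. }
    repeat first
      [ apply (continuity_1d_2d_pt_comp sin); [apply continuity_sin|]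
      | apply continuity_2d_pt_mult
      | apply continuity_2d_pt_plus
      | apply continuity_2d_pt_const
      | apply continuity_2d_pt_id1
      | apply continuity_2d_pt_id2 ].
  + apply filter_forall; intros T0.
    apply (ex_RInt_continuous (V := R_CompleteNormedModule)); intros.
    apply continuous_fresnel_rem_integrand.
- rewrite fresnel_scale.
  rewrite <- Rmult_assoc.
  rewrite <- (RInt_scal (V := R_CompleteNormedModule)).
  + apply RInt_ext; intros y _. etransitivity; [apply is_derive_unique, D|].
    unfold scal; simpl; unfold mult; simpl.
    replace (T * (T * 1) * (y * (y * 1)) + (T * (T * 1) + p - PI / 2))
      with (T * (T * 1) * (1 + y * (y * 1)) + p - PI / 2) by ring.
    rewrite (cos_minus _ (PI / 2)), cos_PI2, sin_PI2. ring.
  + apply (ex_RInt_continuous (V := R_CompleteNormedModule)); intros z _.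
    apply (ex_derive_continuous
      (fun y => cos (T ^ 2 * y ^ 2 + (T ^ 2 + p - PI / 2)))).
    auto_derive; trivial.
Qed.

Lemma is_derive_zero_const (f : R -> R) :
  (forall x, is_derive f x 0) -> forall x y, f x = f y.
Proof.
intros H x y.
destruct (MVT_gen f x y (fun _ => 0)) as [z [_ E]].
- intros; apply H.
- intros z _. apply derivable_continuous_pt. exists 0. apply is_derive_Reals, H.
- lra.
Qed.

Lemma atan_RInt : RInt (fun y => / (1 + y ^ 2)) 0 1 = PI / 4.
Proof.
apply is_RInt_unique.
replace (PI / 4) with (minus (atan 1) (atan 0))
  by (rewrite atan_1, atan_0; unfold minus, plus, opp; simpl; ring).
apply (is_RInt_derive atan).
- intros y _.
  apply is_derive_Reals, derivable_pt_lim_atan.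
- intros y _. apply (ex_derive_continuous (fun y => / (1 + y ^ 2))).
  auto_derive. pose proof (one_plus_sqr_neq_0 y) as H; simpl in H; exact H.
Qed.

(* With G = int_0^T exp(i x^2), both G^2 and
   i * int_0^1 exp(i T^2 (1 + y^2)) / (1 + y^2) have derivatives cancelling each
   other; the next two lemmas are the real and imaginary parts of
   [G^2 + i * remainder = i PI / 4]. *)
Lemma fresnel_sqr_sub (T : R) :
  fresnel 0 T ^ 2 - fresnel (- (PI / 2)) T ^ 2 = fresnel_rem (- (PI / 2)) T.
Proof.
enough (E : fresnel 0 T ^ 2 - fresnel (- (PI / 2)) T ^ 2
  - fresnel_rem (- (PI / 2)) T = 0) by lra.
rewrite (is_derive_zero_const (fun T => fresnel 0 T ^ 2
  - fresnel (- (PI / 2)) T ^ 2 - fresnel_rem (- (PI / 2)) T)) with (y := 0).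
- rewrite !fresnel_0. unfold fresnel_rem.
  transitivity (0 ^ 2 - 0 ^ 2 - RInt (fun _ : R => 0) 0 1).
  + f_equal. apply RInt_ext; intros y _.
    replace (0 ^ 2 * (1 + y ^ 2) + - (PI / 2)) with (- (PI / 2)) by ring.
    rewrite cos_neg, cos_PI2. unfold Rdiv; apply Rmult_0_l.
  + rewrite RInt_const. change (0 ^ 2 - 0 ^ 2 - (1 - 0) * 0 = 0). ring.
- clear T; intros T.
  evar_last.
  + apply (is_derive_minus (fun T => fresnel 0 T ^ 2 - fresnel (- (PI / 2)) T ^ 2)
      (fresnel_rem (- (PI / 2)))).
    * apply (is_derive_minus (fun T => fresnel 0 T ^ 2)
        (fun T => fresnel (- (PI / 2)) T ^ 2)).
      -- apply is_derive_pow, is_derive_fresnel.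
      -- apply is_derive_pow, is_derive_fresnel.
    * apply is_derive_fresnel_rem.
  + unfold minus, plus, opp; simpl.
    replace (T * (T * 1) + - (PI / 2) - PI / 2) with (0 + (T ^ 2 - PI)) by (simpl; field).
    rewrite fresnel_add.
    replace (T ^ 2 - PI) with (- PI + T ^ 2) by ring.
    replace (T * (T * 1) + - (PI / 2)) with (- (PI / 2) + T ^ 2) by (simpl; field).
    replace (T * (T * 1) + 0) with (T ^ 2) by ring.
    rewrite !cos_plus, !sin_plus, !cos_neg, !sin_neg, cos_PI2, sin_PI2,
      cos_PI, sin_PI, Rminus_0_l.
    simpl. ring.
Qed.

Lemma fresnel_mul (T : R) :
  2 * fresnel 0 T * fresnel (- (PI / 2)) T = PI / 4 - fresnel_rem 0 T.
Proof.
enough (E : 2 * fresnel 0 T * fresnel (- (PI / 2)) T + fresnel_rem 0 T = PI / 4) by lra.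
rewrite (is_derive_zero_const (fun T =>
  2 * fresnel 0 T * fresnel (- (PI / 2)) T + fresnel_rem 0 T)) with (y := 0).
- rewrite !fresnel_0. unfold fresnel_rem.
  transitivity (2 * 0 * 0 + RInt (fun y => / (1 + y ^ 2)) 0 1).
  + f_equal. apply RInt_ext; intros y _.
    replace (0 ^ 2 * (1 + y ^ 2) + 0) with 0 by ring.
    rewrite cos_0. apply Rmult_1_l.
  + rewrite atan_RInt. ring.
- clear T; intros T.
  evar_last.
  + apply (is_derive_plus (fun T => 2 * fresnel 0 T * fresnel (- (PI / 2)) T)
      (fresnel_rem 0)).
    * apply (is_derive_mult (fun T => 2 * fresnel 0 T)
        (fun T => fresnel (- (PI / 2)) T)).
      -- apply is_derive_scal, is_derive_fresnel.
      -- apply is_derive_fresnel.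
      -- intros; apply Rmult_comm.
    * apply is_derive_fresnel_rem.
  + unfold plus, mult; simpl.
    replace (T * (T * 1) + 0 - PI / 2) with (0 + (- (PI / 2) + T ^ 2)) by (simpl; field).
    rewrite fresnel_add.
    replace (T * (T * 1) + - (PI / 2)) with (- (PI / 2) + T ^ 2) by (simpl; field).
    replace (T * (T * 1) + 0) with (T ^ 2) by ring.
    rewrite !cos_plus, !sin_plus, !cos_neg, !sin_neg, cos_PI2, sin_PI2, Rminus_0_l.
    simpl. ring.
Qed.

Lemma mean_value_bound (f df : R -> R) (a b K : R) : a <= b ->
  (forall x, a <= x <= b -> is_derive f x (df x)) ->
  (forall x, a <= x <= b -> Rabs (df x) <= K) ->
  Rabs (f b - f a) <= K * (b - a).
Proof.
intros Hab D B.
destruct (MVT_gen f a b df) as [z [Hz E]].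
- rewrite Rmin_left, Rmax_right by exact Hab. intros; apply D; lra.
- rewrite Rmin_left, Rmax_right by exact Hab. intros z Hz.
  apply derivable_continuous_pt. exists (df z). apply is_derive_Reals, D, Hz.
- rewrite Rmin_left, Rmax_right in Hz by exact Hab.
  rewrite E, Rabs_mult, (Rabs_pos_eq (b - a)) by lra.
  apply Rmult_le_compat_r; [lra|]. apply B, Hz.
Qed.

Lemma Rabs_sin_le_1 (x : R) : Rabs (sin x) <= 1.
Proof. apply Rabs_le, SIN_bound. Qed.

Lemma Rabs_cos_le_1 (x : R) : Rabs (cos x) <= 1.
Proof. apply Rabs_le, COS_bound. Qed.

(* Trivial bound on [0, d], integration by parts on [d, 1]. *)
Lemma fresnel_rem_bound_split (p T d : R) : 0 < T -> 0 < d < 1 ->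
  Rabs (fresnel_rem p T) <= d + 2 / (T ^ 2 * d ^ 2).
Proof.
intros HT Hd.
set (f := fun y => cos (T ^ 2 * (1 + y ^ 2) + p) / (1 + y ^ 2)).
assert (If : forall u v, ex_RInt f u v).
{ intros; apply (ex_RInt_continuous (V := R_CompleteNormedModule)).
  intros; apply continuous_fresnel_rem_integrand. }
unfold fresnel_rem. fold f.
rewrite <- (RInt_Chasles f 0 d 1) by apply If.
apply Rle_trans with (1 := Rabs_triang (RInt f 0 d) (RInt f d 1)).
assert (T2 : 0 < T ^ 2) by (apply pow_lt; exact HT).
apply Rplus_le_compat.
- replace d with ((d - 0) * 1) at 2 by ring.
  apply abs_RInt_le_const; [lra|apply If|].
  intros y _. unfold f, Rdiv. rewrite Rabs_mult.
  rewrite <- (Rmult_1_l 1). apply Rmult_le_compat; try apply Rabs_pos.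
  + apply Rabs_cos_le_1.
  + rewrite Rabs_inv, Rabs_pos_eq by (pose proof (pow2_ge_0 y); lra).
    rewrite <- Rinv_1. apply Rinv_le_contravar; [lra|].
    pose proof (pow2_ge_0 y); lra.
(* Boundary term of the integration by parts: the derivative of the sine brings out 2 T^2 y. *)
- set (g := fun y => sin (T ^ 2 * (1 + y ^ 2) + p) * / (2 * T ^ 2 * y * (1 + y ^ 2))).
  assert (Bg : forall y, d <= y <= 1 -> Rabs (g y) <= / (2 * T ^ 2 * d)).
  { intros y Hy. unfold g. rewrite Rabs_mult.
    rewrite <- (Rmult_1_l (/ (2 * T ^ 2 * d))).
    apply Rmult_le_compat; try apply Rabs_pos; [apply Rabs_sin_le_1|].
    assert (0 < 2 * T ^ 2 * d) by (repeat apply Rmult_lt_0_compat; lra).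
    assert (2 * T ^ 2 * d <= 2 * T ^ 2 * y * (1 + y ^ 2)).
    { assert (2 * T ^ 2 * d <= 2 * T ^ 2 * y) by (apply Rmult_le_compat_l; lra).
      pose proof (pow2_ge_0 y). nra. }
    rewrite Rabs_inv, Rabs_pos_eq by lra.
    apply Rinv_le_contravar; lra. }
  (* Only the integrated-by-parts remainder survives in the derivative of [F]; it is at most 1 /
     (T^2 y^2), so a mean value bound does the work of an integral estimate. *)
  set (F := fun z => RInt f d z - g z).
  assert (Fb : Rabs (F 1 - F d) <= / (T ^ 2 * d ^ 2) * (1 - d)).
  { apply (mean_value_bound F (fun y => sin (T ^ 2 * (1 + y ^ 2) + p)
      * ((1 + 3 * y ^ 2) / (2 * T ^ 2 * y ^ 2 * (1 + y ^ 2) ^ 2)))); [lra| |].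
    - intros y Hy. unfold F.
      pose proof (one_plus_sqr_neq_0 y) as Hy1.
      evar_last.
      + apply (is_derive_minus (fun z => RInt f d z) g).
        * apply (is_derive_RInt f (fun z => RInt f d z) d).
          -- apply filter_forall; intros z.
             apply (RInt_correct (V := R_CompleteNormedModule)), If.
          -- apply continuous_fresnel_rem_integrand.
        * unfold g. auto_derive; [|reflexivity].
          simpl in Hy1, T2; repeat apply Rmult_integral_contrapositive_currified; lra.
      + unfold f, minus, plus, opp; simpl. field. simpl in Hy1.
        repeat split; lra.
    - intros y Hy. rewrite Rabs_mult.
      rewrite <- (Rmult_1_l (/ _)).
      apply Rmult_le_compat; try apply Rabs_pos; [apply Rabs_sin_le_1|].
      assert (0 < T ^ 2 * d ^ 2) by (apply Rmult_lt_0_compat; [|apply pow_lt]; lra).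
      assert (T ^ 2 * d ^ 2 <= T ^ 2 * y ^ 2)
        by (apply Rmult_le_compat_l; [lra|apply pow_incr; lra]).
      pose proof (pow2_ge_0 y).
      assert (0 < (1 + y ^ 2) ^ 2) by (apply pow_lt; lra).
      rewrite Rabs_pos_eq.
      + apply Rle_trans with (/ (T ^ 2 * y ^ 2)).
        * apply Rle_div_l.
          { apply Rlt_gt, Rmult_lt_0_compat; [|lra].
            replace (2 * T ^ 2 * y ^ 2) with (2 * (T ^ 2 * y ^ 2)) by ring. lra. }
          replace (/ (T ^ 2 * y ^ 2) * (2 * T ^ 2 * y ^ 2 * (1 + y ^ 2) ^ 2))
            with (2 * (1 + y ^ 2) ^ 2); [nra|].
          field. split; lra.
        * apply Rinv_le_contravar; lra.
      + apply Rdiv_le_0_compat; [lra|].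
        apply Rmult_lt_0_compat; [|lra].
        replace (2 * T ^ 2 * y ^ 2) with (2 * (T ^ 2 * y ^ 2)) by ring. lra. }
  assert (E : (F 1 - F d) + g 1 - g d = RInt f d 1).
  { assert (E0 : F d = - g d).
    { unfold F. rewrite RInt_point. apply Rminus_0_l. }
    rewrite E0. unfold F. ring. }
  rewrite <- E.
  pose proof (Bg 1 ltac:(lra)) as B1. pose proof (Bg d ltac:(lra)) as Bd.
  assert (0 < T ^ 2 * d ^ 2) by (apply Rmult_lt_0_compat; [|apply pow_lt]; lra).
  assert (P2 : / (2 * T ^ 2 * d) = d / 2 * / (T ^ 2 * d ^ 2)) by (field; lra).
  assert (0 < / (T ^ 2 * d ^ 2)) by (apply Rinv_0_lt_compat; lra).
  rewrite P2 in B1, Bd.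
  unfold Rdiv.
  apply Rabs_le_between in Fb, B1, Bd. apply Rabs_le.
  nra.
Qed.

(** The split point d = 1 / sqrt T makes T^2 d^2 equal to T. It is not the optimal choice; any decay
    suffices for the limit. *)
Lemma fresnel_rem_bound (p T : R) : 1 < T -> Rabs (fresnel_rem p T) <= 3 / sqrt T.
Proof.
intros HT.
assert (Hs : 1 < sqrt T) by (rewrite <- sqrt_1; apply sqrt_lt_1; lra).
assert (Hi : 0 < / sqrt T < 1).
{ split; [apply Rinv_0_lt_compat; lra|]. rewrite <- Rinv_1.
  apply Rinv_lt_contravar; lra. }
apply Rle_trans with (1 := fresnel_rem_bound_split p T (/ sqrt T) ltac:(lra) Hi).
pose proof (sqrt_sqrt T ltac:(lra)) as E.
replace (T ^ 2 * (/ sqrt T) ^ 2) with (sqrt T ^ 2).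
- assert (2 / sqrt T ^ 2 <= 2 / sqrt T).
  { apply Rmult_le_compat_l; [lra|]. apply Rinv_le_contravar; nra. }
  unfold Rdiv in *; lra.
- replace T with (sqrt T * sqrt T) at 2 by exact E. field. lra.
Qed.

Lemma is_lim_fresnel_rem (p : R) : is_lim (fresnel_rem p) p_infty 0.
Proof.
apply (is_lim_le_le_loc (fun T => - (3 * / sqrt T)) (fun T => 3 * / sqrt T)).
- exists 1; intros T HT. apply Rabs_le_between, fresnel_rem_bound, HT.
- evar_last; [apply is_lim_opp, is_lim_scal_l|].
  + apply is_lim_inv; [apply is_lim_sqrt_p, is_lim_id|discriminate].
  + simpl; f_equal; ring.
- evar_last; [apply is_lim_scal_l|].
  + apply is_lim_inv; [apply is_lim_sqrt_p, is_lim_id|discriminate].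
  + simpl; f_equal; ring.
Qed.

(** Stands in for monotonicity of the integral: the integrals compared below all have explicit
    primitives. *)
Lemma le_of_derive_le (f g df dg : R -> R) (a b : R) : a <= b ->
  (forall x, a <= x <= b -> is_derive f x (df x)) ->
  (forall x, a <= x <= b -> is_derive g x (dg x)) ->
  (forall x, a <= x <= b -> df x <= dg x) ->
  f b - f a <= g b - g a.
Proof.
intros Hab Df Dg Hle.
assert (D : forall x, a <= x <= b -> is_derive (fun x => g x - f x) x (dg x - df x)).
{ intros x Hx. apply (is_derive_minus g f); auto. }
destruct (MVT_gen (fun x => g x - f x) a b (fun x => dg x - df x)) as [z [Hz E]].
- rewrite Rmin_left, Rmax_right by exact Hab. intros; apply D; lra.
- rewrite Rmin_left, Rmax_right by exact Hab. intros z Hz.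
  apply derivable_continuous_pt. exists (dg z - df z). apply is_derive_Reals, D, Hz.
- rewrite Rmin_left, Rmax_right in Hz by exact Hab.
  specialize (Hle z Hz).
  assert (0 <= (dg z - df z) * (b - a)) by (apply Rmult_le_pos; lra).
  lra.
Qed.

Lemma one_minus_cos_le (u : R) : 0 <= u -> 1 - cos u <= u.
Proof.
intros Hu.
pose proof (le_of_derive_le (fun x => - cos x) (fun x => x) sin (fun _ => 1) 0 u Hu) as H.
cbv beta in H; rewrite cos_0 in H.
enough (- cos u - - (1) <= u - 0) by lra.
apply H.
- intros; auto_derive; [trivial|ring].
- intros; auto_derive; [trivial|ring].
- intros; apply SIN_bound.
Qed.

Lemma fresnel_abs_le (p T : R) : 0 <= T -> Rabs (fresnel p T) <= T.
Proof.
intros HT.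
replace (fresnel p T) with (fresnel p T - fresnel p 0) by (rewrite fresnel_0; ring).
replace T with (1 * (T - 0)) at 2 by ring.
apply (mean_value_bound _ (fun x => cos (x ^ 2 + p))); [exact HT| |].
- intros; apply is_derive_fresnel.
- intros; apply Rabs_cos_le_1.
Qed.

(* Primitive of [2 (1 - cos (al y^2)) / y^2] on (0, oo), vanishing at 0. *)
Definition osc (al y : R) : R :=
  4 * sqrt al * fresnel (- (PI / 2)) (sqrt al * y) - 2 * (1 - cos (al * y ^ 2)) / y.

Lemma is_derive_osc (al y : R) : 0 < al -> 0 < y ->
  is_derive (osc al) y (2 * (1 - cos (al * y ^ 2)) / y ^ 2).
Proof.
intros Ha Hy.
unfold osc.
evar_last.
- apply (is_derive_minus
    (fun y => 4 * sqrt al * fresnel (- (PI / 2)) (sqrt al * y))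
    (fun y => 2 * (1 - cos (al * y ^ 2)) / y)).
  + apply is_derive_scal.
    apply (is_derive_comp (fresnel (- (PI / 2))) (fun y => sqrt al * y)).
    * apply is_derive_fresnel.
    * auto_derive; [trivial|reflexivity].
  + auto_derive; [lra|reflexivity].
- unfold minus, plus, opp, scal; simpl; unfold mult; simpl.
  replace (sqrt al * y * (sqrt al * y * 1) + - (PI / 2))
    with (sqrt al * sqrt al * (y * (y * 1)) - PI / 2) by ring.
  rewrite sqrt_sqrt by lra.
  rewrite cos_minus, cos_PI2, sin_PI2.
  generalize (sin (al * (y * (y * 1)))) (cos (al * (y * (y * 1)))); intros s k.
  pose proof (sqrt_sqrt al ltac:(lra)) as E.
  rewrite <- E at 3. field. lra.
Qed.

Lemma osc_abs_le (al y : R) : 0 < al -> 0 < y -> Rabs (osc al y) <= 6 * al * y.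
Proof.
intros Ha Hy.
assert (Hs : 0 < sqrt al) by (apply sqrt_lt_R0, Ha).
pose proof (fresnel_abs_le (- (PI / 2)) (sqrt al * y)
  ltac:(apply Rlt_le, Rmult_lt_0_compat; lra)) as HF.
pose proof (sqrt_sqrt al ltac:(lra)) as E.
assert (H1 : 0 <= 2 * (1 - cos (al * y ^ 2)) / y <= 2 * al * y).
{ pose proof (COS_bound (al * y ^ 2)).
  pose proof (one_minus_cos_le (al * y ^ 2)
    ltac:(apply Rmult_le_pos; [lra|apply pow2_ge_0])).
  split.
  - apply Rdiv_le_0_compat; lra.
  - apply Rle_div_l; [exact Hy|]. nra. }
unfold osc. apply Rabs_le. apply Rabs_le_between in HF.
replace (4 * sqrt al * fresnel (- (PI / 2)) (sqrt al * y))
  with (sqrt al * (4 * fresnel (- (PI / 2)) (sqrt al * y))) by ring.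
assert (H2 : - (4 * al * y) <= sqrt al * (4 * fresnel (- (PI / 2)) (sqrt al * y))
  <= 4 * al * y).
{ replace (4 * al * y) with (sqrt al * (4 * (sqrt al * y)))
    by (replace al with (sqrt al * sqrt al) at 3 by exact E; ring).
  rewrite Ropp_mult_distr_r.
  split; apply Rmult_le_compat_l; lra. }
lra.
Qed.

(** The derivative is nonnegative and [osc al] tends to 0 at 0 by [osc_abs_le]. Starting from a
    small positive z avoids the singular point. *)
Lemma osc_ge_0 (al y : R) : 0 < al -> 0 < y -> 0 <= osc al y.
Proof.
intros Ha Hy.
apply le_epsilon; intros e He.
set (z := Rmin y (e / (6 * al))).
assert (Hz : 0 < z).
{ apply Rmin_glb_lt; [lra|]. apply Rdiv_lt_0_compat; lra. }
assert (Hzy : z <= y) by apply Rmin_l.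
assert (Hze : 6 * al * z <= e).
{ rewrite Rmult_comm. apply Rle_div_r; [lra|apply Rmin_r]. }
pose proof (osc_abs_le al z Ha Hz) as B. apply Rabs_le_between in B.
pose proof (le_of_derive_le (fun _ => 0) (osc al) (fun _ => 0)
  (fun y => 2 * (1 - cos (al * y ^ 2)) / y ^ 2) z y Hzy) as H.
enough (0 - 0 <= osc al y - osc al z) by lra.
apply H.
- intros; apply @is_derive_const.
- intros; apply is_derive_osc; lra.
- intros x Hx. pose proof (COS_bound (al * x ^ 2)).
  apply Rdiv_le_0_compat; [lra|apply pow_lt; lra].
Qed.

(** Integration by parts turns the sine integral into that of the nonnegative function (1 - cos z^2)
    / z^2, which is what [osc 1] records. The sign is needed to recover the integral from its
    square. *)
Lemma fresnel_sin_ge_0 (T : R) : 0 < T -> 0 <= fresnel (- (PI / 2)) T.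
Proof.
intros HT.
pose proof (osc_ge_0 1 T Rlt_0_1 HT) as H.
unfold osc in H. rewrite sqrt_1, Rmult_1_l in H.
assert (0 <= 2 * (1 - cos (1 * T ^ 2)) / T).
{ pose proof (COS_bound (1 * T ^ 2)). apply Rdiv_le_0_compat; lra. }
lra.
Qed.

(** With G = C + i S, S^2 is half of |G^2| - Re G^2. The real and imaginary parts of G^2 tend to 0
    and PI / 4, so S^2 tends to PI / 8. *)
Lemma is_lim_fresnel_sin : is_lim (fresnel (- (PI / 2))) p_infty (sqrt (PI / 8)).
Proof.
pose proof PI_RGT_0 as Hpi.
set (v := fun T => (sqrt (fresnel_rem (- (PI / 2)) T ^ 2
   + (PI / 4 - fresnel_rem 0 T) ^ 2) - fresnel_rem (- (PI / 2)) T) / 2).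
apply (is_lim_ext_loc (fun T => sqrt (v T))).
{ exists 0; intros T HT.
  pose proof (fresnel_sin_ge_0 T HT) as HS.
  unfold v. rewrite <- fresnel_mul, <- fresnel_sqr_sub.
  set (S := fresnel (- (PI / 2)) T) in *. set (C := fresnel 0 T).
  replace ((C ^ 2 - S ^ 2) ^ 2 + (2 * C * S) ^ 2) with ((C ^ 2 + S ^ 2) ^ 2) by ring.
  rewrite sqrt_pow2 by (pose proof (pow2_ge_0 C); pose proof (pow2_ge_0 S); lra).
  replace ((C ^ 2 + S ^ 2 - (C ^ 2 - S ^ 2)) / 2) with (S ^ 2) by field.
  apply sqrt_pow2, HS. }
assert (Lr : forall f l, is_lim f p_infty (Finite l) ->
   is_lim (fun T => sqrt (f T)) p_infty (sqrt l)).
{ intros f l Hf.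
  apply (filterlim_comp _ _ _ f sqrt _ (locally l)); [exact Hf|].
  apply continuous_sqrt. }
assert (Lm : forall f g l m, is_lim f p_infty (Finite l) -> is_lim g p_infty (Finite m) ->
   is_lim (fun T => f T * g T) p_infty (l * m)).
{ intros f g l m Hf Hg. exact (is_lim_mult f g p_infty l m Hf Hg I). }
apply Lr.
unfold v.
apply (is_lim_ext (fun T => / 2 * (sqrt (fresnel_rem (- (PI / 2)) T
    * fresnel_rem (- (PI / 2)) T
   + (PI / 4 - fresnel_rem 0 T) * (PI / 4 - fresnel_rem 0 T)) - fresnel_rem (- (PI / 2)) T))).
{ intros T. simpl. rewrite !Rmult_1_r. unfold Rdiv. apply Rmult_comm. }
evar_last.
- apply is_lim_scal_l, is_lim_minus'; [apply Lr|apply is_lim_fresnel_rem].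
  apply is_lim_plus'; apply Lm; try apply is_lim_fresnel_rem;
  (apply is_lim_minus'; [apply is_lim_const|apply is_lim_fresnel_rem]).
- simpl. f_equal.
  replace (0 * 0 + (PI / 4 - 0) * (PI / 4 - 0)) with ((PI / 4) ^ 2) by ring.
  rewrite sqrt_pow2 by lra. field.
Qed.

Lemma is_lim_osc (al : R) : 0 < al -> is_lim (osc al) p_infty (sqrt (2 * PI * al)).
Proof.
intros Ha.
pose proof PI_RGT_0 as Hpi.
assert (Hs : 0 < sqrt al) by (apply sqrt_lt_R0, Ha).
unfold osc.
replace (sqrt (2 * PI * al)) with (4 * sqrt al * sqrt (PI / 8) - 0).
2:{ rewrite Rminus_0_r. replace (2 * PI * al) with ((4 ^ 2 * al) * (PI / 8)) by field.
    rewrite sqrt_mult, sqrt_mult by lra. rewrite sqrt_pow2 by lra. reflexivity. }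
apply is_lim_minus'.
- apply (is_lim_scal_l (fun y => fresnel (- (PI / 2)) (sqrt al * y)) (4 * sqrt al) p_infty
    (sqrt (PI / 8))).
  apply (is_lim_comp (fresnel (- (PI / 2))) (fun y => sqrt al * y) p_infty _ p_infty).
  + apply is_lim_fresnel_sin.
  + evar_last; [apply is_lim_scal_l, is_lim_id|].
    simpl. destruct (Rle_dec 0 (sqrt al)) as [H|H]; [|lra].
    destruct (Rle_lt_or_eq_dec 0 (sqrt al) H); [reflexivity|lra].
  + exists 0; intros; discriminate.
- apply (is_lim_le_le_loc (fun _ => 0) (fun y => 4 * / y)).
  + exists 0; intros y Hy. pose proof (COS_bound (al * y ^ 2)).
    assert (0 < / y) by (apply Rinv_0_lt_compat; lra).
    unfold Rdiv; split; nra.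
  + apply is_lim_const.
  + evar_last; [apply is_lim_scal_l, is_lim_inv; [apply is_lim_id|discriminate]|].
    simpl; f_equal; ring.
Qed.

(** * Fourier series of t (1 - t) *)

Lemma is_derive_rsum (f df : nat -> R -> R) (n : nat) (x : R) :
  (forall i, (i < n)%nat -> is_derive (f i) x (df i x)) ->
  is_derive (fun x => rsum (fun i => f i x) n) x (rsum (fun i => df i x) n).
Proof.
induction n as [|n IH]; intros H; simpl.
- apply @is_derive_const.
- apply (is_derive_plus (fun x => rsum (fun i => f i x) n) (f n)).
  + apply IH; intros; apply H; lia.
  + apply H; lia.
Qed.

Lemma INR_S_pos (i : nat) : 0 < INR (S i).
Proof. apply lt_0_INR; lia. Qed.

Lemma PI_gt_2 : 2 < PI.
Proof. pose proof PI2_1; lra. Qed.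

(* Partial sums of the Fourier series of the 1-periodic function equal to
   [t (1 - t)] on [0, 1]. *)
Definition bern (M : nat) (t : R) : R :=
  rsum (fun i => (1 - cos (2 * PI * INR (S i) * t)) / (PI * INR (S i)) ^ 2) M.

Definition dbern (M : nat) (t : R) : R :=
  rsum (fun i => 2 * sin (2 * PI * INR (S i) * t) / (PI * INR (S i))) M.

Lemma PI_mul_INR_S_pos (i : nat) : 0 < PI * INR (S i).
Proof. apply Rmult_lt_0_compat; [apply PI_RGT_0|apply INR_S_pos]. Qed.

Lemma bern_term_bounds (i : nat) (t : R) :
  0 <= (1 - cos (2 * PI * INR (S i) * t)) / (PI * INR (S i)) ^ 2
    <= / 2 * / INR (S i) ^ 2.
Proof.
pose proof (COS_bound (2 * PI * INR (S i) * t)).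
pose proof (PI_mul_INR_S_pos i). pose proof PI_gt_2.
pose proof (INR_S_pos i) as Hi.
split.
- apply Rdiv_le_0_compat; [lra|apply pow_lt; lra].
- rewrite Rpow_mult_distr. unfold Rdiv. rewrite Rinv_mult.
  rewrite <- Rmult_assoc. apply Rmult_le_compat_r.
  + apply Rlt_le, Rinv_0_lt_compat, pow_lt, Hi.
  + apply Rle_div_l; [apply Rlt_gt, pow_lt; lra|]. nra.
Qed.

Lemma bern_shift (M : nat) (t : R) (j : nat) : bern M (t + INR j) = bern M t.
Proof.
apply rsum_ext; intros i _. do 2 f_equal.
replace (2 * PI * INR (S i) * (t + INR j))
  with (2 * PI * INR (S i) * t + 2 * INR (S i * j) * PI)
  by (rewrite mult_INR; ring).
apply cos_period.
Qed.

Lemma bern_sym (M : nat) (t : R) : bern M (1 - t) = bern M t.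
Proof.
apply rsum_ext; intros i _. do 2 f_equal.
replace (2 * PI * INR (S i) * (1 - t))
  with (- (2 * PI * INR (S i) * t) + 2 * INR (S i) * PI) by ring.
rewrite cos_period. apply cos_neg.
Qed.

(** A term is at most 1 / (2 k^2), which telescopes against 1 / (k - 1) - 1 / k. *)
Lemma bern_tail (M d : nat) (t : R) : (1 <= M)%nat ->
  0 <= bern (M + d) t - bern M t <= / INR M - / INR (M + d).
Proof.
intros HM. induction d as [|d IH].
- rewrite Nat.add_0_r. lra.
- rewrite Nat.add_succ_r. replace (bern (S (M + d)) t) with (bern (M + d) t
    + (1 - cos (2 * PI * INR (S (M + d)) * t)) / (PI * INR (S (M + d))) ^ 2)
    by reflexivity.
  pose proof (bern_term_bounds (M + d) t) as B.
  assert (H0 : 0 < INR (M + d)) by (apply lt_0_INR; lia).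
  assert (/ 2 * / INR (S (M + d)) ^ 2 <= / INR (M + d) - / INR (S (M + d))).
  { rewrite S_INR. set (z := INR (M + d)) in *.
    replace (/ z - / (z + 1)) with (/ (z * (z + 1))) by (field; lra).
    rewrite <- Rinv_mult. apply Rinv_le_contravar; nra. }
  lra.
Qed.

(** A crude bound for t near 0, where [dbern_close] degenerates. *)
Lemma bern_le_small (M : nat) (t : R) : 0 <= t -> bern M t <= INR M * t.
Proof.
intros Ht. rewrite <- rsum_const. apply rsum_le; intros i _.
pose proof (PI_mul_INR_S_pos i) as Hp. pose proof PI_gt_2.
pose proof (one_minus_cos_le (2 * PI * INR (S i) * t)) as H1.
assert (1 <= INR (S i)) by (rewrite S_INR; pose proof (pos_INR i); lra).
apply Rle_div_l; [apply Rlt_gt, pow_lt; lra|].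
apply Rle_trans with (2 * (PI * INR (S i)) * t).
- apply Rle_trans with (1 := H1 ltac:(apply Rmult_le_pos; lra)). right; ring.
- assert (2 <= PI * INR (S i)) by nra.
  rewrite (Rmult_comm t). apply Rmult_le_compat_r; [exact Ht|]. nra.
Qed.

Lemma dirichlet_kernel (M : nat) (t : R) :
  sin (PI * t) * rsum (fun i => 4 * cos (2 * PI * INR (S i) * t)) M
  = 2 * sin ((2 * INR M + 1) * (PI * t)) - 2 * sin (PI * t).
Proof.
induction M as [|M IH].
- replace ((2 * INR 0 + 1) * (PI * t)) with (PI * t) by (simpl; ring). simpl; ring.
- rewrite rsum_S, Rmult_plus_distr_l, IH, S_INR.
  replace (2 * PI * (INR M + 1) * t) with ((2 * INR M + 2) * (PI * t)) by ring.
  replace ((2 * (INR M + 1) + 1) * (PI * t))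
    with ((2 * INR M + 2) * (PI * t) + PI * t) by ring.
  replace ((2 * INR M + 1) * (PI * t))
    with ((2 * INR M + 2) * (PI * t) - PI * t) by ring.
  rewrite sin_plus, sin_minus. ring.
Qed.

Lemma is_derive_bern (M : nat) (t : R) : is_derive (bern M) t (dbern M t).
Proof.
apply (is_derive_rsum
  (fun i t => (1 - cos (2 * PI * INR (S i) * t)) / (PI * INR (S i)) ^ 2)
  (fun i t => 2 * sin (2 * PI * INR (S i) * t) / (PI * INR (S i)))).
intros i _. pose proof (INR_S_pos i) as Hk. pose proof PI_RGT_0.
revert Hk; generalize (INR (S i)); intros k Hk.
auto_derive; [trivial|]. simpl. field. lra.
Qed.

Lemma is_derive_dbern (M : nat) (t : R) :
  is_derive (dbern M) t (rsum (fun i => 4 * cos (2 * PI * INR (S i) * t)) M).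
Proof.
apply (is_derive_rsum
  (fun i t => 2 * sin (2 * PI * INR (S i) * t) / (PI * INR (S i)))
  (fun i t => 4 * cos (2 * PI * INR (S i) * t))).
intros i _. pose proof (INR_S_pos i) as Hk. pose proof PI_RGT_0.
revert Hk; generalize (INR (S i)); intros k Hk.
auto_derive; [trivial|]. simpl. field. lra.
Qed.

Lemma dbern_half (M : nat) : dbern M (1 / 2) = 0.
Proof.
replace 0 with (rsum (fun _ => 0) M) by (rewrite rsum_const; ring).
apply rsum_ext; intros i _.
replace (2 * PI * INR (S i) * (1 / 2)) with (INR (S i) * PI) by field.
rewrite sin_eq_0_1; [unfold Rdiv; ring|].
exists (Z.of_nat (S i)). now rewrite INR_IZR_INZ.
Qed.

(* Up to an oscillating term of size O(1/M), the derivative of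
   [t (1 - t) - bern M t] has a derivative of size O(1/M); and it vanishes at 1/2. *)
Lemma dbern_close (M : nat) (e t : R) : 0 < e -> e <= t <= 1 / 2 ->
  Rabs (1 - 2 * t - dbern M t) <= 2 / ((2 * INR M + 1) * sin (PI * e) ^ 2).
Proof.
intros He Ht.
pose proof PI_gt_2 as Hpi. pose proof (pos_INR M) as HM0.
set (m := 2 * INR M + 1). assert (Hm : 1 <= m) by (unfold m; lra).
set (s := sin (PI * e)).
assert (Hs : 0 < s) by (apply sin_gt_0; nra).
assert (Hs1 : s <= 1) by apply SIN_bound.
assert (Hsin : forall y, e <= y <= 1 / 2 -> s <= sin (PI * y)).
{ intros y Hy. apply sin_incr_1; nra. }
(* By the Dirichlet kernel, 1 - 2 y - [dbern M y] has derivative - 2 sin (m PI y) / sin (PI y).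
   Integrating the fast sine produces the subtracted term and leaves a derivative of size 1 / m. *)
set (q := fun y => 1 - 2 * y - dbern M y
   - 2 / (m * PI) * (cos (m * (PI * y)) / sin (PI * y))).
assert (Hq : Rabs (q (1 / 2) - q t) <= 2 / (m * s ^ 2) * (1 / 2 - t)).
{ apply (mean_value_bound q (fun y =>
    2 / m * (cos (m * (PI * y)) * cos (PI * y)) * / sin (PI * y) ^ 2)); [lra| |].
  - intros y Hy. pose proof (Hsin y ltac:(lra)) as Hsy.
    evar_last.
    + apply (is_derive_minus (fun y => 1 - 2 * y - dbern M y)
        (fun y => 2 / (m * PI) * (cos (m * (PI * y)) / sin (PI * y)))).
      * apply (is_derive_minus (fun y => 1 - 2 * y) (dbern M)).
        -- auto_derive; [trivial|reflexivity].
        -- apply is_derive_dbern.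
      * auto_derive; [lra|reflexivity].
    + unfold minus, plus, opp; simpl.
      pose proof (dirichlet_kernel M y) as HD. fold m in HD.
      change (fun i => 4 * cos (2 * PI * match i with
        | O => 1 | S _ => INR i + 1 end * y)) with
        (fun i => 4 * cos (2 * PI * INR (S i) * y)).
      set (D := rsum (fun i => 4 * cos (2 * PI * INR (S i) * y)) M) in *.
      assert (ED : D = (2 * sin (m * (PI * y)) - 2 * sin (PI * y)) / sin (PI * y))
        by (rewrite <- HD; field; lra).
      rewrite ED. field. lra.
  - intros y Hy. pose proof (Hsin y ltac:(lra)) as Hsy.
    unfold Rdiv at 1. rewrite !Rabs_mult.
    assert (0 < / m) by (apply Rinv_0_lt_compat; lra).
    rewrite (Rabs_pos_eq 2), (Rabs_pos_eq (/ m)) by lra.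
    rewrite (Rabs_pos_eq (/ sin (PI * y) ^ 2))
      by (apply Rlt_le, Rinv_0_lt_compat, pow_lt; lra).
    set (A := Rabs (cos (m * (PI * y))) * Rabs (cos (PI * y))).
    assert (HA : 0 <= A <= 1).
    { split; [apply Rmult_le_pos; apply Rabs_pos|].
      rewrite <- (Rmult_1_l 1).
      apply Rmult_le_compat; try apply Rabs_pos; apply Rabs_cos_le_1. }
    replace (2 / (m * s ^ 2)) with (2 * / m * 1 * / s ^ 2) by (field; lra).
    assert (0 <= / m * A) by (apply Rmult_le_pos; lra).
    apply Rmult_le_compat; [lra| | |].
    + apply Rlt_le, Rinv_0_lt_compat, pow_lt; lra.
    + assert (/ m * A <= / m * 1) by (apply Rmult_le_compat_l; lra). lra.
    + apply Rinv_le_contravar; [apply pow_lt; lra|apply pow_incr; lra]. }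
(* At 1/2 the argument is an odd multiple of PI / 2, so the oscillating term vanishes as well. *)
assert (Hq0 : q (1 / 2) = 0).
{ unfold q. rewrite dbern_half.
  replace (m * (PI * (1 / 2))) with (IZR (Z.of_nat M) * PI + PI / 2)
    by (unfold m; rewrite <- INR_IZR_INZ; field).
  rewrite (cos_eq_0_1 (_ + _)) by (exists (Z.of_nat M); reflexivity).
  replace (1 - 2 * (1 / 2)) with 0 by field. unfold Rdiv; ring. }
rewrite Hq0 in Hq.
pose proof (Hsin t ltac:(lra)) as Hst.
assert (HG : Rabs (2 / (m * PI) * (cos (m * (PI * t)) / sin (PI * t)))
  <= 1 / (m * s ^ 2)).
{ unfold Rdiv. rewrite !Rabs_mult, !Rabs_inv, Rabs_mult.
  rewrite (Rabs_pos_eq 2), (Rabs_pos_eq m), (Rabs_pos_eq PI),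
    (Rabs_pos_eq (sin _)) by lra.
  rewrite !Rinv_mult.
  pose proof (Rabs_cos_le_1 (m * (PI * t))) as Hc.
  pose proof (Rabs_pos (cos (m * (PI * t)))) as Hc0.
  assert (0 < / m) by (apply Rinv_0_lt_compat; lra).
  assert (P1 : 0 < / PI <= / 2).
  { split; [apply Rinv_0_lt_compat; lra|apply Rinv_le_contravar; lra]. }
  assert (P2 : 0 < / sin (PI * t) <= / s ^ 2).
  { split; [apply Rinv_0_lt_compat; lra|apply Rinv_le_contravar; nra]. }
  replace (2 * (/ m * / PI) * (Rabs (cos (m * (PI * t))) * / sin (PI * t)))
    with (/ m * ((2 * / PI) * (Rabs (cos (m * (PI * t))) * / sin (PI * t)))) by ring.
  rewrite Rmult_1_l. apply Rmult_le_compat_l; [lra|].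
  rewrite <- (Rmult_1_l (/ s ^ 2)).
  apply Rmult_le_compat; nra. }
replace (1 - 2 * t - dbern M t)
  with (q t + 2 / (m * PI) * (cos (m * (PI * t)) / sin (PI * t)))
  by (unfold q; ring).
apply Rle_trans with (1 := Rabs_triang _ _).
replace (0 - q t) with (- q t) in Hq by ring. rewrite Rabs_Ropp in Hq.
assert (0 < / (m * s ^ 2)).
{ apply Rinv_0_lt_compat, Rmult_lt_0_compat; [lra|apply pow_lt; lra]. }
unfold Rdiv in *. nra.
Qed.

(** The two derivatives are close on [e, t], and both functions are small at e. Matching them near 0
    fixes the constant of integration without the value of the sum of 1 / k^2. *)
Lemma bern_close_half (t d : R) : 0 < t <= 1 / 2 -> 0 < d ->
  exists M0 : nat, forall M, (M0 <= M)%nat -> Rabs (t * (1 - t) - bern M t) <= d.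
Proof.
intros Ht Hd.
destruct (nfloor_ex (4 / d)) as [k [_ Hk]].
{ apply Rlt_le, Rdiv_lt_0_compat; lra. }
set (Q := S k).
assert (HQ : 0 < INR Q) by apply INR_S_pos.
assert (HQ1 : 1 <= INR Q) by (unfold Q; rewrite S_INR; pose proof (pos_INR k); lra).
assert (HQd : / INR Q <= d / 4).
{ replace (d / 4) with (/ (4 / d)) by (field; lra).
  apply Rinv_le_contravar; [apply Rdiv_lt_0_compat; lra|].
  unfold Q; rewrite S_INR; lra. }
(* With e <= 1 / Q^2 the first Q terms of the series, each at most e, add up to at most 1 / Q, and
   so does the tail. The error at e is then at most 3 / Q <= 3 d / 4, which leaves d / 4 for the
   interval [e, t]. *)
set (e := Rmin t (/ INR Q ^ 2)).
assert (HQ2 : 0 < / INR Q ^ 2) by (apply Rinv_0_lt_compat, pow_lt; lra).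
assert (He : 0 < e) by (apply Rmin_glb_lt; lra).
assert (Het : e <= t) by apply Rmin_l.
assert (HeQ : e <= / INR Q ^ 2) by apply Rmin_r.
set (s := sin (PI * e)).
pose proof PI_gt_2 as Hpi.
assert (Hs : 0 < s) by (apply sin_gt_0; nra).
assert (Hs2 : 0 < / s ^ 2) by (apply Rinv_0_lt_compat, pow_lt; lra).
destruct (nfloor_ex (4 / d * / s ^ 2)) as [r [_ Hr]].
{ apply Rmult_le_pos; [|lra]. apply Rlt_le, Rdiv_lt_0_compat; lra. }
exists (S r + Q)%nat; intros M HM.
assert (HMr : INR (S r) <= INR M) by (apply le_INR; lia). rewrite S_INR in HMr.
assert (H1 : Rabs ((t * (1 - t) - bern M t) - (e * (1 - e) - bern M e))
  <= 2 / ((2 * INR M + 1) * s ^ 2) * (t - e)).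
{ apply (mean_value_bound (fun t => t * (1 - t) - bern M t)
    (fun t => 1 - 2 * t - dbern M t)); [lra| |].
  - intros y Hy. evar_last.
    + apply (is_derive_minus (fun t => t * (1 - t)) (bern M)).
      * auto_derive; [trivial|reflexivity].
      * apply is_derive_bern.
    + unfold minus, plus, opp; simpl. ring.
  - intros y Hy. apply dbern_close; lra. }
assert (H2 : 2 / ((2 * INR M + 1) * s ^ 2) * (t - e) <= d / 4).
{ assert (P : / (2 * INR M + 1) * / s ^ 2 <= d / 4).
  { apply Rle_trans with (/ (4 / d * / s ^ 2) * / s ^ 2).
    - apply Rmult_le_compat_r; [lra|]. apply Rinv_le_contravar.
      + apply Rmult_lt_0_compat; [apply Rdiv_lt_0_compat|]; lra.
      + pose proof (pos_INR M); lra.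
    - right. field. lra. }
  unfold Rdiv in *. rewrite Rinv_mult.
  assert (0 < / (2 * INR M + 1)).
  { apply Rinv_0_lt_compat. pose proof (pos_INR M); lra. }
  assert (0 < / (2 * INR M + 1) * / s ^ 2) by (apply Rmult_lt_0_compat; lra).
  nra. }
assert (H3 : Rabs (e * (1 - e) - bern M e) <= 3 * / INR Q).
{ assert (He2 : e * (1 - e) <= / INR Q).
  { assert (/ INR Q ^ 2 <= / INR Q) by (apply Rinv_le_contravar; nra). nra. }
  assert (B1 : bern Q e <= / INR Q).
  { apply Rle_trans with (1 := bern_le_small Q e ltac:(lra)).
    replace (/ INR Q) with (INR Q * / INR Q ^ 2) by (field; lra).
    apply Rmult_le_compat_l; lra. }
  destruct (bern_tail Q (M - Q) e) as [B2 B3]; [unfold Q; lia|].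
  replace (Q + (M - Q))%nat with M in B2, B3 by lia.
  assert (0 < / INR M) by (apply Rinv_0_lt_compat, lt_0_INR; unfold Q in HM; lia).
  assert (B4 : 0 <= bern M e).
  { apply rsum_ge_0; intros; apply bern_term_bounds. }
  apply Rabs_le. nra. }
apply Rabs_le_between in H1, H3. apply Rabs_le. lra.
Qed.

(** Nonnegative terms make the partial sums increase to t (1 - t), so the deviation is a tail, hence
    one-sided and at most 1 / M. The symmetry t -> 1 - t covers the other half of [0, 1]. *)
Lemma bern_bounds (M : nat) (t : R) : (1 <= M)%nat -> 0 <= t <= 1 ->
  0 <= t * (1 - t) - bern M t <= / INR M.
Proof.
intros HM Ht.
assert (HMi : 0 < / INR M) by (apply Rinv_0_lt_compat, lt_0_INR; lia).
assert (Half : forall t, 0 < t <= 1 / 2 -> 0 <= t * (1 - t) - bern M t <= / INR M).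
{ clear t Ht; intros t Ht.
  assert (H : forall d, 0 < d -> - d <= t * (1 - t) - bern M t <= / INR M + d).
  { intros d Hd. destruct (bern_close_half t d Ht Hd) as [M0 H0].
    specialize (H0 (M + M0)%nat ltac:(lia)).
    apply Rabs_le_between in H0.
    pose proof (bern_tail M M0 t HM) as [B1 B2].
    assert (0 < / INR (M + M0)) by (apply Rinv_0_lt_compat, lt_0_INR; lia).
    lra. }
  split; apply le_epsilon; intros d Hd; specialize (H d Hd); lra. }
assert (Zero : bern M 0 = 0).
{ replace 0 with (rsum (fun _ => 0) M) at 2 by (rewrite rsum_const; ring).
  apply rsum_ext; intros i _. rewrite Rmult_0_r, cos_0. unfold Rdiv; ring. }
destruct (Req_dec t 0) as [->|H0].
{ rewrite Zero; lra. }
destruct (Req_dec t 1) as [->|H1].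
{ rewrite <- (bern_sym M 1). replace (1 - 1) with 0 by ring. rewrite Zero; lra. }
destruct (Rle_or_lt t (1 / 2)) as [H|H].
- apply Half; lra.
- specialize (Half (1 - t) ltac:(lra)). rewrite bern_sym in Half. lra.
Qed.

(** * Sums of square roots *)

(* Equal to [-8] times the Euler-Maclaurin remainder of the sum of the square
   roots; it tends to [-8 zeta(-1/2)], that is, [2 / PI * zeta (3/2)]. *)
Definition sqrt_defect (L : nat) : R :=
  16 / 3 * (INR L * sqrt (INR L)) + 4 * sqrt (INR L)
  - 8 * rsum (fun i => sqrt (INR (S i))) L.

(** Primitive of 2 {y^2} (1 - {y^2}) / y^2 for j <= y^2 < j + 1. This integrand is {t} (1 - {t})
    t^(-3/2) dt after t = y^2, which turns half-integer powers into integer ones. *)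
Definition psi (j : nat) (y : R) : R :=
  2 * (2 * INR j + 1) * y - 2 / 3 * y ^ 3 + 2 * INR j * (INR j + 1) / y.

Lemma is_derive_psi (j : nat) (y : R) : 0 < y ->
  is_derive (psi j) y (2 * ((y ^ 2 - INR j) * (1 - (y ^ 2 - INR j))) / y ^ 2).
Proof.
intros Hy. unfold psi. generalize (INR j); intros z.
auto_derive; [lra|]. field. lra.
Qed.

(** Together with [sqrt_defect 1 = psi 0 1], this makes [sqrt_defect L] the integral of {t} (1 -
    {t}) t^(-3/2) over [0, L]. At j = 0 the quotient by y in [psi] would be evaluated at 0, so that
    interval is treated apart. *)
Lemma sqrt_defect_succ (j : nat) : (1 <= j)%nat ->
  sqrt_defect (S j) - sqrt_defect j = psi j (sqrt (INR (S j))) - psi j (sqrt (INR j)).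
Proof.
intros Hj. unfold sqrt_defect, psi. rewrite rsum_S.
assert (H0 : 0 < INR j) by (apply lt_0_INR; lia).
assert (H1 : 0 < INR (S j)) by apply INR_S_pos.
assert (Hp : 0 < sqrt (INR j)) by (apply sqrt_lt_R0; lra).
assert (Hq : 0 < sqrt (INR (S j))) by (apply sqrt_lt_R0; lra).
pose proof (sqrt_sqrt (INR j) ltac:(lra)) as Ep.
pose proof (sqrt_sqrt (INR (S j)) ltac:(lra)) as Eq.
assert (E1 : INR j = sqrt (INR (S j)) * sqrt (INR (S j)) - 1)
  by (rewrite Eq, S_INR; ring).
set (p := sqrt (INR j)) in *. set (q := sqrt (INR (S j))) in *.
generalize (rsum (fun i => sqrt (INR (S i))) j); intros s.
assert (Epq : p * p = q * q - 1) by lra.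
replace (2 * INR j * (INR j + 1) / q) with (2 * INR j * q)
  by (replace (INR j + 1) with (q * q) by lra; field; lra).
replace (2 * INR j * (INR j + 1) / p) with (2 * p * (INR j + 1))
  by (rewrite <- Ep; field; lra).
replace (q ^ 3) with (q * INR (S j)) by (rewrite <- Eq; ring).
replace (p ^ 3) with (p * INR j) by (rewrite <- Ep; ring).
rewrite S_INR. field.
Qed.

(** The integral of 2 [bern M (z^2)] / z^2 over (0, y], term by term. *)
Definition osc_sum (M : nat) (y : R) : R :=
  rsum (fun i => / (PI * INR (S i)) ^ 2 * osc (2 * PI * INR (S i)) y) M.

Lemma two_PI_INR_S_pos (i : nat) : 0 < 2 * PI * INR (S i).
Proof. pose proof (PI_mul_INR_S_pos i); lra. Qed.

Lemma is_derive_osc_sum (M : nat) (y : R) : 0 < y ->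
  is_derive (osc_sum M) y (2 * bern M (y ^ 2) / y ^ 2).
Proof.
intros Hy.
replace (2 * bern M (y ^ 2) / y ^ 2) with (rsum (fun i => / (PI * INR (S i)) ^ 2
  * (2 * (1 - cos (2 * PI * INR (S i) * y ^ 2)) / y ^ 2)) M).
- apply (is_derive_rsum (fun i y => / (PI * INR (S i)) ^ 2 * osc (2 * PI * INR (S i)) y)
   (fun i y => / (PI * INR (S i)) ^ 2
     * (2 * (1 - cos (2 * PI * INR (S i) * y ^ 2)) / y ^ 2))).
  intros i _. apply is_derive_scal, is_derive_osc; [apply two_PI_INR_S_pos|exact Hy].
- unfold bern. replace (2 * rsum _ M / y ^ 2)
    with (2 / y ^ 2 * rsum (fun i =>
      (1 - cos (2 * PI * INR (S i) * y ^ 2)) / (PI * INR (S i)) ^ 2) M)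
    by (field; lra).
  rewrite <- rsum_scal. apply rsum_ext; intros i _.
  pose proof (PI_mul_INR_S_pos i). field. pose proof (INR_S_pos i).
  pose proof PI_RGT_0. lra.
Qed.

Lemma osc_sum_ge_0 (M : nat) (y : R) : 0 < y -> 0 <= osc_sum M y.
Proof.
intros Hy. apply rsum_ge_0; intros i _. apply Rmult_le_pos.
- apply Rlt_le, Rinv_0_lt_compat, pow_lt, PI_mul_INR_S_pos.
- apply osc_ge_0; [apply two_PI_INR_S_pos|exact Hy].
Qed.

(** The constant depends on M, which is harmless: it only serves to let y tend to 0 with M fixed. *)
Lemma osc_sum_small (M : nat) :
  exists C, 0 < C /\ forall y, 0 < y -> osc_sum M y <= C * y.
Proof.
exists (1 + rsum (fun i => / (PI * INR (S i)) ^ 2 * (6 * (2 * PI * INR (S i)))) M).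
assert (H : 0 <= rsum (fun i => / (PI * INR (S i)) ^ 2 * (6 * (2 * PI * INR (S i)))) M).
{ apply rsum_ge_0; intros i _. apply Rmult_le_pos.
  - apply Rlt_le, Rinv_0_lt_compat, pow_lt, PI_mul_INR_S_pos.
  - pose proof (two_PI_INR_S_pos i); lra. }
split; [lra|]. intros y Hy.
rewrite Rmult_plus_distr_r.
enough (osc_sum M y <= rsum (fun i => / (PI * INR (S i)) ^ 2
  * (6 * (2 * PI * INR (S i)))) M * y) by lra.
rewrite Rmult_comm, <- rsum_scal. apply rsum_le; intros i _.
replace (y * (/ (PI * INR (S i)) ^ 2 * (6 * (2 * PI * INR (S i)))))
  with (/ (PI * INR (S i)) ^ 2 * (6 * (2 * PI * INR (S i)) * y)) by ring.
apply Rmult_le_compat_l.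
- apply Rlt_le, Rinv_0_lt_compat, pow_lt, PI_mul_INR_S_pos.
- apply Rle_trans with (1 := Rle_abs _).
  apply osc_abs_le; [apply two_PI_INR_S_pos|exact Hy].
Qed.

Lemma psi_osc_sum_integrand (M j : nat) (y : R) : (1 <= M)%nat -> 0 < y ->
  INR j <= y ^ 2 <= INR (S j) ->
  2 * bern M (y ^ 2) / y ^ 2
    <= 2 * ((y ^ 2 - INR j) * (1 - (y ^ 2 - INR j))) / y ^ 2
    <= 2 * bern M (y ^ 2) / y ^ 2 + 2 * / INR M / y ^ 2.
Proof.
intros HM Hy Hj. rewrite S_INR in Hj.
pose proof (bern_bounds M (y ^ 2 - INR j) HM ltac:(lra)) as B.
rewrite <- (bern_shift M _ j) in B.
replace (y ^ 2 - INR j + INR j) with (y ^ 2) in B by ring.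
assert (0 < / y ^ 2) by (apply Rinv_0_lt_compat, pow_lt, Hy).
unfold Rdiv. rewrite <- Rmult_plus_distr_r.
split; apply Rmult_le_compat_r; lra.
Qed.

Lemma is_derive_inv_scal (k y : R) : 0 < y ->
  is_derive (fun y => - (k / y)) y (k / y ^ 2).
Proof. intros Hy. auto_derive; [lra|]. field. lra. Qed.

Lemma psi_osc_sum_increment (M j : nat) (p q : R) : (1 <= M)%nat ->
  0 < p <= q -> INR j <= p ^ 2 -> q ^ 2 <= INR (S j) ->
  osc_sum M q - osc_sum M p <= psi j q - psi j p
    <= osc_sum M q - osc_sum M p + 2 / INR M * (/ p - / q).
Proof.
intros HM Hpq Hp Hq.
assert (Hy : forall y, p <= y <= q -> INR j <= y ^ 2 <= INR (S j)).
{ intros y Hy. split.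
  - apply Rle_trans with (1 := Hp), pow_incr; lra.
  - apply Rle_trans with (2 := Hq), pow_incr; lra. }
split.
- apply (le_of_derive_le (osc_sum M) (psi j) (fun y => 2 * bern M (y ^ 2) / y ^ 2)
   (fun y => 2 * ((y ^ 2 - INR j) * (1 - (y ^ 2 - INR j))) / y ^ 2)); [lra| | |].
  + intros; apply is_derive_osc_sum; lra.
  + intros; apply is_derive_psi; lra.
  + intros y Hyy. apply psi_osc_sum_integrand; [exact HM|lra|apply Hy, Hyy].
- replace (osc_sum M q - osc_sum M p + 2 / INR M * (/ p - / q))
    with ((osc_sum M q + - (2 * / INR M / q)) - (osc_sum M p + - (2 * / INR M / p)))
    by (unfold Rdiv; ring).
  apply (le_of_derive_le (psi j) (fun y => osc_sum M y + - (2 * / INR M / y))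
   (fun y => 2 * ((y ^ 2 - INR j) * (1 - (y ^ 2 - INR j))) / y ^ 2)
   (fun y => 2 * bern M (y ^ 2) / y ^ 2 + 2 * / INR M / y ^ 2)); [lra| | |].
  + intros; apply is_derive_psi; lra.
  + intros x Hx. apply (is_derive_plus (osc_sum M) (fun y => - (2 * / INR M / y))).
    * apply is_derive_osc_sum; lra.
    * apply is_derive_inv_scal; lra.
  + intros y Hyy. apply psi_osc_sum_integrand; [exact HM|lra|apply Hy, Hyy].
Qed.

(* On (0, 1 / sqrt M] one uses [t (1 - t) <= t] instead of the uniform bound. *)
Lemma sqrt_defect_1_close (M : nat) : (1 <= M)%nat ->
  0 <= sqrt_defect 1 - osc_sum M 1 <= 4 / sqrt (INR M) - 2 / INR M.
Proof.
intros HM.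
assert (HM1 : 1 <= INR M) by (apply (le_INR 1); lia).
assert (Hs : 1 <= sqrt (INR M)) by (rewrite <- sqrt_1; apply sqrt_le_1; lra).
pose proof (sqrt_sqrt (INR M) ltac:(lra)) as Es.
set (y0 := / sqrt (INR M)).
assert (Hy0 : 0 < y0 <= 1).
{ split; [apply Rinv_0_lt_compat; lra|]. rewrite <- Rinv_1.
  apply Rinv_le_contravar; lra. }
assert (E1 : sqrt_defect 1 = psi 0 1).
{ unfold sqrt_defect, psi. simpl. rewrite sqrt_1. field. }
destruct (osc_sum_small M) as [C [HC HCb]].
assert (psi_small : forall e, 0 < e <= 1 -> 0 <= psi 0 e <= 2 * e).
{ intros e He. unfold psi. simpl INR.
  replace (2 * 0 * (0 + 1) / e) with 0 by (field; lra).
  assert (0 < e ^ 3) by (apply pow_lt; lra).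
  assert (e ^ 3 <= e) by (simpl; nra). lra. }
rewrite E1. split.
- apply le_epsilon; intros d Hd.
  set (e := Rmin 1 (d / C)).
  assert (He : 0 < e) by (apply Rmin_glb_lt; [lra|apply Rdiv_lt_0_compat; lra]).
  assert (He1 : e <= 1) by apply Rmin_l.
  assert (HeC : C * e <= d) by (rewrite Rmult_comm; apply Rle_div_r; [lra|apply Rmin_r]).
  destruct (psi_osc_sum_increment M 0 e 1 HM) as [H _]; [lra|simpl; nra|simpl; lra|].
  specialize (HCb e He). specialize (psi_small e ltac:(lra)). lra.
- destruct (psi_osc_sum_increment M 0 y0 1 HM) as [_ H]; [lra|simpl; nra|simpl; lra|].
  assert (H2 : psi 0 y0 - 0 <= 2 * y0) by (specialize (psi_small y0 ltac:(lra)); lra).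
  pose proof (osc_sum_ge_0 M y0 ltac:(lra)).
  replace (2 / INR M * (/ y0 - / 1)) with (2 * y0 - 2 / INR M) in H.
  + unfold Rdiv at 1. fold y0. lra.
  + unfold y0. rewrite Rinv_inv. set (s := sqrt (INR M)) in *. rewrite <- Es. field. lra.
Qed.

(** The errors 2 / M (1 / p - 1 / q) of the successive intervals telescope; the subtracted term on
    the right keeps this visible to the induction. The resulting bound is uniform in L, so L can
    tend to infinity before M does. *)
Lemma sqrt_defect_close (M L : nat) : (1 <= M)%nat -> (1 <= L)%nat ->
  0 <= sqrt_defect L - osc_sum M (sqrt (INR L))
    <= 4 / sqrt (INR M) - 2 / INR M * / sqrt (INR L).
Proof.
intros HM HL. induction L as [|L IH]; [lia|].
destruct L as [|L].
- simpl INR. rewrite sqrt_1, Rinv_1, Rmult_1_r. apply sqrt_defect_1_close, HM.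
- specialize (IH ltac:(lia)). set (j := S L) in *.
  assert (H0 : 0 < INR j) by apply INR_S_pos.
  assert (H1 : 0 < INR (S j)) by apply INR_S_pos.
  pose proof (sqrt_defect_succ j ltac:(lia)) as E.
  pose proof (pow2_sqrt (INR j) ltac:(lra)) as Ep.
  pose proof (pow2_sqrt (INR (S j)) ltac:(lra)) as Eq.
  pose proof (psi_osc_sum_increment M j (sqrt (INR j)) (sqrt (INR (S j))) HM) as H.
  assert (Hp : 0 < sqrt (INR j)) by (apply sqrt_lt_R0; lra).
  assert (Hq : sqrt (INR j) <= sqrt (INR (S j))).
  { apply sqrt_le_1; rewrite ?S_INR; lra. }
  specialize (H ltac:(lra) ltac:(lra) ltac:(lra)). lra.
Qed.

(** As {t} (1 - {t}) <= 1/4, the integrand is at most 1 / (2 y^2). *)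
Lemma sqrt_defect_increment (j : nat) : (1 <= j)%nat ->
  0 <= sqrt_defect (S j) - sqrt_defect j
    <= 1 / 2 * / sqrt (INR j) - 1 / 2 * / sqrt (INR (S j)).
Proof.
intros Hj. rewrite sqrt_defect_succ by exact Hj.
assert (H0 : 0 < INR j) by (apply lt_0_INR; lia).
pose proof (S_INR j) as ES.
pose proof (pow2_sqrt (INR j) ltac:(lra)) as Ep.
pose proof (pow2_sqrt (INR (S j)) ltac:(lra)) as Eq.
assert (Hp : 0 < sqrt (INR j)) by (apply sqrt_lt_R0; lra).
assert (Hq : sqrt (INR j) <= sqrt (INR (S j))) by (apply sqrt_le_1; lra).
set (p := sqrt (INR j)) in *. set (q := sqrt (INR (S j))) in *.
assert (Hy : forall y, p <= y <= q -> 0 < / y ^ 2 /\ INR j <= y ^ 2 <= INR j + 1).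
{ intros y Hy. split; [apply Rinv_0_lt_compat, pow_lt; lra|].
  rewrite <- ES, <- Ep, <- Eq. split; apply pow_incr; lra. }
split.
- replace 0 with (0 - 0) by ring.
  apply (le_of_derive_le (fun _ => 0) (psi j) (fun _ => 0)
   (fun y => 2 * ((y ^ 2 - INR j) * (1 - (y ^ 2 - INR j))) / y ^ 2)); [lra| | |].
  + intros; apply @is_derive_const.
  + intros; apply is_derive_psi; lra.
  + intros y Hyy. destruct (Hy y Hyy) as [Hi Hb]. unfold Rdiv.
    apply Rmult_le_pos; [|lra]. nra.
- replace (1 / 2 * / p - 1 / 2 * / q) with (- (1 / 2 / q) - - (1 / 2 / p))
    by (unfold Rdiv; ring).
  apply (le_of_derive_le (psi j) (fun y => - (1 / 2 / y))
   (fun y => 2 * ((y ^ 2 - INR j) * (1 - (y ^ 2 - INR j))) / y ^ 2)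
   (fun y => 1 / 2 / y ^ 2)); [lra| | |].
  + intros; apply is_derive_psi; lra.
  + intros; apply is_derive_inv_scal; lra.
  + intros y Hyy. destruct (Hy y Hyy) as [Hi Hb]. unfold Rdiv.
    apply Rmult_le_compat_r; [lra|].
    pose proof (pow2_ge_0 (y ^ 2 - INR j - 1 / 2)). lra.
Qed.

Lemma sqrt_defect_mono (L d : nat) : (1 <= L)%nat ->
  0 <= sqrt_defect (L + d) - sqrt_defect L
    <= 1 / 2 * / sqrt (INR L) - 1 / 2 * / sqrt (INR (L + d)).
Proof.
intros HL. induction d as [|d IH].
- rewrite Nat.add_0_r. lra.
- rewrite Nat.add_succ_r.
  pose proof (sqrt_defect_increment (L + d) ltac:(lia)). lra.
Qed.

Definition zeta32_sum (M : nat) : R :=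
  rsum (fun i => / Rpower (INR (S i)) (3 / 2)) M.

Lemma is_lim_seq_zeta32_sum : is_lim_seq zeta32_sum (zeta (3 / 2)).
Proof.
apply is_lim_seq_incr_1.
apply (is_lim_seq_ext (sum_n (fun n => / Rpower (INR (S n)) (3 / 2)))).
- intros n. induction n as [|n IH].
  + rewrite sum_O. unfold zeta32_sum. simpl. ring.
  + rewrite sum_Sn, IH. reflexivity.
- apply (Series_correct (fun n => / Rpower (INR (S n)) (3 / 2))).
  apply ex_series_zeta. lra.
Qed.

Lemma Rpower_3_2 (k : R) : 0 < k -> Rpower k (3 / 2) = k * sqrt k.
Proof.
intros Hk. replace (3 / 2) with (1 + / 2) by field.
rewrite Rpower_plus, Rpower_1, Rpower_sqrt by exact Hk. reflexivity.
Qed.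

(** The k-th term tends to sqrt (2 PI (2 PI k)) / (PI k)^2 = 2 / PI k^(-3/2); this is where zeta
    (3/2) comes from. *)
Lemma is_lim_osc_sum (M : nat) :
  is_lim (osc_sum M) p_infty (2 / PI * zeta32_sum M).
Proof.
induction M as [|M IH].
- apply (is_lim_ext (fun _ => 0)); [reflexivity|].
  unfold zeta32_sum; simpl. rewrite Rmult_0_r. apply is_lim_const.
- unfold zeta32_sum. rewrite rsum_S, Rmult_plus_distr_l.
  apply (is_lim_plus' (osc_sum M)
    (fun y => / (PI * INR (S M)) ^ 2 * osc (2 * PI * INR (S M)) y)); [exact IH|].
  evar_last; [apply is_lim_scal_l, is_lim_osc, two_PI_INR_S_pos|].
  unfold Rbar_mult, Rbar_mult'. f_equal.
  pose proof (INR_S_pos M) as Hk. pose proof PI_RGT_0.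
  generalize dependent (INR (S M)); intros k Hk.
  replace (2 * PI * (2 * PI * k)) with ((2 * PI) ^ 2 * k) by ring.
  rewrite sqrt_mult, sqrt_pow2, Rpower_3_2 by (try apply pow2_ge_0; lra).
  assert (0 < sqrt k) by (apply sqrt_lt_R0; lra).
  rewrite <- (sqrt_sqrt k) at 1 3 by lra.
  field. lra.
Qed.

(** First d tends to infinity in [osc_sum M (sqrt (L + d))] with M fixed, then M does. Multiplied by
    sqrt (c x), the rate 1 / (2 sqrt L) is again of the size of the error term. *)
Lemma sqrt_defect_zeta (L : nat) : (1 <= L)%nat ->
  0 <= 2 / PI * zeta (3 / 2) - sqrt_defect L <= 1 / 2 * / sqrt (INR L).
Proof.
intros HL.
assert (HLp : 0 < INR L) by (apply lt_0_INR; lia).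
assert (B : forall M, (1 <= M)%nat ->
  sqrt_defect L - 4 / sqrt (INR M) <= 2 / PI * zeta32_sum M
    <= sqrt_defect L + 1 / 2 * / sqrt (INR L)).
{ intros M HM.
  assert (HMp : 0 < INR M) by (apply lt_0_INR; lia).
  assert (Hlim : is_lim_seq (fun d => osc_sum M (sqrt (INR (d + L))))
    (2 / PI * zeta32_sum M)).
  { apply (is_lim_comp_seq (osc_sum M) (fun d => sqrt (INR (d + L))) p_infty).
    - apply is_lim_osc_sum.
    - exists 0%nat; intros; discriminate.
    - apply (filterlim_comp _ _ _ (fun d => INR (d + L)) sqrt _ (Rbar_locally p_infty)).
      + apply (is_lim_seq_incr_n INR L p_infty), is_lim_seq_INR.
      + apply (filterlim_sqrt_p). }
  assert (Bd : forall d, sqrt_defect L - 4 / sqrt (INR M)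
    <= osc_sum M (sqrt (INR (d + L))) <= sqrt_defect L + 1 / 2 * / sqrt (INR L)).
  { intros d.
    pose proof (sqrt_defect_close M (d + L) HM ltac:(lia)) as H1.
    pose proof (sqrt_defect_mono L d HL) as H2.
    rewrite (Nat.add_comm L d) in H2.
    assert (0 < / sqrt (INR (d + L)))
      by (apply Rinv_0_lt_compat, sqrt_lt_R0, lt_0_INR; lia).
    assert (0 < 2 / INR M) by (apply Rdiv_lt_0_compat; lra).
    assert (0 < 2 / INR M * / sqrt (INR (d + L))) by (apply Rmult_lt_0_compat; lra).
    lra. }
  split.
  - apply (is_lim_seq_le (fun _ => sqrt_defect L - 4 / sqrt (INR M))
      (fun d => osc_sum M (sqrt (INR (d + L))))
      (Finite (sqrt_defect L - 4 / sqrt (INR M))) (Finite (2 / PI * zeta32_sum M)));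
      [apply Bd|apply is_lim_seq_const|exact Hlim].
  - apply (is_lim_seq_le (fun d => osc_sum M (sqrt (INR (d + L))))
      (fun _ => sqrt_defect L + 1 / 2 * / sqrt (INR L))
      (Finite (2 / PI * zeta32_sum M)) (Finite (sqrt_defect L + 1 / 2 * / sqrt (INR L))));
      [apply Bd|exact Hlim|apply is_lim_seq_const]. }
assert (Hz : is_lim_seq (fun M => 2 / PI * zeta32_sum (S M)) (2 / PI * zeta (3 / 2))).
{ apply (is_lim_seq_scal_l (fun M => zeta32_sum (S M)) (2 / PI) (zeta (3 / 2))).
  apply -> is_lim_seq_incr_1. apply is_lim_seq_zeta32_sum. }
assert (Hl : is_lim_seq (fun M => sqrt_defect L - 4 / sqrt (INR (S M))) (sqrt_defect L)).
{ evar_last.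
  - apply is_lim_seq_minus'; [apply is_lim_seq_const|].
    apply (is_lim_seq_scal_l (fun M => / sqrt (INR (S M))) 4 0).
    apply (is_lim_seq_inv (fun M => sqrt (INR (S M))) p_infty); [|discriminate].
    apply (filterlim_comp _ _ _ (fun d => INR (S d)) sqrt _ (Rbar_locally p_infty)).
    + apply -> is_lim_seq_incr_1. apply is_lim_seq_INR.
    + apply filterlim_sqrt_p.
  - simpl. f_equal. ring. }
split.
- enough (sqrt_defect L <= 2 / PI * zeta (3 / 2)) by lra.
  apply (is_lim_seq_le (fun M => sqrt_defect L - 4 / sqrt (INR (S M)))
     (fun M => 2 / PI * zeta32_sum (S M)) (Finite (sqrt_defect L))
     (Finite (2 / PI * zeta (3 / 2)))); [|exact Hl|exact Hz].
  intros M. apply B. lia.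
- enough (2 / PI * zeta (3 / 2) <= sqrt_defect L + 1 / 2 * / sqrt (INR L)) by lra.
  apply (is_lim_seq_le (fun M => 2 / PI * zeta32_sum (S M))
     (fun _ => sqrt_defect L + 1 / 2 * / sqrt (INR L)) (Finite (2 / PI * zeta (3 / 2)))
     (Finite (sqrt_defect L + 1 / 2 * / sqrt (INR L))));
     [|exact Hz|apply is_lim_seq_const].
  intros M. apply B. lia.
Qed.

(** * Counting pairs *)

(** Real-valued, so that conditions become factors and sums over n and k can be exchanged by
    linearity. *)
Definition ind_le (u v : R) : R := if Rle_dec u v then 1 else 0.

Lemma ind_le_true (u v : R) : u <= v -> ind_le u v = 1.
Proof. unfold ind_le; destruct (Rle_dec u v); [reflexivity|contradiction]. Qed.

Lemma ind_le_false (u v : R) : v < u -> ind_le u v = 0.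
Proof. unfold ind_le; destruct (Rle_dec u v); [lra|reflexivity]. Qed.

Lemma ind_le_iff (u v u' v' : R) : (u <= v <-> u' <= v') -> ind_le u v = ind_le u' v'.
Proof.
intros H. unfold ind_le. destruct (Rle_dec u v), (Rle_dec u' v'); tauto.
Qed.

Lemma ind_le_bounds (u v : R) : 0 <= ind_le u v <= 1.
Proof. unfold ind_le; destruct (Rle_dec u v); lra. Qed.

Lemma rsum_ind_le (h : nat -> R) (p M : nat) (y : R) : INR p <= y < INR p + 1 ->
  rsum (fun i => ind_le (INR (S i)) y * h i) M = rsum h (Nat.min M p).
Proof.
intros Hy. induction M as [|M IH]; [reflexivity|].
rewrite rsum_S, IH.
destruct (Nat.le_gt_cases (S M) p) as [H|H].
- rewrite !Nat.min_l by lia.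
  rewrite ind_le_true; [simpl; ring|].
  apply le_INR in H. lra.
- rewrite !Nat.min_r by lia.
  rewrite ind_le_false; [ring|].
  assert (H2 : (S p <= S M)%nat) by lia. apply le_INR in H2. rewrite S_INR in H2. lra.
Qed.

Lemma rsum_count (p M : nat) (y : R) : INR p <= y < INR p + 1 ->
  rsum (fun i => ind_le (INR (S i)) y) M = INR (Nat.min M p).
Proof.
intros Hy. rewrite (rsum_ext _ (fun i => ind_le (INR (S i)) y * 1)) by (intros; ring).
rewrite (rsum_ind_le (fun _ => 1) p M y Hy), rsum_const. ring.
Qed.

Lemma Int_part_bounds (y : R) : IZR (Int_part y) <= y < IZR (Int_part y) + 1.
Proof. pose proof (base_Int_part y). lra. Qed.

Lemma nat_floor (y : R) : 0 <= y ->
  exists p : nat, INR p = IZR (Int_part y) /\ INR p <= y < INR p + 1.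
Proof.
intros Hy. pose proof (Int_part_bounds y) as B.
assert (H : (0 <= Int_part y)%Z).
{ assert (H : (-1 < Int_part y)%Z) by (apply lt_IZR; simpl; lra). lia. }
exists (Z.to_nat (Int_part y)).
assert (E : INR (Z.to_nat (Int_part y)) = IZR (Int_part y))
  by (rewrite INR_IZR_INZ, Z2Nat.id by exact H; reflexivity).
rewrite E. auto.
Qed.

Lemma rsum_count_Int_part (y : R) (M : nat) : 0 <= y -> y < INR M + 1 ->
  rsum (fun i => ind_le (INR (S i)) y) M = IZR (Int_part y).
Proof.
intros H0 HM. destruct (nat_floor y H0) as [p [E Hp]].
rewrite (rsum_count p M y Hp), <- E, Nat.min_r; [reflexivity|].
assert (H : INR p < INR (S M)) by (rewrite S_INR; lra).
apply INR_lt in H. lia.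
Qed.

Lemma Int_part_plus_1 (y : R) : IZR (Int_part (y + 1)) = IZR (Int_part y) + 1.
Proof.
pose proof (Int_part_bounds y) as B. pose proof (Int_part_bounds (y + 1)) as B'.
rewrite <- (plus_IZR _ 1). apply f_equal.
assert (H1 : (Int_part (y + 1) < Int_part y + 2)%Z)
  by (apply lt_IZR; rewrite plus_IZR; simpl; lra).
assert (H2 : (Int_part y < Int_part (y + 1))%Z).
{ assert (H2 : (Int_part y + 1 < Int_part (y + 1) + 1)%Z)
    by (apply lt_IZR; rewrite !plus_IZR; simpl; lra). lia. }
lia.
Qed.

Lemma rsum_count_Int_part_0 (y : R) (M : nat) : -1 <= y -> y < INR M ->
  rsum (fun i => ind_le (INR i) y) M = IZR (Int_part y) + 1.
Proof.
intros H0 HM. rewrite <- Int_part_plus_1, <- (rsum_count_Int_part (y + 1) M) by lra.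
apply rsum_ext; intros i _. apply ind_le_iff. rewrite S_INR. lra.
Qed.

Lemma frac_part_bounds (y : R) : 0 <= frac_part y < 1.
Proof. pose proof (base_fp y). lra. Qed.

(* With f the floor of u - v, the difference m of the two integer parts is f or f + 1,
   and the two sums over i are 2 f (u - v) - 2 f (f + 1) and f: in this form the
   right-hand side is linear in the indicators of [i + 1 <= u - v]. *)
Lemma abs_frac_part_sub (u v : R) (f M : nat) :
  INR f <= u - v < INR f + 1 -> (f <= M)%nat ->
  Rabs (frac_part u - frac_part v) =
  (u - v) + rsum (fun i => ind_le (INR (S i)) (u - v) * (2 * (u - v) - 4 * INR (S i))) M
  + (IZR (Int_part u) - IZR (Int_part v))
    * (1 - 2 * (u - v) + 2 * rsum (fun i => ind_le (INR (S i)) (u - v)) M).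
Proof.
intros Hf HfM.
rewrite (rsum_count f M (u - v) Hf).
rewrite (rsum_ind_le (fun i => 2 * (u - v) - 4 * INR (S i)) f M (u - v) Hf).
rewrite Nat.min_r by exact HfM.
assert (E : forall n, rsum (fun i => 2 * (u - v) - 4 * INR (S i)) n
   = 2 * INR n * (u - v) - 2 * INR n * (INR n + 1)).
{ intros n; induction n as [|n IH]; [simpl; ring|].
  rewrite rsum_S, IH, S_INR. ring. }
rewrite E.
unfold frac_part.
pose proof (Int_part_bounds u) as Bu. pose proof (Int_part_bounds v) as Bv.
rewrite <- minus_IZR.
replace (u - IZR (Int_part u) - (v - IZR (Int_part v)))
  with (u - v - IZR (Int_part u - Int_part v)) by (rewrite minus_IZR; ring).
set (m := (Int_part u - Int_part v)%Z).
assert (Hm : u - v - 1 < IZR m < u - v + 1) by (unfold m; rewrite minus_IZR; lra).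
rewrite INR_IZR_INZ in *.
assert (C : m = Z.of_nat f \/ m = (Z.of_nat f + 1)%Z).
{ assert (H1 : (Z.of_nat f - 1 < m)%Z) by (apply lt_IZR; rewrite minus_IZR; simpl; lra).
  assert (H2 : (m < Z.of_nat f + 2)%Z) by (apply lt_IZR; rewrite plus_IZR; simpl; lra).
  lia. }
destruct C as [-> | ->].
- rewrite Rabs_pos_eq by lra. ring.
- rewrite plus_IZR in *. rewrite Rabs_left1 by lra. ring.
Qed.

(** * Pairs (n, k), and the thresholds in n and in k *)

Definition du (x a b : R) (n : nat) : R := x / (INR n + a) - x / (INR n + b).

Definition dm (x a b : R) (n : nat) : R :=
  IZR (Int_part (x / (INR n + a))) - IZR (Int_part (x / (INR n + b))).

(* Indicator of [x / (n + b) < k <= x / (n + a)]. *)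
Definition hit (x a b : R) (n k : nat) : R :=
  ind_le (INR k * (INR n + a)) x - ind_le (INR k * (INR n + b)) x.

Definition dfrac (x a b : R) (k : nat) : R :=
  frac_part (x / INR k - a) - frac_part (x / INR k - b).

(* As [du] decreases in n, this is the number of n with [j <= du x a b n]. *)
Definition cut (x a b : R) (j : nat) : nat :=
  largest (fun n => forall p, (p < n)%nat -> INR j <= du x a b p).

Section Counting.

Variables x a b : R.
Hypotheses (Ha : 0 < a) (Hab : a < b) (Hx : 0 < x).

Let c := b - a.
Let t := x / c.

Lemma shift_pos (n : nat) : 0 < INR n + a < INR n + b.
Proof. pose proof (pos_INR n); lra. Qed.

Lemma width_pos : 0 < c.
Proof. unfold c; lra. Qed.

Lemma ratio_pos : 0 < t.
Proof. apply Rdiv_lt_0_compat; [exact Hx|apply width_pos]. Qed.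

Lemma du_eq (n : nat) : du x a b n = c * x / ((INR n + a) * (INR n + b)).
Proof. pose proof (shift_pos n). unfold du, c. field. lra. Qed.

Lemma du_pos (n : nat) : 0 < du x a b n.
Proof.
rewrite du_eq. pose proof (shift_pos n). pose proof width_pos.
apply Rdiv_lt_0_compat; apply Rmult_lt_0_compat; lra.
Qed.

Lemma du_decr (m n : nat) : (m <= n)%nat -> du x a b n <= du x a b m.
Proof.
intros H. rewrite !du_eq. apply le_INR in H.
pose proof (shift_pos m). pose proof (shift_pos n). pose proof width_pos.
apply Rmult_le_compat_l; [apply Rmult_le_pos; lra|].
apply Rinv_le_contravar; [apply Rmult_lt_0_compat; lra|].
apply Rmult_le_compat; lra.
Qed.

Lemma cut_spec (j : nat) : (1 <= j)%nat ->
  (forall p, (p < cut x a b j)%nat -> INR j <= du x a b p) /\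
  (forall p, (cut x a b j <= p)%nat -> du x a b p < INR j).
Proof.
intros Hj.
assert (HjR : 1 <= INR j) by (apply (le_INR 1); exact Hj).
assert (Hcx : 0 < c * x) by (apply Rmult_lt_0_compat; [apply width_pos|exact Hx]).
(* For n > c x one has du < 1 <= j, so the candidates for [cut] are bounded. *)
destruct (nfloor_ex (c * x + 1)) as [r [_ Hr]]; [lra|].
assert (Hbig : du x a b r < INR j).
{ rewrite du_eq. pose proof (shift_pos r).
  apply Rlt_div_l; [apply Rlt_gt, Rmult_lt_0_compat; lra|].
  assert (c * x < INR r) by lra.
  assert (INR r * INR r < (INR r + a) * (INR r + b))
    by (apply Rmult_le_0_lt_compat; lra).
  assert (1 * ((INR r + a) * (INR r + b)) <= INR j * ((INR r + a) * (INR r + b)))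
    by (apply Rmult_le_compat_r; [apply Rmult_le_pos; lra|lra]).
  destruct (Rle_or_lt 1 (INR r)) as [H3|H3].
  - nra.
  - assert (INR r < INR 1) by (simpl; lra). apply INR_lt in H4.
    assert (r = 0)%nat by lia. subst r. simpl in *. lra. }
destruct (largest_spec (fun n => forall p, (p < n)%nat -> INR j <= du x a b p) 0 r)
  as [H1 H2].
{ intros p Hp; lia. }
{ intros m Hm. destruct (Nat.le_gt_cases m r) as [H|H]; [exact H|].
  specialize (Hm r H). lra. }
fold (cut x a b j) in H1, H2.
split; [exact H1|].
intros p Hp. apply Rnot_le_lt. intros Hle.
enough (S (cut x a b j) <= cut x a b j)%nat by lia.
apply H2. intros q Hq.
apply Rle_trans with (1 := Hle). apply du_decr. lia.
Qed.

Lemma cut_decr (i j : nat) : (1 <= i <= j)%nat -> (cut x a b j <= cut x a b i)%nat.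
Proof.
intros Hij. apply Nat.nlt_ge. intros H.
destruct (cut_spec i) as [_ H1]; [lia|]. destruct (cut_spec j) as [H2 _]; [lia|].
specialize (H1 (cut x a b i) (Nat.le_refl _)). specialize (H2 _ H).
assert (INR i <= INR j) by (apply le_INR; lia). lra.
Qed.

Lemma rsum_cut (f : nat -> R) (j q : nat) : (1 <= j)%nat ->
  rsum (fun n => ind_le (INR j) (du x a b n) * f n) q = rsum f (Nat.min q (cut x a b j)).
Proof.
intros Hj. destruct (cut_spec j Hj) as [H1 H2].
induction q as [|q IH]; [reflexivity|].
rewrite rsum_S, IH.
destruct (Nat.le_gt_cases (S q) (cut x a b j)) as [H|H].
- rewrite !Nat.min_l by lia. rewrite ind_le_true by (apply H1; lia). simpl; ring.
- rewrite !Nat.min_r by lia. rewrite ind_le_false by (apply H2; lia). ring.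
Qed.

(** The product (n + a) (n + b) lies between (n + a)^2 and (n + b)^2, so du = j is crossed between s
    - b and s - a. The alternative [cut = 0] covers the case where no n has j <= du. *)
Lemma cut_bounds (j : nat) (s : R) : (1 <= j)%nat -> 0 < s -> INR j * s ^ 2 = c * x ->
  s - b < INR (cut x a b j) /\ INR (cut x a b j) <= s + 1 /\
  (1 <= s -> INR (cut x a b j) <= s + 1 - a \/ (cut x a b j = 0)%nat).
Proof.
intros Hj Hs E. destruct (cut_spec j Hj) as [H1 H2].
assert (HjR : 1 <= INR j) by (apply (le_INR 1); exact Hj).
assert (HL : s - b < INR (cut x a b j)).
{ specialize (H2 _ (Nat.le_refl _)). rewrite du_eq in H2.
  pose proof (shift_pos (cut x a b j)) as Hp.
  set (z := INR (cut x a b j)) in *.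
  apply Rlt_div_l in H2; [|apply Rlt_gt, Rmult_lt_0_compat; lra].
  rewrite <- E in H2. apply Rmult_lt_reg_l in H2; [|lra].
  destruct (Rle_or_lt (z + b) s) as [H|H]; [exfalso; nra|lra]. }
assert (HU : INR (cut x a b j) <= s + 1 - a \/ (cut x a b j = 0)%nat).
{ destruct (cut x a b j) as [|p]; [now right|left].
  specialize (H1 p ltac:(lia)). rewrite du_eq in H1. pose proof (shift_pos p) as Hp.
  rewrite S_INR. set (z := INR p) in *.
  apply Rle_div_r in H1; [|apply Rlt_gt, Rmult_lt_0_compat; lra].
  rewrite <- E in H1. apply Rmult_le_reg_l in H1; [|lra].
  destruct (Rle_or_lt (z + a) s) as [H|H]; [lra|exfalso; nra]. }
split; [exact HL|split; [|intros _; exact HU]].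
destruct HU as [HU|HU]; [lra|]. rewrite HU. simpl. lra.
Qed.

Lemma hit_ge_0 (n k : nat) : 0 <= hit x a b n k.
Proof.
unfold hit. pose proof (shift_pos n). pose proof (pos_INR k).
pose proof (ind_le_bounds (INR k * (INR n + a)) x).
pose proof (ind_le_bounds (INR k * (INR n + b)) x).
destruct (Rle_or_lt (INR k * (INR n + b)) x) as [G1|G1].
- rewrite (ind_le_true (INR k * (INR n + a))); [lra|].
  apply Rle_trans with (2 := G1). apply Rmult_le_compat_l; lra.
- rewrite (ind_le_false (INR k * (INR n + b))) by exact G1. lra.
Qed.

Lemma hit_pos_inv (n k : nat) : hit x a b n k = 0 \/
  x / (INR n + b) < INR k <= x / (INR n + a).
Proof.
unfold hit. pose proof (shift_pos n).
destruct (Rle_or_lt (INR k * (INR n + a)) x) as [G1|G1];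
destruct (Rle_or_lt (INR k * (INR n + b)) x) as [G2|G2].
- left. rewrite !ind_le_true by assumption. ring.
- right. split; [apply Rlt_div_l|apply Rle_div_r]; lra.
- exfalso. pose proof (pos_INR k). nra.
- left. rewrite !ind_le_false by assumption. ring.
Qed.

Lemma sum_hit_k (n M : nat) : x / (INR n + a) < INR M + 1 ->
  rsum (fun i => hit x a b n (S i)) M = dm x a b n.
Proof.
intros HM. pose proof (shift_pos n) as Hn.
assert (H0 : 0 < x / (INR n + b)) by (apply Rdiv_lt_0_compat; lra).
pose proof (du_pos n) as Hd. unfold du in Hd.
unfold hit, dm. rewrite rsum_minus.
f_equal; [|f_equal].
- rewrite <- (rsum_count_Int_part (x / (INR n + a)) M) by lra.
  apply rsum_ext; intros i _. apply ind_le_iff. apply Rle_div_r. lra.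
- rewrite <- (rsum_count_Int_part (x / (INR n + b)) M) by lra.
  apply rsum_ext; intros i _. apply ind_le_iff. apply Rle_div_r. lra.
Qed.

(** For fixed k the hits are the n with x/k - b < n <= x/k - a, an interval of length c. The
    condition b k <= x makes its ends nonnegative, so no integer of it is lost below 0. *)
Lemma sum_hit_n (k N : nat) : (1 <= k)%nat -> b * INR k <= x -> x < INR N ->
  rsum (fun n => hit x a b n k) N = c - dfrac x a b k.
Proof.
intros Hk Hbk HN.
assert (HkR : 1 <= INR k) by (apply (le_INR 1); exact Hk).
assert (H1 : b <= x / INR k) by (apply Rle_div_r; lra).
assert (H2 : x / INR k <= x).
{ apply Rle_div_l; [lra|]. nra. }
unfold hit. rewrite rsum_minus.
replace (rsum (fun n => ind_le (INR k * (INR n + a)) x) N)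
  with (IZR (Int_part (x / INR k - a)) + 1).
- replace (rsum (fun n => ind_le (INR k * (INR n + b)) x) N)
    with (IZR (Int_part (x / INR k - b)) + 1).
  + unfold dfrac, frac_part, c. ring.
  + rewrite <- (rsum_count_Int_part_0 (x / INR k - b) N) by lra.
    apply rsum_ext; intros n _. apply ind_le_iff.
    rewrite (Rmult_comm (INR k)), (Rle_div_r (INR n + b) x (INR k)) by lra. lra.
- rewrite <- (rsum_count_Int_part_0 (x / INR k - a) N) by lra.
  apply rsum_ext; intros n _. apply ind_le_iff.
  rewrite (Rmult_comm (INR k)), (Rle_div_r (INR n + a) x (INR k)) by lra. lra.
Qed.

Lemma dfrac_abs_le (k : nat) : Rabs (dfrac x a b k) <= 1.
Proof.
unfold dfrac. pose proof (frac_part_bounds (x / INR k - a)).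
pose proof (frac_part_bounds (x / INR k - b)). apply Rabs_le. lra.
Qed.

Lemma du_mul (n : nat) :
  du x a b n * t = x / (INR n + a) * (x / (INR n + b)).
Proof.
pose proof (shift_pos n). pose proof width_pos. unfold t. rewrite du_eq. field. lra.
Qed.

(** The positive root of (k - j) k = j t lies between s and s + j. *)
Lemma Kj_bounds (j : nat) (s : R) : (1 <= j)%nat -> 0 < s -> s ^ 2 = INR j * t ->
  s - 1 < INR (Kj j t) /\ INR (Kj j t) <= s + INR j.
Proof.
intros Hj Hs E.
assert (HjR : 1 <= INR j) by (apply (le_INR 1); exact Hj).
destruct (Kj_spec j t ratio_pos) as [[H0 H1] H2].
split.
- apply Rnot_le_lt. intros H.
  enough (S (Kj j t) <= Kj j t)%nat by lia.
  apply H2. split; [lia|]. rewrite S_INR, <- E.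
  pose proof (pos_INR (Kj j t)). apply le_INR in H0. nra.
- apply Rnot_lt_le. intros H. nra.
Qed.

Lemma Kj_le (i j : nat) : (i <= j)%nat -> (Kj i t <= Kj j t)%nat.
Proof.
intros Hij.
destruct (Kj_spec i t ratio_pos) as [[H0 H1] _].
destruct (Kj_spec j t ratio_pos) as [[H0' _] H2].
destruct (Nat.le_gt_cases j (Kj i t)) as [H|H]; [|lia].
apply H2. split; [exact H|].
apply le_INR in Hij. pose proof (pos_INR (Kj i t)). pose proof ratio_pos. nra.
Qed.

(** Here d < j and u^2 = d (t + u), hence (u - j) u <= j t. If u reached K_j + 1, this integer would
    also satisfy the inequality defining K_j. *)
Lemma cut_le_u_lt (j n : nat) : (1 <= j)%nat -> (cut x a b j <= n)%nat ->
  x / (INR n + a) < INR (Kj j t) + 1.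
Proof.
intros Hj Hn. destruct (cut_spec j Hj) as [_ H2]. specialize (H2 n Hn).
apply Rnot_le_lt. intros H.
destruct (Kj_spec j t ratio_pos) as [[HK0 HK] HK2].
enough (S (Kj j t) <= Kj j t)%nat by lia.
apply HK2. split; [lia|].
rewrite S_INR. set (k := INR (Kj j t) + 1) in *.
pose proof (du_mul n) as E. pose proof (du_pos n) as Hd. pose proof ratio_pos as Ht.
assert (Ev : x / (INR n + b) = x / (INR n + a) - du x a b n) by (unfold du; ring).
rewrite Ev in E. set (u := x / (INR n + a)) in *. set (d := du x a b n) in *.
apply le_INR in HK0.
assert (Hk : 0 < k) by (unfold k; pose proof (pos_INR (Kj j t)); lra).
assert (E2 : u * u = d * (t + u)) by lra.
assert (u * u <= INR j * (t + u)).
{ rewrite E2. apply Rmult_le_compat_r; lra. }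
assert (k - INR j <= u - INR j) by lra.
assert ((k - INR j) * k <= (u - INR j) * u) by (apply Rmult_le_compat; lra || (unfold k; lra)).
lra.
Qed.

(** Here d >= j and v^2 = d (t - v), hence v (v + j) >= j t = s^2. This forces v >= s - j, and a hit
    needs k > v. *)
Lemma lt_cut_hit_eq_0 (j n k : nat) (s : R) : (1 <= j)%nat -> 0 < s -> s ^ 2 = INR j * t ->
  (n < cut x a b j)%nat -> INR k <= s - INR j -> hit x a b n k = 0.
Proof.
intros Hj Hs E Hn Hk. destruct (cut_spec j Hj) as [H1 _]. specialize (H1 n Hn).
destruct (hit_pos_inv n k) as [H|[H _]]; [exact H|exfalso].
pose proof (du_mul n) as E1. pose proof (du_pos n) as Hd. pose proof ratio_pos as Ht.
pose proof (shift_pos n) as Hn0.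
assert (Eu : x / (INR n + a) = x / (INR n + b) + du x a b n) by (unfold du; ring).
rewrite Eu in E1.
assert (Hv : 0 < x / (INR n + b)) by (apply Rdiv_lt_0_compat; lra).
set (v := x / (INR n + b)) in *. set (d := du x a b n) in *.
assert (E2 : v * v = d * (t - v)) by lra.
assert (Htv : 0 < t - v) by nra.
assert (INR j * (t - v) <= v * v).
{ rewrite E2. apply Rmult_le_compat_r; lra. }
assert (HjR : 1 <= INR j) by (apply (le_INR 1); exact Hj).
nra.
Qed.

(** * Estimates with the cutoff d < L and n < N *)

Variables l N : nat.
Let L := S l.
Let B := 1 + b.

(** The bound on c x keeps every [s j] with j <= L at least 4 B, away from the shifts by a and b;
    the bound on t gives [sig j] >= j up to j = L + 1, so that K_j is of order [sig j]. For N, the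
    first condition makes n < N contain all hits of each relevant k, the second makes the sum of du
    over n >= N bounded. *)
Hypotheses (Hl : (1 <= l)%nat) (HLcx : 16 * B ^ 2 * INR L <= c * x)
  (HLt : 4 * INR L ^ 3 <= t).
Hypotheses (HN1 : x < INR N) (HN2 : c * x <= INR N) (HN3 : (cut x a b 1 <= N)%nat).

Let term n := Rabs (frac_part (x / (INR n + a)) - frac_part (x / (INR n + b))).
Let tail f j := rsum f N - rsum f (cut x a b j).
Let Ds m := rsum (fun i => dfrac x a b (S i)) m.
Let Gs m := rsum (fun i => INR (S i) ^ 2 / t * dfrac x a b (S i)) m.
(** [Q j] is the number of pairs with k <= K_j. [Y] sums d over the pairs with n beyond [cut L]; [Z]
    is its model, with d replaced by k^2 / t and the condition on n by k <= K_L. *)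
Let Q j := c * INR (Kj j t) - Ds (Kj j t).
Let Y := tail (fun n => dm x a b n * du x a b n) L.
Let Z := rsum (fun i => INR (S i) ^ 2 / t * (c - dfrac x a b (S i))) (Kj L t).
(* [cut x a b j] is close to [s j], and [Kj j t] to [sig j]. *)
Let s j := sqrt (c * x / INR j).
Let sig j := sqrt (INR j * t).
Let r := sqrt (c * x).

Lemma L_ge_2 : 2 <= INR L.
Proof. apply (le_INR 2). unfold L; lia. Qed.

Lemma cx_pos : 0 < c * x.
Proof. apply Rmult_lt_0_compat; [apply width_pos|exact Hx]. Qed.

Lemma cut_le_N (j : nat) : (1 <= j)%nat -> (cut x a b j <= N)%nat.
Proof.
intros Hj. apply Nat.le_trans with (2 := HN3). apply cut_decr. lia.
Qed.

Lemma s_spec (j : nat) : (1 <= j)%nat -> 0 < s j /\ INR j * s j ^ 2 = c * x.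
Proof.
intros Hj. assert (HjR : 0 < INR j) by (apply lt_0_INR; lia).
assert (H : 0 < c * x / INR j) by (apply Rdiv_lt_0_compat; [apply cx_pos|exact HjR]).
unfold s. split; [apply sqrt_lt_R0, H|]. rewrite pow2_sqrt by lra. field. lra.
Qed.

Lemma sig_spec (j : nat) : (1 <= j)%nat -> 0 < sig j /\ sig j ^ 2 = INR j * t.
Proof.
intros Hj. assert (HjR : 0 < INR j) by (apply lt_0_INR; lia).
assert (H : 0 < INR j * t) by (apply Rmult_lt_0_compat; [exact HjR|apply ratio_pos]).
unfold sig. split; [apply sqrt_lt_R0, H|]. apply pow2_sqrt; lra.
Qed.

Lemma le_of_sqr_le (u v : R) : 0 <= v -> u ^ 2 <= v ^ 2 -> u <= v.
Proof. intros Hv H. apply Rnot_lt_le. intros H'. nra. Qed.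

Lemma s_ge (j : nat) : (1 <= j <= L)%nat -> 4 * B <= s j.
Proof.
intros Hj. destruct (s_spec j) as [H1 H2]; [lia|].
apply le_of_sqr_le; [lra|].
assert (HjR : 0 < INR j) by (apply lt_0_INR; lia).
assert (HjL : INR j <= INR L) by (apply le_INR; lia).
apply (Rmult_le_reg_l (INR j)); [exact HjR|]. rewrite H2.
apply Rle_trans with (2 := HLcx).
replace (INR j * (4 * B) ^ 2) with (16 * B ^ 2 * INR j) by ring.
apply Rmult_le_compat_l; [|exact HjL]. pose proof (pow2_ge_0 B). lra.
Qed.

Lemma sig_ge (j : nat) : (1 <= j <= S L)%nat -> INR j <= sig j.
Proof.
intros Hj. destruct (sig_spec j) as [H1 H2]; [lia|].
apply le_of_sqr_le; [lra|]. rewrite H2.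
assert (HjR : 0 < INR j) by (apply lt_0_INR; lia).
assert (HjL : INR j <= INR L + 1) by (rewrite <- S_INR; apply le_INR; lia).
pose proof L_ge_2 as HL2. replace (INR j ^ 2) with (INR j * INR j) by ring.
apply Rmult_le_compat_l; [lra|].
apply Rle_trans with (1 := HjL). apply Rle_trans with (2 := HLt).
revert HL2; generalize (INR L); intros z Hz.
assert (z * 1 <= z * (z * z)) by (apply Rmult_le_compat_l; nra). nra.
Qed.

Lemma Kj_le_sig (j : nat) : (1 <= j <= S L)%nat -> INR (Kj j t) <= 2 * sig j.
Proof.
intros Hj. destruct (sig_spec j) as [H1 H2]; [lia|].
destruct (Kj_bounds j (sig j)) as [_ H]; [lia|exact H1|exact H2|].
pose proof (sig_ge j Hj). lra.
Qed.

Lemma c_lt_B : c + 1 < B.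
Proof. unfold c, B. lra. Qed.

Lemma b_Kj_le_x (j : nat) : (1 <= j <= S L)%nat -> b * INR (Kj j t) <= x.
Proof.
intros Hj. pose proof (Kj_le_sig j Hj) as HK. destruct (sig_spec j) as [H1 H2]; [lia|].
apply Rle_trans with (b * (2 * sig j)); [apply Rmult_le_compat_l; lra|].
apply le_of_sqr_le; [lra|].
replace ((b * (2 * sig j)) ^ 2) with (4 * b ^ 2 * (sig j ^ 2)) by ring.
rewrite H2. pose proof width_pos. pose proof ratio_pos.
replace (x ^ 2) with (c * x * t) by (unfold t; field; lra).
rewrite <- Rmult_assoc. apply Rmult_le_compat_r; [lra|].
apply Rle_trans with (2 := HLcx).
assert (HjL : INR j <= INR L + 1) by (rewrite <- S_INR; apply le_INR; lia).
pose proof L_ge_2. assert (b ^ 2 <= B ^ 2) by (apply pow_incr; unfold B; lra).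
pose proof (pow2_ge_0 b). pose proof (pos_INR j).
apply Rle_trans with (4 * b ^ 2 * (2 * INR L)).
- apply Rmult_le_compat_l; lra.
- nra.
Qed.

(** The terms lie between consecutive differences of c x / (n + b) and of c x / (n + a - 1). The
    telescoped value is c x / s = j s with the denominator shifted by at most B, and s >= 4 B
    controls the effect of the shift. *)
Lemma tail_du_close (j : nat) : (1 <= j <= L)%nat ->
  Rabs (tail (du x a b) j - INR j * s j) <= 3 * INR j * B.
Proof.
intros Hj. destruct (s_spec j) as [Hs Es]; [lia|].
pose proof (s_ge j Hj) as Hs4. pose proof width_pos as Hc. pose proof c_lt_B as HcB.
assert (HB : 1 < B) by (unfold B; lra).
assert (HjR : 1 <= INR j) by (apply (le_INR 1); lia).
destruct (cut_bounds j (s j)) as [H1 [_ H3]]; [lia|exact Hs|exact Es|].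
assert (H2 : INR (cut x a b j) <= s j + 1 - a).
{ destruct H3 as [H3|H3]; [lra|exact H3|]. rewrite H3 in H1. simpl in H1.
  unfold B in *. lra. }
clear H3. pose proof (cut_le_N j ltac:(lia)) as HcN. pose proof cx_pos as Hcx.
assert (Hlow : s j - B <= INR (cut x a b j) + a - 1) by (unfold B, c in *; lra).
assert (Hup : INR (cut x a b j) + b <= s j + B) by (unfold B, c in *; lra).
unfold tail. apply Rabs_le. split.
- pose proof (rsum_range_telescope_ge (du x a b) (fun n => c * x / (INR n + b))
    (cut x a b j) N HcN) as H.
  assert (HN : c * x / (INR N + b) <= 1).
  { pose proof (pos_INR N). apply Rle_div_l; lra. }
  assert (Hm : INR j * s j - INR j * B <= c * x / (INR (cut x a b j) + b)).
  { pose proof (pos_INR (cut x a b j)).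
    apply Rle_trans with (c * x / (s j + B)).
    - apply Rle_div_r; [lra|]. rewrite <- Es.
      apply Rle_trans with (INR j * ((s j - B) * (s j + B))); [right; ring|].
      apply Rmult_le_compat_l; [lra|]. nra.
    - apply Rmult_le_compat_l; [lra|]. apply Rinv_le_contravar; lra. }
  lapply H; [clear H; intros H; cbv beta in H; nra|].
  intros n Hn. pose proof (shift_pos n). rewrite S_INR, du_eq. fold c.
  replace (c * x / (INR n + b) - c * x / (INR n + 1 + b))
    with (c * x / ((INR n + b) * (INR n + 1 + b))) by (field; lra).
  apply Rmult_le_compat_l; [lra|]. apply Rinv_le_contravar.
  + apply Rmult_lt_0_compat; lra.
  + rewrite Rmult_comm. apply Rmult_le_compat; lra.
- pose proof (rsum_range_telescope_le (du x a b) (fun n => c * x / (INR n + a - 1))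
    (cut x a b j) N HcN) as H.
  assert (HN : 0 <= c * x / (INR N + a - 1)).
  { apply le_INR in HcN. apply Rdiv_le_0_compat; lra. }
  assert (Hm : c * x / (INR (cut x a b j) + a - 1) <= INR j * s j + 2 * INR j * B).
  { apply Rle_trans with (c * x / (s j - B)).
    - apply Rmult_le_compat_l; [lra|]. apply Rinv_le_contravar; lra.
    - apply Rle_div_l; [lra|]. rewrite <- Es.
      apply Rle_trans with (INR j * ((s j + 2 * B) * (s j - B))); [|right; ring].
      apply Rmult_le_compat_l; [lra|]. nra. }
  lapply H; [clear H; intros H; cbv beta in H; nra|].
  intros n [Hn _]. pose proof (shift_pos n). rewrite S_INR, du_eq. fold c.
  apply le_INR in Hn.
  replace (c * x / (INR n + a - 1) - c * x / (INR n + 1 + a - 1))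
    with (c * x / ((INR n + a - 1) * (INR n + a))) by (field; lra).
  apply Rmult_le_compat_l; [lra|]. apply Rinv_le_contravar.
  + apply Rmult_lt_0_compat; lra.
  + rewrite Rmult_comm. apply Rmult_le_compat; lra.
Qed.

Lemma hit_sum_bounds (j i : nat) : (1 <= j <= S L)%nat -> (i < Kj j t)%nat ->
  rsum (fun n => hit x a b n (S i)) N = c - dfrac x a b (S i).
Proof.
intros Hj Hi. apply sum_hit_n; [lia| |exact HN1].
apply Rle_trans with (2 := b_Kj_le_x j Hj).
apply Rmult_le_compat_l; [lra|]. apply le_INR. lia.
Qed.

(** Beyond [cut j] every hit has k <= K_j, so all inner sums over k can be given the same length and
    then exchanged with the sum over n. *)
Lemma tail_dm_hit (f : nat -> R) (j : nat) : (1 <= j)%nat ->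
  tail (fun n => dm x a b n * f n) j =
  rsum (fun i => rsum (fun n => hit x a b n (S i) * f n) N
    - rsum (fun n => hit x a b n (S i) * f n) (cut x a b j)) (Kj j t).
Proof.
intros Hj. unfold tail. rewrite rsum_minus, !rsum_swap with (n := Kj j t).
apply rsum_range_ext; [apply cut_le_N, Hj|].
intros n [Hn _].
rewrite <- (sum_hit_k n (Kj j t))
  by (apply cut_le_u_lt; assumption).
rewrite Rmult_comm, <- rsum_scal. apply rsum_ext; intros; ring.
Qed.

Lemma Q_hit (j : nat) : (1 <= j <= S L)%nat ->
  Q j = rsum (fun i => rsum (fun n => hit x a b n (S i)) N) (Kj j t).
Proof.
intros Hj. unfold Q, Ds. rewrite Rmult_comm, <- rsum_const, <- rsum_minus.
apply rsum_ext; intros i Hi. symmetry. apply (hit_sum_bounds j); assumption.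
Qed.

(* The left-hand side counts the pairs (n, k) with k <= K_j although [j <= du n]; by
   [lt_cut_hit_eq_0] such a k lies within j of [sig j]. *)
Lemma Q_sub_tail_dm (j : nat) : (1 <= j <= S L)%nat ->
  Q j - tail (dm x a b) j
  = rsum (fun i => rsum (fun n => hit x a b n (S i)) (cut x a b j)) (Kj j t).
Proof.
intros Hj.
assert (E : tail (dm x a b) j = tail (fun n => dm x a b n * 1) j).
{ unfold tail.
  rewrite !(rsum_ext (dm x a b) (fun n => dm x a b n * 1)) by (intros; ring).
  reflexivity. }
rewrite E, tail_dm_hit, Q_hit, <- rsum_minus by (lia || exact Hj).
apply rsum_ext; intros i _.
assert (E1 : forall q, rsum (fun n => hit x a b n (S i) * 1) q
  = rsum (fun n => hit x a b n (S i)) q) by (intros; apply rsum_ext; intros; ring).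
rewrite !E1. ring.
Qed.

(** The k concerned lie above [sig j] - j and do not exceed K_j <= [sig j] + j: at most 2 j + 1 of
    them, each with at most c + 1 < B hits. *)
Lemma excess_bounds (j : nat) : (1 <= j <= S L)%nat ->
  0 <= Q j - tail (dm x a b) j <= (2 * INR j + 1) * B.
Proof.
intros Hj. rewrite Q_sub_tail_dm by exact Hj.
destruct (sig_spec j) as [Hs Es]; [lia|].
pose proof (sig_ge j Hj) as Hsj. pose proof c_lt_B as HcB.
assert (HB : 1 < B) by (unfold B; lra).
split.
{ apply rsum_ge_0; intros; apply rsum_ge_0; intros; apply hit_ge_0. }
destruct (Kj_bounds j (sig j)) as [_ HK]; [lia|exact Hs|exact Es|].
apply Rle_trans with
  (rsum (fun i => B * (1 - ind_le (INR (S i)) (sig j - INR j))) (Kj j t)).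
- apply rsum_le; intros i Hi.
  destruct (Rle_or_lt (INR (S i)) (sig j - INR j)) as [H|H].
  + rewrite ind_le_true by exact H. right.
    rewrite Rminus_diag, Rmult_0_r.
    transitivity (rsum (fun _ => 0) (cut x a b j)); [|rewrite rsum_const; ring].
    apply rsum_ext; intros n Hn.
    apply (lt_cut_hit_eq_0 j n (S i) (sig j)); try assumption. lia.
  + rewrite ind_le_false by exact H.
    apply Rle_trans with (rsum (fun n => hit x a b n (S i)) N).
    * apply rsum_le_upper; [apply cut_le_N; lia|]. intros; apply hit_ge_0.
    * rewrite (hit_sum_bounds j) by assumption.
      pose proof (dfrac_abs_le (S i)) as H1. apply Rabs_le_between in H1. lra.
- rewrite rsum_scal, rsum_minus, rsum_const.
  destruct (nat_floor (sig j - INR j)) as [p [_ Hp]]; [lra|].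
  rewrite (rsum_count p) by exact Hp.
  rewrite (Rmult_comm _ B). apply Rmult_le_compat_l; [lra|].
  destruct (Nat.le_gt_cases (Kj j t) p) as [H|H].
  + rewrite Nat.min_l by exact H. pose proof (pos_INR j). lra.
  + rewrite Nat.min_r by lia. lra.
Qed.

Lemma k_sqr_div_t_le (i : nat) : (i < Kj L t)%nat ->
  0 <= INR (S i) ^ 2 / t <= 4 * INR L.
Proof.
intros Hi. pose proof ratio_pos as Ht.
destruct (sig_spec L) as [Hs Es]; [unfold L; lia|].
pose proof (Kj_le_sig L ltac:(unfold L; lia)) as HK.
assert (Hk : INR (S i) <= INR (Kj L t)) by (apply le_INR; lia).
pose proof (pos_INR (S i)).
split; [apply Rdiv_le_0_compat; [apply pow2_ge_0|exact Ht]|].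
apply Rle_div_l; [lra|].
replace (4 * INR L * t) with ((2 * sig L) ^ 2) by (rewrite Rpow_mult_distr, Es; ring).
apply pow_incr. lra.
Qed.

(** Since u v = d t and k lies in (v, u], k^2 differs from d t by at most u d; and u <= K_L + 1 <= 3
    [sig L], d < L. *)
Lemma hit_weight_close (n k : nat) : (cut x a b L <= n)%nat ->
  hit x a b n k * Rabs (INR k ^ 2 / t - du x a b n)
    <= hit x a b n k * (3 * sig L * INR L / t).
Proof.
intros Hn.
destruct (hit_pos_inv n k) as [E|[Hv Hu]]; [rewrite E; lra|].
apply Rmult_le_compat_l; [apply hit_ge_0|].
assert (HL1 : (1 <= L)%nat) by (unfold L; lia).
pose proof (cut_le_u_lt L n HL1 Hn) as HuK.
destruct (cut_spec L HL1) as [_ Hd]. specialize (Hd n Hn).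
pose proof (Kj_le_sig L ltac:(unfold L; lia)) as HK.
pose proof (sig_ge L ltac:(unfold L; lia)) as HsL. pose proof L_ge_2 as HL2.
pose proof (du_mul n) as E. pose proof (du_pos n) as Hd0. pose proof ratio_pos as Ht.
pose proof (shift_pos n) as Hn0.
assert (Hv0 : 0 < x / (INR n + b)) by (apply Rdiv_lt_0_compat; lra).
assert (Eu : x / (INR n + a) = x / (INR n + b) + du x a b n) by (unfold du; ring).
set (u := x / (INR n + a)) in *. set (v := x / (INR n + b)) in *.
set (d := du x a b n) in *. set (k' := INR k) in *.
assert (Hu3 : u <= 3 * sig L) by lra.
replace (k' ^ 2 / t - d) with ((k' ^ 2 - u * v) / t) by (rewrite <- E; field; lra).
unfold Rdiv. rewrite Rabs_mult, Rabs_inv, (Rabs_pos_eq t) by lra.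
apply Rmult_le_compat_r; [apply Rlt_le, Rinv_0_lt_compat, Ht|].
assert (Hud : u * d <= 3 * sig L * INR L) by (apply Rmult_le_compat; lra).
assert (k' * k' <= u * u) by (apply Rmult_le_compat; lra).
assert (v * v <= k' * k') by (apply Rmult_le_compat; lra).
assert (v * d <= u * d) by (apply Rmult_le_compat_r; lra).
apply Rabs_le. nra.
Qed.

(** Two sources of error. The pairs with n before [cut L] are O(L B) in number and have weight at
    most 4 L. For the others the weight is off by [eta], with at most B hits for each of at most 2
    [sig L] values of k; as [sig L]^2 = L t, this adds at most 6 L^2 B. *)
Lemma Y_Z_close : Rabs (Y - Z) <= 18 * INR L ^ 2 * B.
Proof.
assert (HL1 : (1 <= L)%nat) by (unfold L; lia).
assert (HLr : (1 <= L <= S L)%nat) by lia.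
destruct (sig_spec L HL1) as [Hs Es].
pose proof (Kj_le_sig L HLr) as HK. pose proof L_ge_2 as HL2.
pose proof c_lt_B as HcB. pose proof ratio_pos as Ht. pose proof width_pos as Hc.
pose proof (excess_bounds L HLr) as Hex. rewrite Q_sub_tail_dm in Hex by exact HLr.
set (eta := 3 * sig L * INR L / t).
assert (Heta : 0 <= eta).
{ apply Rdiv_le_0_compat; [|exact Ht]. apply Rmult_le_pos; lra. }
set (h := fun i n => hit x a b n (S i)).
assert (EZY : Z - Y = rsum (fun i =>
  INR (S i) ^ 2 / t * rsum (h i) (cut x a b L)
  + (rsum (fun n => h i n * (INR (S i) ^ 2 / t - du x a b n)) N
     - rsum (fun n => h i n * (INR (S i) ^ 2 / t - du x a b n)) (cut x a b L))) (Kj L t)).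
{ unfold Y, Z. rewrite (tail_dm_hit (du x a b) L HL1), <- rsum_minus.
  apply rsum_ext; intros i Hi.
  rewrite <- (hit_sum_bounds L i HLr Hi). fold (h i).
  assert (E : forall q, rsum (fun n => h i n * (INR (S i) ^ 2 / t - du x a b n)) q
    = INR (S i) ^ 2 / t * rsum (h i) q - rsum (fun n => h i n * du x a b n) q).
  { intros q. rewrite <- rsum_scal, <- rsum_minus. apply rsum_ext; intros; ring. }
  rewrite !E. unfold h. ring. }
replace (Y - Z) with (- (Z - Y)) by ring.
rewrite Rabs_Ropp, EZY. clear EZY.
apply Rle_trans with (1 := rsum_abs_le _ _).
apply Rle_trans with (rsum (fun i =>
  4 * INR L * rsum (h i) (cut x a b L) + eta * B) (Kj L t)).
- apply rsum_le; intros i Hi.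
  pose proof (k_sqr_div_t_le i Hi) as Hk.
  apply Rle_trans with (1 := Rabs_triang _ _). apply Rplus_le_compat.
  + assert (0 <= rsum (h i) (cut x a b L)) by (apply rsum_ge_0; intros; apply hit_ge_0).
    rewrite Rabs_pos_eq by (apply Rmult_le_pos; lra).
    apply Rmult_le_compat_r; lra.
  + assert (HS : eta * rsum (h i) N - eta * rsum (h i) (cut x a b L) <= eta * B).
    { rewrite <- Rmult_minus_distr_l. apply Rmult_le_compat_l; [exact Heta|].
      unfold h. rewrite (hit_sum_bounds L i HLr Hi).
      pose proof (dfrac_abs_le (S i)) as H1. apply Rabs_le_between in H1.
      assert (0 <= rsum (fun n => hit x a b n (S i)) (cut x a b L))
        by (apply rsum_ge_0; intros; apply hit_ge_0).
      lra. }
    pose proof (cut_le_N L HL1) as HcN.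
    assert (HP : forall n, (cut x a b L <= n < N)%nat ->
      - (eta * h i n) <= h i n * (INR (S i) ^ 2 / t - du x a b n) <= eta * h i n).
    { intros n [Hn _]. pose proof (hit_weight_close n (S i) Hn) as H. fold eta in H.
      fold (h i n) in H. pose proof (hit_ge_0 n (S i)) as H0. fold (h i n) in H0.
      rewrite (Rmult_comm eta).
      apply Rabs_le_between. rewrite Rabs_mult, (Rabs_pos_eq (h i n)) by exact H0.
      exact H. }
    apply Rabs_le. split.
    * pose proof (rsum_range_le (fun n => - (eta * h i n))
        (fun n => h i n * (INR (S i) ^ 2 / t - du x a b n)) _ _ HcN
        (fun n Hn => proj1 (HP n Hn))) as H.
      assert (E : forall q, rsum (fun n => - (eta * h i n)) q = - (eta * rsum (h i) q)).
      { intros q. rewrite Ropp_mult_distr_l, <- rsum_scal.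
        apply rsum_ext; intros; ring. }
      rewrite !E in H. lra.
    * pose proof (rsum_range_le (fun n => h i n * (INR (S i) ^ 2 / t - du x a b n))
        (fun n => eta * h i n) _ _ HcN (fun n Hn => proj2 (HP n Hn))) as H.
      rewrite !rsum_scal in H. lra.
- rewrite rsum_plus, rsum_scal, rsum_const. unfold h.
  assert (H1 : INR (Kj L t) * (eta * B) <= 6 * INR L ^ 2 * B).
  { rewrite <- Rmult_assoc. apply Rmult_le_compat_r; [unfold B in *; lra|].
    apply Rle_trans with (2 * sig L * eta).
    - apply Rmult_le_compat_r; lra.
    - right. unfold eta. replace (2 * sig L * (3 * sig L * INR L / t))
        with (6 * sig L ^ 2 * INR L / t) by (field; lra).
      rewrite Es. field. lra. }
  assert (H2 : 4 * INR L * rsum (fun i => rsum (fun n => hit x a b n (S i)) (cut x a b L))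
    (Kj L t) <= 4 * INR L * ((2 * INR L + 1) * B)) by (apply Rmult_le_compat_l; lra).
  assert (INR L * B <= INR L ^ 2 * B).
  { apply Rmult_le_compat_r; [unfold B in *; lra|].
    replace (INR L ^ 2) with (INR L * INR L) by ring. nra. }
  lra.
Qed.

Lemma s_eq (j : nat) : (1 <= j)%nat -> s j = r / sqrt (INR j).
Proof.
intros Hj. unfold s, r. apply sqrt_div_alt. apply lt_0_INR; lia.
Qed.

Lemma j_s_eq (j : nat) : (1 <= j)%nat -> INR j * s j = r * sqrt (INR j).
Proof.
intros Hj. rewrite s_eq by exact Hj.
assert (H : 0 < INR j) by (apply lt_0_INR; lia).
assert (H1 : 0 < sqrt (INR j)) by (apply sqrt_lt_R0, H).
rewrite <- (sqrt_sqrt (INR j)) at 1 by lra. field. lra.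
Qed.

Lemma c_sig_eq (j : nat) : c * sig j = r * sqrt (INR j).
Proof.
pose proof width_pos as Hc. pose proof ratio_pos as Ht. pose proof (pos_INR j).
unfold sig, r. rewrite sqrt_mult by lra.
replace (c * x) with (c ^ 2 * t) by (unfold t; field; lra).
rewrite sqrt_mult, sqrt_pow2 by (try apply pow2_ge_0; lra). ring.
Qed.

Lemma sqrt_succ_sub (z : R) : 0 < z -> 0 <= sqrt (z + 1) - sqrt z <= / (2 * sqrt z).
Proof.
intros Hz. assert (H : 0 < sqrt z) by (apply sqrt_lt_R0, Hz).
assert (H1 : sqrt z <= sqrt (z + 1)) by (apply sqrt_le_1; lra).
pose proof (sqrt_sqrt z ltac:(lra)). pose proof (sqrt_sqrt (z + 1) ltac:(lra)).
split; [lra|].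
rewrite <- (Rmult_1_l (/ _)). apply Rle_div_r; [lra|]. nra.
Qed.

(* Each [D k] is bounded by [c + N k], where [N k] counts the pairs hitting [k];
   this beats the trivial bound when [c] is small. *)
Lemma last_block_bound :
  Rabs ((Gs (Kj (S L) t) - Gs (Kj L t)) - INR L * (Ds (Kj (S L) t) - Ds (Kj L t)))
    <= 5 * s L + 24 * INR L * B.
Proof.
assert (HL1 : (1 <= L)%nat) by (unfold L; lia).
assert (HLr : (1 <= L <= S L)%nat) by lia.
assert (HSr : (1 <= S L <= S L)%nat) by lia.
destruct (sig_spec L HL1) as [Hs Es].
destruct (sig_spec (S L)) as [Hs' Es']; [lia|].
destruct (s_spec L HL1) as [Hsr Esr]. destruct (s_spec (S L)) as [Hsr' Esr']; [lia|].
pose proof (Kj_le_sig (S L) HSr) as HK. pose proof L_ge_2 as HL2.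
pose proof c_lt_B as HcB. pose proof ratio_pos as Ht. pose proof width_pos as Hc.
pose proof (Kj_le L (S L) ltac:(lia)) as HKK.
assert (HB : 1 < B) by (unfold B; lra).
set (N' := fun i => c - dfrac x a b (S i)).
assert (HN' : forall i, (i < Kj (S L) t)%nat ->
  0 <= N' i /\ Rabs (dfrac x a b (S i)) <= c + N' i).
{ intros i Hi. unfold N'. rewrite <- (hit_sum_bounds (S L) i HSr Hi).
  assert (H : 0 <= rsum (fun n => hit x a b n (S i)) N)
    by (apply rsum_ge_0; intros; apply hit_ge_0).
  split; [exact H|]. rewrite (hit_sum_bounds (S L) i HSr Hi) in *.
  apply Rabs_le. lra. }
(* On this block k^2 >= [sig L]^2 = L t, and k^2 <= (L + 1) t + (L + 1) K_(L+1), where the last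
   product is at most 2 t. *)
assert (HW : forall i, (Kj L t <= i < Kj (S L) t)%nat ->
  0 <= INR (S i) ^ 2 / t - INR L <= 3).
{ intros i Hi.
  destruct (Kj_bounds L (sig L) HL1 Hs Es) as [HKL _].
  assert (Hi1 : INR (Kj L t) + 1 <= INR (S i))
    by (rewrite S_INR; apply Rplus_le_compat_r, le_INR; lia).
  assert (Hi2 : INR (S i) <= INR (Kj (S L) t)) by (apply le_INR; lia).
  destruct (Kj_spec (S L) t Ht) as [[HK0 HK1] _]. apply le_INR in HK0.
  set (k := INR (S i)) in *. set (K1 := INR (Kj (S L) t)) in *.
  assert (Hk2 : INR L * t <= k ^ 2) by (rewrite <- Es; apply pow_incr; lra).
  split.
  - enough (INR L <= k ^ 2 / t) by lra. apply Rle_div_r; lra.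
  - enough (k ^ 2 / t <= INR L + 3) by lra. apply Rle_div_l; [lra|].
    assert (k ^ 2 <= K1 ^ 2) by (apply pow_incr; lra).
    assert (K1 ^ 2 <= INR (S L) * t + INR (S L) * K1) by lra.
    assert (HS : INR (S L) * K1 <= 2 * t).
    { apply Rle_trans with (INR (S L) * (2 * sig (S L))).
      - apply Rmult_le_compat_l; [apply pos_INR|exact HK].
      - enough (INR (S L) * sig (S L) <= t) by lra.
        apply le_of_sqr_le; [lra|]. rewrite Rpow_mult_distr, Es'.
        replace (INR (S L) ^ 2 * (INR (S L) * t)) with (INR (S L) ^ 3 * t) by ring.
        replace (t ^ 2) with (t * t) by ring.
        apply Rmult_le_compat_r; [lra|]. apply Rle_trans with (2 := HLt).
        rewrite S_INR. generalize (INR L) HL2; intros z Hz.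
        apply Rle_trans with ((3 / 2 * z) ^ 3); [apply pow_incr; lra|].
        assert (0 <= z ^ 3) by (apply pow_le; lra).
        rewrite Rpow_mult_distr. lra. }
    rewrite S_INR in *. lra. }
assert (E : (Gs (Kj (S L) t) - Gs (Kj L t)) - INR L * (Ds (Kj (S L) t) - Ds (Kj L t))
  = rsum (fun i => (INR (S i) ^ 2 / t - INR L) * dfrac x a b (S i)) (Kj (S L) t)
    - rsum (fun i => (INR (S i) ^ 2 / t - INR L) * dfrac x a b (S i)) (Kj L t)).
{ assert (E0 : forall q,
    rsum (fun i => (INR (S i) ^ 2 / t - INR L) * dfrac x a b (S i)) q
    = Gs q - INR L * Ds q).
  { intros q. unfold Gs, Ds. rewrite <- rsum_scal, <- rsum_minus.
    apply rsum_ext; intros; ring. }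
  rewrite !E0. ring. }
rewrite E. clear E.
assert (HP : forall i, (Kj L t <= i < Kj (S L) t)%nat ->
  - (3 * (c + N' i)) <= (INR (S i) ^ 2 / t - INR L) * dfrac x a b (S i) <= 3 * (c + N' i)).
{ intros i Hi. destruct (HN' i ltac:(lia)) as [H0 H1]. specialize (HW i Hi).
  apply Rabs_le_between. rewrite Rabs_mult, (Rabs_pos_eq (_ - _)) by lra.
  apply Rmult_le_compat; try apply Rabs_pos; lra. }
assert (EQ : forall q, rsum (fun i => 3 * (c + N' i)) q
  = 3 * (c * INR q + (c * INR q - Ds q))).
{ intros q. rewrite rsum_scal, rsum_plus, rsum_const. unfold N'.
  rewrite rsum_minus, rsum_const. unfold Ds. ring. }
assert (HA : 3 * (c * (INR (Kj (S L) t) - INR (Kj L t)) + (Q (S L) - Q L))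
  <= 5 * s L + 24 * INR L * B).
{ pose proof (excess_bounds L HLr) as X1. pose proof (excess_bounds (S L) HSr) as X2.
  assert (HQ : Q (S L) - Q L <= (tail (dm x a b) (S L) - tail (dm x a b) L)
    + (2 * INR (S L) + 1) * B) by lra.
  (* An n between the two cuts has du < L + 1, hence at most L + 2 integers k. *)
  assert (HT : tail (dm x a b) (S L) - tail (dm x a b) L
    <= (INR (cut x a b L) - INR (cut x a b (S L))) * (INR L + 2)).
  { unfold tail.
    pose proof (rsum_range_const (dm x a b) (INR L + 2) (cut x a b (S L)) (cut x a b L))
      as H.
    lapply H; [clear H; intros H|apply cut_decr; lia].
    lapply H; [clear H; intros H; lra|].
    intros n [Hn _]. destruct (cut_spec (S L)) as [_ Hd]; [lia|]. specialize (Hd n Hn).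
    unfold dm, du in *. rewrite S_INR in Hd.
    pose proof (Int_part_bounds (x / (INR n + a))).
    pose proof (Int_part_bounds (x / (INR n + b))). lra. }
  destruct (cut_bounds L (s L) HL1 Hsr Esr) as [_ [C1 _]].
  destruct (cut_bounds (S L) (s (S L)) ltac:(lia) Hsr' Esr') as [C2 _].
  destruct (Kj_bounds L (sig L) HL1 Hs Es) as [K1 _].
  destruct (Kj_bounds (S L) (sig (S L)) ltac:(lia) Hs' Es') as [_ K2].
  assert (Hr0 : 0 < r) by (apply sqrt_lt_R0, cx_pos).
  pose proof (sqrt_succ_sub (INR L) ltac:(lra)) as HD. rewrite <- S_INR in HD.
  assert (Hq : 0 < sqrt (INR L)) by (apply sqrt_lt_R0; lra).
  (* [F1] and [F2] each contribute s L / 2; [F2] counts twice because L + 2 <= 2 L. The total 3 (1/2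
     + 1) is below the coefficient 5. *)
  assert (F1 : c * sig (S L) - c * sig L <= s L / 2).
  { rewrite !c_sig_eq, s_eq by exact HL1. rewrite <- Rmult_minus_distr_l.
    replace (r / sqrt (INR L) / 2) with (r * / (2 * sqrt (INR L))) by (field; lra).
    apply Rmult_le_compat_l; lra. }
  assert (F2 : (s L - s (S L)) * INR L <= s L / 2).
  { assert (H1 : s (S L) * sqrt (INR (S L)) = s L * sqrt (INR L)).
    { rewrite !s_eq by lia. field. split; [lra|].
      apply Rgt_not_eq, sqrt_lt_R0, lt_0_INR. lia. }
    pose proof (sqrt_sqrt (INR L) ltac:(lra)) as E1.
    set (p := sqrt (INR L)) in *. set (q := sqrt (INR (S L))) in *.
    assert (Hqp : 0 < q) by lra.
    replace (s (S L)) with (s L * p / q) by (rewrite <- H1; field; lra).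
    replace ((s L - s L * p / q) * INR L) with (s L * ((q - p) * INR L / q))
      by (field; lra).
    unfold Rdiv at 2. apply Rmult_le_compat_l; [lra|].
    apply Rle_div_l; [lra|]. rewrite <- E1.
    assert ((q - p) * (2 * p) <= 1).
    { apply Rle_div_r; [lra|]. unfold Rdiv. rewrite Rmult_1_l. apply HD. }
    nra. }
  assert (F3 : s (S L) <= s L).
  { apply sqrt_le_1_alt. apply Rmult_le_compat_l; [apply Rlt_le, cx_pos|].
    apply Rinv_le_contravar; [lra|]. apply le_INR; lia. }
  assert (G1 : c * (INR (Kj (S L) t) - INR (Kj L t)) <= s L / 2 + (INR L + 2) * B).
  { rewrite S_INR in K2.
    apply Rle_trans with (c * ((sig (S L) - sig L) + (INR L + 2))).
    - apply Rmult_le_compat_l; lra.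
    - rewrite Rmult_plus_distr_l. apply Rplus_le_compat; [lra|].
      rewrite (Rmult_comm c). apply Rmult_le_compat_l; lra. }
  assert (G2 : (INR (cut x a b L) - INR (cut x a b (S L))) * (INR L + 2)
    <= s L + (INR L + 2) * B).
  { apply Rle_trans with ((s L - s (S L) + B) * (INR L + 2)).
    - apply Rmult_le_compat_r; [lra|]. unfold B in *; lra.
    - assert ((s L - s (S L)) * 2 <= (s L - s (S L)) * INR L)
        by (apply Rmult_le_compat_l; lra). lra. }
  rewrite S_INR in HQ.
  assert (2 * B <= INR L * B) by (apply Rmult_le_compat_r; lra).
  lra. }
apply Rabs_le. split.
- pose proof (rsum_range_le (fun i => - (3 * (c + N' i))) _ _ _ HKK
    (fun i Hi => proj1 (HP i Hi))) as H.
  assert (EN : forall q, rsum (fun i => - (3 * (c + N' i))) q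
    = - rsum (fun i => 3 * (c + N' i)) q).
  { intros q. replace (- rsum (fun i => 3 * (c + N' i)) q)
      with ((-1) * rsum (fun i => 3 * (c + N' i)) q) by ring.
    rewrite <- rsum_scal. apply rsum_ext; intros; ring. }
  rewrite !EN, !EQ in H. unfold Q in HA. lra.
- pose proof (rsum_range_le _ (fun i => 3 * (c + N' i)) _ _ HKK
    (fun i Hi => proj2 (HP i Hi))) as H.
  rewrite !EQ in H. unfold Q in HA. lra.
Qed.

(** * Recombination into the sums R_j and the main term *)

Lemma sum_block (z : R) (p q : nat) : (p <= q)%nat ->
  sum_n_m (fun k => (INR k ^ 2 * c / x - z)
    * (frac_part (x / INR k - a) - frac_part (x / INR k - b))) (S p) q
  = (Gs q - Gs p) - z * (Ds q - Ds p).
Proof.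
intros Hpq. rewrite sum_n_m_rsum by exact Hpq.
pose proof width_pos as Hc.
assert (E : forall m, rsum (fun i => (INR (S i) ^ 2 * c / x - z)
    * (frac_part (x / INR (S i) - a) - frac_part (x / INR (S i) - b))) m
  = Gs m - z * Ds m).
{ intros m. unfold Gs, Ds. rewrite <- rsum_scal, <- rsum_minus.
  apply rsum_ext; intros i _. fold (dfrac x a b (S i)). unfold t. field. lra. }
rewrite !E.
change (Gs q - z * Ds q - (Gs p - z * Ds p) = (Gs q - Gs p) - z * (Ds q - Ds p)).
ring.
Qed.

Lemma Kj_1 : Kj 1 t = S (K t).
Proof.
pose proof ratio_pos as Ht.
destruct (K_spec t Ht) as [H1 H2]. destruct (Kj_spec 1 t Ht) as [[H3 H4] H5].
apply Nat.le_antisymm.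
- destruct (Kj 1 t) as [|p]; [lia|]. apply le_n_S, H2.
  rewrite S_INR in H4. simpl in H4. lra.
- apply H5. split; [lia|]. rewrite S_INR. simpl. lra.
Qed.

(** As K_1 = K + 1, the two sums differ by the single term k = K_1, whose weight is at most (2
    [sig 1])^2 / t = 4. *)
Lemma R0_close : Rabs (Rj 0 x a b - Gs (Kj 1 t)) <= 4.
Proof.
pose proof width_pos as Hc. pose proof ratio_pos as Ht.
destruct (sig_spec 1) as [Hs Es]; [lia|].
pose proof (Kj_le_sig 1 ltac:(lia)) as HK.
assert (E : Rj 0 x a b = Gs (K t)).
{ unfold Rj. fold c. fold t. rewrite sum_n_m_rsum by lia. simpl (rsum _ 0).
  rewrite Rminus_0_r. unfold Gs. rewrite <- rsum_scal.
  apply rsum_ext; intros i _. fold (dfrac x a b (S i)). unfold t. field. lra. }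
assert (E2 : Gs (S (K t)) = Gs (K t) + INR (S (K t)) ^ 2 / t * dfrac x a b (S (K t)))
  by reflexivity.
rewrite E, Kj_1, E2, <- Kj_1.
replace (Gs (K t) - _) with (- (INR (Kj 1 t) ^ 2 / t * dfrac x a b (Kj 1 t))) by ring.
rewrite Rabs_Ropp, Rabs_mult.
assert (H0 : 0 <= INR (Kj 1 t) ^ 2 / t <= 4).
{ split; [apply Rdiv_le_0_compat; [apply pow2_ge_0|exact Ht]|].
  apply Rle_div_l; [lra|].
  replace (4 * t) with ((2 * sig 1) ^ 2) by (rewrite Rpow_mult_distr, Es; simpl; ring).
  apply pow_incr. pose proof (pos_INR (Kj 1 t)). lra. }
rewrite (Rabs_pos_eq (_ / t)) by lra.
rewrite <- (Rmult_1_r 4). apply Rmult_le_compat; try apply Rabs_pos; try lra.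
apply dfrac_abs_le.
Qed.

(** Each R_j spans two consecutive blocks: the sums [Gs] telescope with step 2 and leave end values
    only, while the weights j in front of [Ds] leave twice an inner sum. The lower end disappears
    because K_0 = 0. *)
Lemma sum_Rj (m : nat) : rsum (fun i => Rj (S i) x a b) (S m) =
  Gs (Kj (S (S m)) t) + Gs (Kj (S m) t) - Gs (Kj 1 t)
  - INR (S m) * Ds (Kj (S (S m)) t) - INR m * Ds (Kj (S m) t)
  + 2 * rsum (fun i => Ds (Kj (S i) t)) m.
Proof.
assert (E : forall i, Rj (S i) x a b = (Gs (Kj (S (S i)) t) - Gs (Kj i t))
  - INR (S i) * (Ds (Kj (S (S i)) t) - Ds (Kj i t))).
{ intros i. unfold Rj. fold c. fold t. apply sum_block. apply Kj_le. lia. }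
induction m as [|m IH].
- rewrite rsum_S, E, (Kj_0 t ratio_pos), !rsum_0.
  change (Gs 0) with 0; change (Ds 0) with 0. change (INR 1) with 1. change (INR 0) with 0.
  ring.
- rewrite rsum_S, IH, E, (rsum_S _ m), !S_INR. ring.
Qed.

(* Abel summation: [sum_(n >= cut L) g (floor (du n))] is expressed through the tails
   starting at the [cut j]. *)
Lemma term_sum :
  rsum term N - rsum term (cut x a b L) =
  tail (du x a b) L
  + rsum (fun i => 2 * (tail (du x a b) L - tail (du x a b) (S i))
      - 4 * INR (S i) * (INR (cut x a b (S i)) - INR (cut x a b L))) l
  + tail (dm x a b) L
  + 2 * rsum (fun i => tail (dm x a b) L - tail (dm x a b) (S i)) l - 2 * Y.
Proof.
assert (HL1 : (1 <= L)%nat) by (unfold L; lia).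
set (g := fun n => du x a b n
  + rsum (fun i => ind_le (INR (S i)) (du x a b n) * (2 * du x a b n - 4 * INR (S i))) l
  + dm x a b n - 2 * (dm x a b n * du x a b n)
  + 2 * rsum (fun i => ind_le (INR (S i)) (du x a b n) * dm x a b n) l).
assert (ET : rsum term N - rsum term (cut x a b L) = rsum g N - rsum g (cut x a b L)).
{ apply rsum_range_ext; [apply cut_le_N, HL1|].
  intros n [Hn _]. destruct (cut_spec L HL1) as [_ Hd]. specialize (Hd n Hn).
  pose proof (du_pos n) as Hd0.
  destruct (nat_floor (du x a b n)) as [f [_ Hf]]; [lra|].
  assert (Hfl : (f <= l)%nat).
  { assert (H : INR f < INR (S l)) by (unfold L in Hd; lra). apply INR_lt in H. lia. }
  unfold term. rewrite (abs_frac_part_sub _ _ f l Hf Hfl).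
  fold (du x a b n). fold (dm x a b n). unfold g.
  rewrite (rsum_ext (fun i => ind_le (INR (S i)) (du x a b n) * dm x a b n)
    (fun i => dm x a b n * ind_le (INR (S i)) (du x a b n))) by (intros; ring).
  rewrite rsum_scal. ring. }
rewrite ET. clear ET.
(* Each indicator sum over n is a prefix sum. Since the cuts decrease in j, the minimum is the cut
   at i + 1 when q = N, and [cut L] when q is [cut L]. *)
assert (E : forall q, rsum g q = rsum (du x a b) q
  + rsum (fun i => 2 * rsum (du x a b) (Nat.min q (cut x a b (S i)))
      - 4 * INR (S i) * INR (Nat.min q (cut x a b (S i)))) l
  + rsum (dm x a b) q - 2 * rsum (fun n => dm x a b n * du x a b n) q
  + 2 * rsum (fun i => rsum (dm x a b) (Nat.min q (cut x a b (S i)))) l).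
{ intros q. unfold g.
  rewrite rsum_plus, rsum_minus, rsum_plus, rsum_plus, !rsum_scal.
  rewrite !(rsum_swap _ l q).
  do 2 f_equal; [do 2 f_equal|].
  - apply rsum_ext; intros i _.
    rewrite (rsum_cut (fun n => 2 * du x a b n - 4 * INR (S i))) by lia.
    rewrite rsum_minus, rsum_scal, rsum_const. ring.
  - apply rsum_ext; intros i _. apply (rsum_cut (dm x a b)). lia. }
rewrite !E. unfold Y, tail.
rewrite (rsum_ext (fun i => 2 * rsum (du x a b) (Nat.min N (cut x a b (S i)))
      - 4 * INR (S i) * INR (Nat.min N (cut x a b (S i))))
   (fun i => 2 * rsum (du x a b) (cut x a b (S i)) - 4 * INR (S i) * INR (cut x a b (S i))))
  by (intros i _; rewrite Nat.min_r by (apply cut_le_N; lia); reflexivity).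
rewrite (rsum_ext (fun i => rsum (dm x a b) (Nat.min N (cut x a b (S i))))
   (fun i => rsum (dm x a b) (cut x a b (S i))))
  by (intros i _; rewrite Nat.min_r by (apply cut_le_N; lia); reflexivity).
rewrite (rsum_ext (fun i => 2 * rsum (du x a b) (Nat.min (cut x a b L) (cut x a b (S i)))
      - 4 * INR (S i) * INR (Nat.min (cut x a b L) (cut x a b (S i))))
   (fun i => 2 * rsum (du x a b) (cut x a b L) - 4 * INR (S i) * INR (cut x a b L)))
  by (intros i Hi; rewrite Nat.min_l by (apply cut_decr; unfold L; lia); reflexivity).
rewrite (rsum_ext (fun i => rsum (dm x a b) (Nat.min (cut x a b L) (cut x a b (S i))))
   (fun i => rsum (dm x a b) (cut x a b L)))
  by (intros i Hi; rewrite Nat.min_l by (apply cut_decr; unfold L; lia); reflexivity).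
match goal with |- _ = _ + rsum ?F l + _ + 2 * rsum ?H l - _ =>
  rewrite (rsum_ext F (fun i =>
    (2 * rsum (du x a b) (cut x a b (S i)) - 4 * INR (S i) * INR (cut x a b (S i)))
    - (2 * rsum (du x a b) (cut x a b L) - 4 * INR (S i) * INR (cut x a b L))))
    by (intros; ring);
  rewrite (rsum_ext H (fun i =>
    rsum (dm x a b) (cut x a b (S i)) - rsum (dm x a b) (cut x a b L))) by (intros; ring)
end.
rewrite (rsum_minus (fun i => 2 * rsum (du x a b) (cut x a b (S i)) - _)).
rewrite (rsum_minus (fun i => rsum (dm x a b) (cut x a b (S i)))).
ring.
Qed.

(* Replacing [tail du j], [j * cut j] and [c * Kj j t] by [r * sqrt j] turns the
   expression into [r * sqrt_defect L] exactly. *)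
Lemma main_close :
  Rabs ((2 * INR L - 1) * tail (du x a b) L
    - 2 * rsum (fun i => tail (du x a b) (S i)) l
    - 4 * rsum (fun i => INR (S i) * INR (cut x a b (S i))) l
    + 2 * INR L * (INR L - 1) * INR (cut x a b L)
    + c * ((2 * INR L - 1) * INR (Kj L t) - 2 * rsum (fun i => INR (Kj (S i) t)) l
       - 2 / t * rsum (fun i => INR (S i) ^ 2) (Kj L t))
    - r * sqrt_defect L) <= 30 * INR L ^ 2 * B.
Proof.
assert (HL1 : (1 <= L)%nat) by (unfold L; lia).
pose proof L_ge_2 as HL2. pose proof c_lt_B as HcB. pose proof width_pos as Hc.
pose proof ratio_pos as Ht. assert (HB : 1 < B) by (unfold B; lra).
assert (HlL : INR l = INR L - 1) by (unfold L; rewrite S_INR; ring).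
destruct (sig_spec L HL1) as [HsL EsL].
pose proof (sig_ge L ltac:(lia)) as HsigL.
assert (Hle : forall i, (i < l)%nat -> (1 <= S i <= L)%nat) by (unfold L; intros; lia).
assert (HleR : forall i, (i < l)%nat -> 1 <= INR (S i) <= INR L).
{ intros i Hi. split; [apply (le_INR 1); lia|apply le_INR; unfold L; lia]. }
assert (Tclose : forall j, (1 <= j <= L)%nat ->
  Rabs (tail (du x a b) j - r * sqrt (INR j)) <= 3 * INR L * B).
{ intros j Hj. rewrite <- j_s_eq by lia.
  apply Rle_trans with (1 := tail_du_close j Hj).
  apply Rmult_le_compat_r; [lra|]. apply Rmult_le_compat_l; [lra|].
  apply le_INR; lia. }
assert (Cclose : forall j, (1 <= j)%nat -> Rabs (INR (cut x a b j) - s j) <= B).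
{ intros j Hj. destruct (s_spec j Hj) as [Hs Es].
  destruct (cut_bounds j (s j) Hj Hs Es) as [C1 [C2 _]].
  apply Rabs_le. unfold B in *; lra. }
assert (Kclose : forall j, (1 <= j <= L)%nat ->
  Rabs (INR (Kj j t) - sig j) <= INR L).
{ intros j Hj. destruct (sig_spec j) as [Hs Es]; [lia|].
  destruct (Kj_bounds j (sig j)) as [K1 K2]; [lia|exact Hs|exact Es|].
  assert (INR j <= INR L) by (apply le_INR; lia). apply Rabs_le. lra. }
pose proof (Tclose L ltac:(lia)) as T1.
pose proof (rsum_close (fun i => tail (du x a b) (S i)) (fun i => r * sqrt (INR (S i)))
  (3 * INR L * B) l (fun i Hi => Tclose (S i) (Hle i Hi))) as T2.
assert (T3 : Rabs (rsum (fun i => INR (S i) * INR (cut x a b (S i))) l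
  - rsum (fun i => r * sqrt (INR (S i))) l) <= INR l * (INR L * B)).
{ apply rsum_close. intros i Hi. rewrite <- j_s_eq by lia.
  rewrite <- Rmult_minus_distr_l, Rabs_mult. pose proof (HleR i Hi).
  rewrite (Rabs_pos_eq (INR (S i))) by lra.
  apply Rmult_le_compat; try apply Rabs_pos; [lra|lra|]. apply Cclose; lia. }
pose proof (Cclose L HL1) as T4.
pose proof (Kclose L ltac:(lia)) as T5.
pose proof (rsum_close (fun i => INR (Kj (S i) t)) (fun i => sig (S i)) (INR L) l
  (fun i Hi => Kclose (S i) (Hle i Hi))) as T6.
assert (EK : c * rsum (fun i => sig (S i)) l = rsum (fun i => r * sqrt (INR (S i))) l).
{ rewrite <- rsum_scal. apply rsum_ext; intros; apply c_sig_eq. }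
(* The sum of squares up to K_L is close to [sig L]^3 / 3, and c [sig L]^3 / (3 t) = r L sqrt L / 3
   because [sig L]^2 = L t and c [sig L] = r sqrt L. *)
assert (T7 : Rabs (c / t * rsum (fun i => INR (S i) ^ 2) (Kj L t)
   - r * (INR L * sqrt (INR L)) / 3) <= 4 * INR L ^ 2 * c).
{ rewrite rsum_sqr. pose proof (Kj_le_sig L ltac:(lia)) as HK.
  pose proof (c_sig_eq L) as Ecs.
  pose proof (pos_INR (Kj L t)) as HK0. apply Rabs_le_between in T5.
  replace (r * (INR L * sqrt (INR L)) / 3) with (c / t * (sig L ^ 3 / 3)).
  2:{ replace (sig L ^ 3) with (sig L * sig L ^ 2) by ring. rewrite EsL.
      replace (r * (INR L * sqrt (INR L)) / 3) with (r * sqrt (INR L) * INR L / 3) by field.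
      rewrite <- Ecs. field. lra. }
  rewrite <- Rmult_minus_distr_l, Rabs_mult.
  assert (Hct : 0 < c / t) by (apply Rdiv_lt_0_compat; lra).
  rewrite (Rabs_pos_eq (c / t)) by lra.
  replace (4 * INR L ^ 2 * c) with (c / t * (4 * INR L * (INR L * t))) by (field; lra).
  apply Rmult_le_compat_l; [lra|]. rewrite <- EsL.
  set (k := INR (Kj L t)) in *. set (w := sig L) in *. set (z := INR L) in *.
  replace (k ^ 3 / 3 + k ^ 2 / 2 + k / 6 - w ^ 3 / 3)
    with ((k - w) * (k ^ 2 + k * w + w ^ 2) / 3 + (k ^ 2 / 2 + k / 6)) by field.
  assert (Hk2 : 0 <= k ^ 2 <= 4 * w ^ 2).
  { split; [apply pow2_ge_0|].
    replace (4 * w ^ 2) with ((2 * w) ^ 2) by ring. apply pow_incr; lra. }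
  assert (Hkw : 0 <= k * w <= 2 * w ^ 2) by nra.
  assert (Hw2 : w <= w ^ 2) by nra.
  assert (Hq : 0 <= k ^ 2 + k * w + w ^ 2 <= 7 * w ^ 2) by lra.
  set (q := k ^ 2 + k * w + w ^ 2) in *.
  assert (Hb : - (7 * z * w ^ 2) <= (k - w) * q <= 7 * z * w ^ 2) by (split; nra).
  assert (2 * w ^ 2 <= z * w ^ 2) by (apply Rmult_le_compat_r; lra).
  apply Rabs_le. lra. }
unfold sqrt_defect.
replace (rsum (fun i => sqrt (INR (S i))) L)
  with (rsum (fun i => sqrt (INR (S i))) l + sqrt (INR L)) by reflexivity.
pose proof (rsum_scal r (fun i => sqrt (INR (S i))) l) as ES.
set (SQ := rsum (fun i => sqrt (INR (S i))) l) in *.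
rewrite ES in *. clear ES.
pose proof (j_s_eq L HL1) as EsL2. pose proof (c_sig_eq L) as Ecs.
set (q := sqrt (INR L)) in *.
set (A1 := tail (du x a b) L) in *.
set (A2 := rsum (fun i => tail (du x a b) (S i)) l) in *.
set (A3 := rsum (fun i => INR (S i) * INR (cut x a b (S i))) l) in *.
set (A4 := INR (cut x a b L)) in *.
set (A5 := INR (Kj L t)) in *.
set (A6 := rsum (fun i => INR (Kj (S i) t)) l) in *.
set (A7 := rsum (fun i => INR (S i) ^ 2) (Kj L t)) in *.
rewrite HlL in *.
set (z := INR L) in *.
(* The main values add up to r (16/3 z q - 4 q - 8 SQ), where 16/3 is 6 - 2/3; and - 4 q is 4 q - 8
   q, as the sum in [sqrt_defect] includes the term L. *)
match goal with |- Rabs ?e <= _ => replace e with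
  ((2 * z - 1) * (A1 - r * q) - 2 * (A2 - r * SQ) - 4 * (A3 - r * SQ)
   + 2 * (z - 1) * z * (A4 - s L) + (2 * z - 1) * (c * (A5 - sig L))
   - 2 * (c * (A6 - rsum (fun i => sig (S i)) l))
   - 2 * (c / t * A7 - r * (z * q) / 3)) end.
2:{ replace (2 * (z - 1) * z * (A4 - s L))
      with (2 * (z - 1) * (z * A4) - 2 * (z - 1) * (z * s L)) by ring.
    rewrite EsL2.
    replace (c * (A5 - sig L)) with (c * A5 - c * sig L) by ring. rewrite Ecs.
    replace (c * (A6 - rsum (fun i => sig (S i)) l))
      with (c * A6 - c * rsum (fun i => sig (S i)) l) by ring. rewrite EK.
    field. lra. }
apply Rabs_le_between in T1, T2, T3, T4, T5, T6, T7.
assert (Hz2 : z <= z ^ 2 / 2) by nra.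
assert (HzB : 0 <= z * B) by nra.
assert (Hz2B : 0 <= z ^ 2 * B) by nra.
assert (P1 : - (6 * z ^ 2 * B) <= (2 * z - 1) * (A1 - r * q) <= 6 * z ^ 2 * B).
{ replace (6 * z ^ 2 * B) with (2 * z * (3 * z * B)) by ring. split; nra. }
assert (P2 : - (3 * z ^ 2 * B) <= A2 - r * SQ <= 3 * z ^ 2 * B) by (split; nra).
assert (P3 : - (z ^ 2 * B) <= A3 - r * SQ <= z ^ 2 * B) by (split; nra).
assert (P4 : - (2 * z ^ 2 * B) <= 2 * (z - 1) * z * (A4 - s L) <= 2 * z ^ 2 * B).
{ assert (0 <= 2 * (z - 1) * z <= 2 * z ^ 2) by nra. split; nra. }
assert (P5 : - (2 * z ^ 2 * B) <= (2 * z - 1) * (c * (A5 - sig L)) <= 2 * z ^ 2 * B).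
{ assert (- (B * z) <= c * (A5 - sig L) <= B * z) by (split; nra).
  assert (0 <= 2 * z - 1 <= 2 * z) by lra. split; nra. }
assert (P6 : - (z ^ 2 * B) <= c * (A6 - rsum (fun i => sig (S i)) l) <= z ^ 2 * B).
{ assert (- z ^ 2 <= A6 - rsum (fun i => sig (S i)) l <= z ^ 2) by (split; nra).
  split; nra. }
assert (P7 : 4 * z ^ 2 * c <= 4 * z ^ 2 * B) by nra.
apply Rabs_le. lra.
Qed.

(** The dropped n contribute at most s L + 1 and the last block about 5 s L; all other errors are of
    order L^2 B. *)
Lemma core_close :
  Rabs (rsum term N - (r * sqrt_defect L + rsum (fun j => Rj j x a b) (S L)))
    <= 6 * s L + 90 * INR L ^ 2 * B.
Proof.
assert (HL1 : (1 <= L)%nat) by (unfold L; lia).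
pose proof L_ge_2 as HL2. assert (HB : 1 < B) by (unfold B; lra).
assert (HlL : INR l = INR L - 1) by (unfold L; rewrite S_INR; ring).
assert (HW : 0 <= rsum term (cut x a b L) <= s L + 1).
{ split; [apply rsum_ge_0; intros; apply Rabs_pos|].
  destruct (s_spec L HL1) as [Hs Es].
  destruct (cut_bounds L (s L) HL1 Hs Es) as [_ [C _]].
  apply Rle_trans with (2 := C).
  rewrite <- (Rmult_1_r (INR _)), <- rsum_const. apply rsum_le; intros n _.
  unfold term. pose proof (frac_part_bounds (x / (INR n + a))).
  pose proof (frac_part_bounds (x / (INR n + b))). apply Rabs_le. lra. }
pose proof term_sum as E1. pose proof main_close as E2. pose proof Y_Z_close as E3.
pose proof last_block_bound as E4. pose proof R0_close as E5.
rewrite rsum_shift.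
assert (E6 : rsum (fun i => Rj (S i) x a b) L = Gs (Kj (S L) t) + Gs (Kj L t) - Gs (Kj 1 t)
  - INR L * Ds (Kj (S L) t) - INR l * Ds (Kj L t)
  + 2 * rsum (fun i => Ds (Kj (S i) t)) l) by apply sum_Rj.
rewrite E6.
(* The pairs with k <= K_j that lie before [cut j]; their weighted total over j <= L is O(L^2 B). *)
set (X := fun j => Q j - tail (dm x a b) j).
assert (HXL : 0 <= X L <= (2 * INR L + 1) * B) by (apply excess_bounds; lia).
assert (HX : 0 <= rsum (fun i => X (S i)) l <= INR l * ((2 * INR L + 1) * B)).
{ rewrite <- rsum_const.
  split; [apply rsum_ge_0|apply rsum_le]; intros i Hi;
  destruct (excess_bounds (S i)) as [X1 X2]; try (unfold L; lia).
  - exact X1.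
  - apply Rle_trans with (1 := X2). apply Rmult_le_compat_r; [lra|].
    assert (INR (S i) <= INR L) by (apply le_INR; unfold L; lia). lra. }
assert (EX : rsum (fun i => tail (dm x a b) (S i)) l
  = c * rsum (fun i => INR (Kj (S i) t)) l - rsum (fun i => Ds (Kj (S i) t)) l
    - rsum (fun i => X (S i)) l).
{ rewrite <- rsum_scal, <- !rsum_minus. apply rsum_ext; intros i _. unfold X, Q. ring. }
assert (EL : tail (dm x a b) L = c * INR (Kj L t) - Ds (Kj L t) - X L)
  by (unfold X, Q; ring).
assert (EZ : Z = c / t * rsum (fun i => INR (S i) ^ 2) (Kj L t) - Gs (Kj L t)).
{ unfold Z, Gs. rewrite <- rsum_scal, <- rsum_minus. apply rsum_ext; intros i _.
  unfold Rdiv. ring. }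
assert (EP : rsum (fun i => tail (dm x a b) L - tail (dm x a b) (S i)) l
  = INR l * tail (dm x a b) L - rsum (fun i => tail (dm x a b) (S i)) l)
  by (rewrite rsum_minus, rsum_const; reflexivity).
rewrite EP in E1.
assert (EA : rsum (fun i => 2 * (tail (du x a b) L - tail (du x a b) (S i))
    - 4 * INR (S i) * (INR (cut x a b (S i)) - INR (cut x a b L))) l
  = 2 * (INR l * tail (du x a b) L) - 2 * rsum (fun i => tail (du x a b) (S i)) l
    - 4 * rsum (fun i => INR (S i) * INR (cut x a b (S i))) l
    + 2 * INR L * (INR L - 1) * INR (cut x a b L)).
{ replace (2 * INR L * (INR L - 1) * INR (cut x a b L))
    with (4 * INR (cut x a b L) * rsum (fun i => INR (S i)) l)
    by (rewrite rsum_INR, HlL; field).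
  rewrite <- rsum_const, <- !rsum_scal, <- !rsum_minus, <- rsum_plus.
  apply rsum_ext; intros; ring. }
rewrite EA, EX, EL, HlL in E1. rewrite HlL in *.
replace (Y - Z) with (Y - (c / t * rsum (fun i => INR (S i) ^ 2) (Kj L t) - Gs (Kj L t)))
  in E3 by (rewrite EZ; ring).
apply Rabs_le_between in E2, E3, E4, E5.
assert (HX1 : 0 <= (2 * INR L - 1) * X L <= 4 * INR L ^ 2 * B).
{ split; [apply Rmult_le_pos; lra|].
  apply Rle_trans with ((2 * INR L - 1) * ((2 * INR L + 1) * B)).
  - apply Rmult_le_compat_l; lra.
  - nra. }
assert (HX2 : (INR L - 1) * ((2 * INR L + 1) * B) <= 2 * INR L ^ 2 * B) by nra.
assert (HL2B : 2 * (INR L * B) <= INR L ^ 2 * B).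
{ replace (INR L ^ 2 * B) with (INR L * (INR L * B)) by ring.
  apply Rmult_le_compat_r; [|lra]. apply Rmult_le_pos; lra. }
assert (HL1B : 2 * 1 <= INR L * B) by (apply Rmult_le_compat; lra).
pose proof (s_spec L HL1) as [Hs _].
replace (c * ((2 * INR L - 1) * INR (Kj L t) - 2 * rsum (fun i => INR (Kj (S i) t)) l
       - 2 / t * rsum (fun i => INR (S i) ^ 2) (Kj L t)))
  with ((2 * INR L - 1) * (c * INR (Kj L t)) - 2 * (c * rsum (fun i => INR (Kj (S i) t)) l)
    - 2 * (c / t * rsum (fun i => INR (S i) ^ 2) (Kj L t))) in E2
  by (unfold Rdiv; ring).
apply Rabs_le. split; lra.
Qed.

End Counting.

(** * Passage to the series W, and the choice of J *)

Lemma W_close (x a b X e : R) (N0 : nat) : 0 < x -> 0 < a -> a < b ->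
  (forall N, (N0 <= N)%nat -> Rabs (rsum (fun n =>
     Rabs (frac_part (x / (INR n + a)) - frac_part (x / (INR n + b)))) N - X) <= e) ->
  Rabs (W x a b - X) <= e.
Proof.
intros Hx Ha Hab H.
set (term := fun n => Rabs (frac_part (x / (INR n + a)) - frac_part (x / (INR n + b)))) in *.
assert (HW : is_lim_seq (fun n => rsum term (S (n + N0))) (W x a b)).
{ apply (is_lim_seq_ext (fun n => sum_n term (n + N0))).
  - intros n. unfold sum_n. apply sum_n_m_0_rsum.
  - apply (is_lim_seq_incr_n (sum_n term) N0). apply Series_correct.
    apply ex_series_W; assumption. }
assert (HB : forall n, X - e <= rsum term (S (n + N0)) <= X + e).
{ intros n. specialize (H (S (n + N0)) ltac:(lia)). apply Rabs_le_between in H. lra. }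
assert (H1 : X - e <= W x a b).
{ apply (is_lim_seq_le (fun _ => X - e) (fun n => rsum term (S (n + N0)))
    (Finite (X - e)) (Finite (W x a b))); [apply HB|apply is_lim_seq_const|exact HW]. }
assert (H2 : W x a b <= X + e).
{ apply (is_lim_seq_le (fun n => rsum term (S (n + N0))) (fun _ => X + e)
    (Finite (W x a b)) (Finite (X + e))); [apply HB|exact HW|apply is_lim_seq_const]. }
apply Rabs_le. lra.
Qed.

Lemma pow_Rpower (y e : R) (n : nat) : Rpower y e ^ n = Rpower y (e * INR n).
Proof. rewrite <- Rpower_pow by apply exp_pos. apply Rpower_mult. Qed.

Lemma Rpower_INR (y e : R) (n : nat) : 0 < y -> e = INR n -> Rpower y e = y ^ n.
Proof. intros Hy ->. apply Rpower_pow, Hy. Qed.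

(** With [J_sqr], this is all that is used about the real powers: afterwards J and the error term
    are only known through two polynomial relations. *)
Lemma J_pow_5 (c B x : R) : 0 < c -> 0 < B -> 0 < x ->
  (Rpower c (3 / 5) * Rpower B (- (4 / 5)) * Rpower x (1 / 5)) ^ 5 * B ^ 4 = c ^ 3 * x.
Proof.
intros Hc HB Hx. rewrite !Rpow_mult_distr, !pow_Rpower.
rewrite (Rpower_INR c _ 3) by (simpl; lra || field).
replace (- (4 / 5) * INR 5) with (- INR 4) by (simpl; field).
rewrite Rpower_Ropp, Rpower_pow by exact HB.
rewrite (Rpower_INR x _ 1) by (simpl; lra || field).
field. lra.
Qed.

Lemma J_sqr (c B x : R) : 0 < c -> 0 < B -> 0 < x ->
  (Rpower c (3 / 5) * Rpower B (- (4 / 5)) * Rpower x (1 / 5)) ^ 2 * B ^ 2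
  = c * (Rpower B (2 / 5) * Rpower c (1 / 5) * Rpower x (2 / 5)).
Proof.
intros Hc HB Hx. rewrite !Rpow_mult_distr, !pow_Rpower.
replace (3 / 5 * INR 2) with (1 + 1 / 5) by (simpl; field).
replace (2 / 5) with (- (4 / 5) * INR 2 + INR 2) by (simpl; field).
replace (- (4 / 5) * INR 2 + INR 2) with (1 / 5 * INR 2) at 2 by (simpl; field).
rewrite !Rpower_plus, Rpower_1, Rpower_pow by assumption. ring.
Qed.

Theorem mainTheorem1 :
  exists M : R, 0 < M /\
  forall x a b : R, 0 < a -> a < b ->
  let c := b - a in
  40 * / c ^ 3 * (1 + b) ^ 4 <= x ->
  let J := Rpower c (3 / 5) * Rpower (1 + b) (- (4 / 5)) * Rpower x (1 / 5) in
  Rabs (W x a b - (2 / PI * zeta (3 / 2) * sqrt (c * x) + calR J x a b))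
    <= M * (Rpower (1 + b) (2 / 5) * Rpower c (1 / 5) * Rpower x (2 / 5)).
Proof.
(* With s <= 2 E, the bound 6 s + 90 z^2 B gives 12 + 90, and the replacement of [sqrt_defect] by
   its limit costs s / 2, one more E. *)
exists 103. split; [lra|].
intros x a b Ha Hab c Hx40 J.
assert (Hc : 0 < c) by (unfold c; lra).
set (B := 1 + b) in *.
assert (HB : 1 < B) by (unfold B; lra).
assert (HcB : c < B) by (unfold c, B; lra).
assert (Hc3 : 0 < c ^ 3) by (apply pow_lt, Hc).
assert (HB4 : 0 < B ^ 4) by (apply pow_lt; lra).
assert (Hx : 0 < x).
{ apply Rlt_le_trans with (2 := Hx40).
  apply Rmult_lt_0_compat; [|exact HB4].
  apply Rmult_lt_0_compat; [lra|]. apply Rinv_0_lt_compat, Hc3. }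
set (E := Rpower B (2 / 5) * Rpower c (1 / 5) * Rpower x (2 / 5)).
assert (HJ0 : 0 < J) by (repeat apply Rmult_lt_0_compat; apply exp_pos).
assert (HE0 : 0 < E) by (repeat apply Rmult_lt_0_compat; apply exp_pos).
assert (E5 : J ^ 5 * B ^ 4 = c ^ 3 * x) by (apply J_pow_5; lra).
assert (E2 : J ^ 2 * B ^ 2 = c * E) by (apply J_sqr; lra).
(* The hypothesis on x says J^5 >= 40 > 2^5, so L >= 2. *)
assert (HJ : 2 <= J).
{ apply Rnot_lt_le. intros HJ2.
  assert (H32 : J ^ 5 <= 2 ^ 5) by (apply pow_incr; lra).
  assert (H40 : 40 * B ^ 4 <= c ^ 3 * x).
  { apply Rle_trans with (c ^ 3 * (40 * / c ^ 3 * B ^ 4)).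
    - right. field. lra.
    - apply Rmult_le_compat_l; lra. }
  rewrite <- E5 in H40. apply Rmult_le_reg_r in H40; [|exact HB4].
  simpl in H32, H40. lra. }
destruct (nat_floor J ltac:(lra)) as [L [EL [HLJ HJL]]].
assert (HL : Z.to_nat (Int_part J) = L).
{ rewrite INR_IZR_INZ in EL. apply eq_IZR in EL. rewrite <- EL. apply Nat2Z.id. }
assert (HL2 : (2 <= L)%nat).
{ assert (H : INR 1 < INR L) by (simpl; lra). apply INR_lt in H. lia. }
assert (HL2R : 2 <= INR L) by (apply (le_INR 2); exact HL2).
destruct L as [|l]; [lia|].
set (z := INR (S l)) in *.
assert (HJ2 : 4 <= J ^ 2) by (replace 4 with (2 ^ 2) by ring; apply pow_incr; lra).
assert (HJ4 : 16 <= J ^ 4) by (replace 16 with (2 ^ 4) by ring; apply pow_incr; lra).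
assert (Hc2B2 : c ^ 2 <= B ^ 2) by (apply pow_incr; lra).
assert (Hc4B4 : c ^ 4 <= B ^ 4) by (apply pow_incr; lra).
assert (Hc2 : 0 < c ^ 2) by (apply pow_lt, Hc).
assert (Hcx : c ^ 2 * (c * x) = J ^ 5 * B ^ 4) by (rewrite E5; ring).
assert (C1 : 16 * B ^ 2 * z <= c * x).
{ apply (Rmult_le_reg_l (c ^ 2)); [exact Hc2|]. rewrite Hcx.
  replace (c ^ 2 * (16 * B ^ 2 * z)) with (16 * z * (c ^ 2 * B ^ 2)) by ring.
  replace (J ^ 5 * B ^ 4) with (J ^ 4 * J * (B ^ 2 * B ^ 2)) by ring.
  pose proof (pow2_ge_0 B).
  apply Rmult_le_compat; [lra|apply Rmult_le_pos; lra| |apply Rmult_le_compat_r; lra].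
  apply Rmult_le_compat; lra. }
assert (C2 : 4 * z ^ 3 <= x / c).
{ apply (Rmult_le_reg_l (c ^ 4)); [apply pow_lt, Hc|].
  replace (c ^ 4 * (x / c)) with (J ^ 5 * B ^ 4) by (rewrite E5; field; lra).
  replace (c ^ 4 * (4 * z ^ 3)) with (4 * z ^ 3 * c ^ 4) by ring.
  replace (J ^ 5 * B ^ 4) with (J ^ 2 * J ^ 3 * B ^ 4) by ring.
  assert (0 <= z ^ 3) by (apply pow_le; lra).
  assert (z ^ 3 <= J ^ 3) by (apply pow_incr; lra).
  apply Rmult_le_compat; [lra|apply pow_le; lra| |lra].
  apply Rmult_le_compat; lra. }
set (s := sqrt (c * x / z)).
assert (Hcx0 : 0 < c * x) by (apply Rmult_lt_0_compat; lra).
(* E^2 = c x / J, and J < z + 1 <= 4 z for the floor z of J. *)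
assert (Hs : s <= 2 * E).
{ replace (2 * E) with (sqrt ((2 * E) ^ 2)) by (apply sqrt_pow2; lra).
  apply sqrt_le_1_alt. apply Rle_div_l; [lra|].
  apply (Rmult_le_reg_l (c ^ 2)); [exact Hc2|]. rewrite Hcx.
  replace (c ^ 2 * ((2 * E) ^ 2 * z)) with (4 * (c * E) ^ 2 * z) by ring.
  rewrite <- E2.
  replace (4 * (J ^ 2 * B ^ 2) ^ 2 * z) with (J ^ 4 * (4 * z) * B ^ 4) by ring.
  replace (J ^ 5) with (J ^ 4 * J) by ring.
  apply Rmult_le_compat_r; [lra|]. apply Rmult_le_compat_l; lra. }
assert (HzB : z ^ 2 * B <= E).
{ apply (Rmult_le_reg_l c); [exact Hc|]. rewrite <- E2.
  replace (c * (z ^ 2 * B)) with (z ^ 2 * (c * B)) by ring.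
  replace (J ^ 2 * B ^ 2) with (J ^ 2 * (B * B)) by ring.
  apply Rmult_le_compat; [apply pow2_ge_0| | |].
  - apply Rmult_le_pos; lra.
  - apply pow_incr; lra.
  - apply Rmult_le_compat_r; lra. }
(* Any N above x + c x exceeds both x and c x, as the truncation requires. *)
destruct (nfloor_ex (x + c * x) ltac:(lra)) as [r0 [_ Hr0]].
assert (Hcore : Rabs (W x a b - (sqrt (c * x) * sqrt_defect (S l) + calR J x a b))
  <= 6 * s + 90 * z ^ 2 * B).
{ apply (W_close x a b _ _ (S r0 + cut x a b 1) Hx Ha Hab). intros N HN.
  unfold calR. rewrite HL, sum_n_m_0_rsum.
  assert (HNR : INR (S r0) <= INR N) by (apply le_INR; lia). rewrite S_INR in HNR.
  apply (core_close x a b Ha Hab Hx l N); [lia|exact C1|exact C2|lra| |lia].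
  fold c. lra. }
pose proof (sqrt_defect_zeta (S l) ltac:(lia)) as Hz. fold z in Hz.
assert (Hmain : Rabs (sqrt (c * x) * sqrt_defect (S l)
  - 2 / PI * zeta (3 / 2) * sqrt (c * x)) <= s / 2).
{ replace (s / 2) with (sqrt (c * x) * (1 / 2 * / sqrt z)).
  - replace (sqrt (c * x) * sqrt_defect (S l) - 2 / PI * zeta (3 / 2) * sqrt (c * x))
      with (- (sqrt (c * x) * (2 / PI * zeta (3 / 2) - sqrt_defect (S l)))) by ring.
    pose proof (sqrt_pos (c * x)).
    rewrite Rabs_Ropp, Rabs_pos_eq by (apply Rmult_le_pos; lra).
    apply Rmult_le_compat_l; lra.
  - unfold s. rewrite sqrt_div_alt by lra. field.
    apply Rgt_not_eq, sqrt_lt_R0. lra. }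
apply Rabs_le_between in Hcore, Hmain. apply Rabs_le. lra.
Qed.
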